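(* Let $u_h(\omega,x,t),\eta_h(\omega,x,t)\in V_h^k$ be the numerical solutions of the semi-discrete DG method: for all $\varphi,\widetilde\varphi\in V_h^k$ and all cells $I_j$, $$\int_{I_j}d\eta_h\,\varphi\,dx=\Big(\int_{I_j}u_h\varphi_x\,dx-(\check u_h\varphi^-)_{j+\frac12}+(\check u_h\varphi^+)_{j-\frac12}\Big)dt-\int_{I_j}\lambda_1\varphi\,dW_t\,dx,$$ $$\int_{I_j}du_h\,\widetilde\varphi\,dx=\Big(\int_{I_j}\eta_h\widetilde\varphi_x\,dx-(\check\eta_h\widetilde\varphi^-)_{j+\frac12}+(\check\eta_h\widetilde\varphi^+)_{j-\frac12}\Big)dt+\int_{I_j}\lambda_2\widetilde\varphi\,dW_t\,dx,$$ with numerical fluxes $\check u_h=\{u_h\}+\alpha[u_h]$, $\check\eta_h=\{\eta_h\}-\alpha[\eta_h]$, where $\alpha\in[-1,1]$ is a non-zero constant, under periodic boundary conditions. (a) For any $t\in[0,T]$, $$\|u_h(\omega,x,t)\|^2+\|\eta_h(\omega,x,t)\|^2=2\int_0^t\int_I(\lambda_2u_h-\lambda_1\eta_h)\,dW_s\,dx+\|u_h(x,0)\|^2+\|\eta_h(x,0)\|^2+(\lambda_1^2+\lambda_2^2)Kt$$ and $$\mathbb{E}\Big(\|u_h(\omega,x,t)\|^2+\|\eta_h(\omega,x,t)\|^2\Big)=\|u_h(x,0)\|^2+\|\eta_h(x,0)\|^2+(\lambda_1^2+\lambda_2^2)Kt,$$ with $$K=\sum_{j=1}^N\sum_{l=0}^k\mu_j^l\sum_{m=1}^\infty\Big(\int_{I_j}\phi_j^l\sqrt{\gamma_m}\,e_m\,dx\Big)^2,$$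 where $\{\phi_j^l:\ l=0,\dots,k\}$ is the (orthogonal) Legendre basis of $P^k(I_j)$ and $\mu_j^l=\big(\int_{I_j}(\phi_j^l)^2dx\big)^{-1}$. (b) The constant $K$ is bounded by $(k+1)\mathrm{Tr}(Q)$. Moreover, if there exists some constant $\beta>0$ such that $\sum_{m=1}^\infty\gamma_m(K_m)^\beta<\infty$ with $K_m=\|(e_m)_x\|_\infty$, then $K=\mathrm{Tr}(Q)+O(h^\beta)$.
   Context: The method discretizes $d\eta=-u_x\,dt-\lambda_1\,dW_t$, $du=-\eta_x\,dt+\lambda_2\,dW_t$ on a bounded interval $I$, with constants $\lambda_1,\lambda_2\in\mathbb{R}$. The interval $I$ is partitioned into cells $I_j=[x_{j-\frac12},x_{j+\frac12}]$, $j=1,\dots,N$, with $h_j=x_{j+\frac12}-x_{j-\frac12}$, $h=\max_jh_j$, and $h/h_j$ bounded over all $j$ (uniformly under mesh refinement). $V_h^k=\{v: v|_{I_j}\in P^k(I_j),\ j=1,\dots,N\}$, where $P^k(I_j)$ is the space of polynomials of degree at most $k$ on $I_j$. $v^\pm_{j+\frac12}$ denote the right ($+$) and left ($-$) limits of $v$ at $x_{j+\frac12}$, $\{v\}=\frac12(v^++v^-)$ and $[v]=v^+-v^-$; traces at the end points of $I$ are defined by periodicity. $\|\cdot\|$ is the $L^2(I)$ norm. $W_t=\sum_{m\ge1}\sqrt{\gamma_m}\,e_m(x)\mathcal{B}_m(t,\omega)$ is a $Q$-Wiener process on $(\Omega,\mathcal{F},\mathbb{P})$, with $\{e_m\}$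 an orthonormal basis of $L^2(I)$, $Q$ symmetric non-negative, $Qe_m=\gamma_me_m$, $\mathrm{Tr}(Q)=\sum_m\gamma_m<\infty$, and $\mathcal{B}_m$ independent standard Brownian motions. Stochastic differentials are in the It\^o sense and $\int_0^t\int_If\,dW_s\,dx=\sum_m\sqrt{\gamma_m}\int_0^t(\int_Ife_m\,dx)\,d\mathcal{B}_m(s)$. The initial data $u_h(x,0),\eta_h(x,0)$ are deterministic. $O(h^\beta)$ refers to $h\to0$, with constant independent of $h$.
   Formalization: In (b) the conclusion K = Tr(Q) + O(h^β) is proved as K = Tr(Q) + O(h^{min(β,2)}), because the claim fails for β > 2 (e.g. k = 0 and a single cosine mode give a difference of exact order h²); for β ≤ 2 it is unchanged. *)

(* Defs.v *)
From HB Require Import structures.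
From mathcomp Require Import all_boot all_order all_algebra.
From mathcomp Require Import all_classical all_reals all_analysis.

Set Implicit Arguments.
Unset Strict Implicit.
Unset Printing Implicit Defensive.

Import Order.TTheory GRing.Theory Num.Theory.
Import numFieldNormedType.Exports.

Local Open Scope classical_set_scope.
Local Open Scope ring_scope.

Section L2.
Context {R : realType}.
Local Notation mu := (@lebesgue_measure R).

Definition L2fun (a b : R) (f : R -> R) : Prop :=
  measurable_fun `[a, b] f /\
  mu.-integrable `[a, b] (fun x => (f x ^+ 2)%:E).

Definition dotL2 (a b : R) (f g : R -> R) : R :=
  \int[mu]_(x in `[a, b]) (f x * g x).

(* The family is indexed from 0 instead of 1. *)
Definition orthonormal_basis (a b : R) (e : nat -> R -> R) : Prop :=
  [/\ forall m, L2fun a b (e m),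
      forall m n, dotL2 a b (e m) (e n) = (m == n)%:R &
      forall f, L2fun a b f ->
        (fun n => \int[mu]_(x in `[a, b])
           (f x - \sum_(m < n) dotL2 a b f (e m) * e m x) ^+ 2)
          @ \oo --> (0 : R)].

Definition eq_on_ae (a b : R) (f g : R -> R) : Prop :=
  {ae mu, forall x, `[a, b]%classic x -> f x = g x}.

(* The operators on L^2(I) are given on representatives; all the identities
   between functions hold almost everywhere on I. *)
Record covariance_operator (a b : R) (e : nat -> R -> R) (gamma : nat -> R)
    (Q : (R -> R) -> (R -> R)) : Prop := CovarianceOperator {
  cov_L2 : forall f, L2fun a b f -> L2fun a b (Q f);
  cov_linear : forall c f g, L2fun a b f -> L2fun a b g ->
    eq_on_ae a b (Q (fun x => c * f x + g x)) (fun x => c * Q f x + Q g x);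
  cov_sym : forall f g, L2fun a b f -> L2fun a b g ->
    dotL2 a b (Q f) g = dotL2 a b f (Q g);
  cov_ge0 : forall f, L2fun a b f -> 0 <= dotL2 a b (Q f) f;
  cov_eigen : forall m, eq_on_ae a b (Q (e m)) (fun x => gamma m * e m x);
  cov_trace_class : cvgn (series gamma) }.

Definition traceQ (a b : R) (e : nat -> R -> R) (Q : (R -> R) -> (R -> R))
  : R := limn [series dotL2 a b (Q (e m)) (e m)]_m.

(* The classical derivative is used, on the interior of I only; the value may
   be +oo. *)
Definition deriv_sup_norm (a b : R) (f : R -> R) : \bar R :=
  ereal_sup [set `|derive1 f x|%:E | x in `]a, b[].

End L2.

Section Brownian.
Context {R : realType} {d : measure_display} {Omega : measurableType d}.
Variable P : probability Omega R.

Definition rv_events (X : Omega -> R) : set (set Omega) :=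
  preimage_set_system setT X measurable.

(* Used for classes of events containing the sure event only. *)
Definition indep_events (n : nat) (F : nat -> set (set Omega)) : Prop :=
  forall E : nat -> set Omega, (forall i, (i < n)%N -> F i (E i)) ->
    P (\bigcap_(i in `I_n) E i) = (\prod_(i < n) P (E i))%E.

Record brownian_motion (B : R -> Omega -> R) : Prop := BrownianMotion {
  bm_rv : forall t, 0 <= t -> measurable_fun setT (B t);
  bm_0 : {ae P, forall w, B 0 w = 0};
  bm_indep : forall (n : nat) (tau : nat -> R),
    0 <= tau 0%N -> (forall i, tau i <= tau i.+1) ->
    indep_events n (fun i => rv_events (fun w => B (tau i.+1) w - B (tau i) w));
  bm_normal : forall s t, 0 <= s -> s < t ->
    forall V : set R, measurable V ->
      P ((fun w => B t w - B s w) @^-1` V) = normal_prob 0 (Num.sqrt (t - s)) V;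
  bm_cont : {ae P, forall w, {within `[0, +oo[, continuous (fun t => B t w)}} }.

Definition process_sigma (B : R -> Omega -> R) : set (set Omega) :=
  <<s [set A | exists2 s, 0 <= s & rv_events (B s) A] >>.

Definition independent_brownian_motions (B : nat -> R -> Omega -> R) : Prop :=
  (forall m, brownian_motion (B m)) /\
  (forall n, indep_events n (fun m => process_sigma (B m))).

End Brownian.

Section Ito.
Context {R : realType} {d : measure_display} {Omega : measurableType d}.
Variable P : probability Omega R.
Variable B : nat -> R -> Omega -> R.
Local Notation mu := (@lebesgue_measure R).

Definition filtration (t : R) : set (set Omega) :=
  <<s [set A | exists m s, 0 <= s <= t /\ rv_events (B m s) A] >>.

(* The process with value el_coef i on [el_time i, el_time i.+1[, i < el_size *)
Record elementary := Elementary {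
  el_size : nat;
  el_time : nat -> R;
  el_coef : nat -> Omega -> R }.

Definition elementary_on (t : R) (f : elementary) : Prop :=
  [/\ el_time f 0 = 0, el_time f (el_size f) = t,
      forall i, (i < el_size f)%N -> el_time f i <= el_time f i.+1,
      forall i, (i < el_size f)%N ->
        rv_events (el_coef f i) `<=` filtration (el_time f i) &
      forall i, (i < el_size f)%N ->
        ('E_P[fun w => (el_coef f i w ^+ 2)%R] < +oo)%E].

Definition elementary_val (f : elementary) (w : Omega) (s : R) : R :=
  \sum_(i < el_size f) el_coef f i w * \1_(`[el_time f i, el_time f i.+1[) s.

Definition elementary_int (W : R -> Omega -> R) (f : elementary) (w : Omega)
  : R :=
  \sum_(i < el_size f)
     el_coef f i w * (W (el_time f i.+1) w - W (el_time f i) w).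

(* [ito_integral m f t J]: the random variable J is (a version of)
   int_0^t f dB_m, i.e., the limit in L^2(Omega) of the integrals of elementary
   processes converging to f in L^2(Omega x [0, t]).  It determines J almost
   surely. *)
Definition ito_integral (m : nat) (f : Omega -> R -> R) (t : R)
    (J : Omega -> R) : Prop :=
  [/\ measurable_fun (setT `*` `[0, t]) (fun z : Omega * R => f z.1 z.2),
      measurable_fun setT J &
      exists g : nat -> elementary,
        [/\ forall n, elementary_on t (g n),
            (fun n => \int[P]_w \int[mu]_(s in `[0%R, t])
               (((f w s - elementary_val (g n) w s) ^+ 2)%R)%:E)%E
              @ \oo --> (0 : \bar R) &
            (fun n => 'E_P[fun w => ((J w - elementary_int (B m) (g n) w) ^+ 2)%R])%E
              @ \oo --> (0 : \bar R)]].

(* [wiener_integral a b e gamma f t S]: the random variable S is (a version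
   of) int_0^t int_I f dW_s dx, the sum in L^2(Omega) of the series of the
   sqrt(gamma_m) int_0^t (int_I f e_m dx) dB_m. *)
Definition wiener_integral (a b : R) (e : nat -> R -> R) (gamma : nat -> R)
    (f : Omega -> R -> R -> R) (t : R) (S : Omega -> R) : Prop :=
  measurable_fun setT S /\
  exists J : nat -> Omega -> R,
    (forall m, ito_integral m (fun w s => dotL2 a b (f w s) (e m)) t (J m)) /\
    (fun n => 'E_P[fun w =>
        ((S w - \sum_(m < n) Num.sqrt (gamma m) * J m w) ^+ 2)%R])%E
      @ \oo --> (0 : \bar R).

End Ito.

Section DG.
Context {R : realType}.
Local Notation mu := (@lebesgue_measure R).

(* The node x i stands for x_{i + 1/2} and the cell of index j : 'I_N is
   [x j, x j.+1]; cells are thus numbered from 0. *)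
Definition mesh (a b : R) (N : nat) (x : nat -> R) : Prop :=
  [/\ x 0%N = a, x N = b & forall j, (j < N)%N -> x j < x j.+1].

Definition cell_size (x : nat -> R) (j : nat) : R := x j.+1 - x j.

Definition mesh_size (N : nat) (x : nat -> R) : R :=
  \big[Num.max/0]_(j < N) cell_size x j.

(* A function of V_h^k is given by the family of its local polynomials. *)
Definition in_Vh (N k : nat) (v : 'I_N -> {poly R}) : Prop :=
  forall j, (size (v j) <= k.+1)%N.

(* The values at the nodes (set to 0) are immaterial in the integrals. *)
Definition Vh_fun (N : nat) (x : nat -> R) (v : 'I_N -> {poly R}) (y : R) : R :=
  \sum_(j < N) \1_(`]x j, x j.+1[) y * (v j).[y].

Definition Vh_sqnorm (a b : R) (N : nat) (x : nat -> R) (v : 'I_N -> {poly R})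
  : R := dotL2 a b (Vh_fun x v) (Vh_fun x v).

Definition cell_dot (x : nat -> R) (j : nat) (f g : R -> R) : R :=
  \int[mu]_(y in `[x j, x j.+1]) (f y * g y).

(* Traces at the right end point of the cell j: the interface j + 1/2.  The
   cyclic successor ordS implements periodicity, and the interface j - 1/2 is
   that of the cyclic predecessor ord_pred j. *)
Definition trace_m (N : nat) (x : nat -> R) (v : 'I_N -> {poly R}) (j : 'I_N)
  : R := (v j).[x j.+1].
Definition trace_p (N : nat) (x : nat -> R) (v : 'I_N -> {poly R}) (j : 'I_N)
  : R := (v (ordS j)).[x (ordS j)].

Definition avg (N : nat) x (v : 'I_N -> {poly R}) (j : 'I_N) : R :=
  (trace_p x v j + trace_m x v j) / 2.
Definition jump (N : nat) x (v : 'I_N -> {poly R}) (j : 'I_N) : R :=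
  trace_p x v j - trace_m x v j.
Definition flux (alpha : R) (N : nat) x (v : 'I_N -> {poly R}) (j : 'I_N) : R :=
  avg x v j + alpha * jump x v j.

Definition dg_drift (alpha : R) (N : nat) (x : nat -> R)
    (v phi : 'I_N -> {poly R}) (j : 'I_N) : R :=
  cell_dot x j (horner (v j)) (horner (phi j)^`())
  - flux alpha x v j * trace_m x phi j
  + flux alpha x v (ord_pred j) * trace_p x phi (ord_pred j).

(* Rodrigues formula, on [-1, 1] *)
Definition legendre (l : nat) : {poly R} :=
  (2 ^+ l * l`!%:R)^-1 *: (('X ^+ 2 - 1) ^+ l)^`(l).

Definition legendre_cell (x : nat -> R) (j l : nat) : {poly R} :=
  legendre l \Po ((2 / cell_size x j) *: ('X - ((x j + x j.+1) / 2)%:P)).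

Definition legendre_weight (x : nat -> R) (j l : nat) : R :=
  (cell_dot x j (horner (legendre_cell x j l))
                (horner (legendre_cell x j l)))^-1.

Definition Kconst (k : nat) (e : nat -> R -> R) (gamma : nat -> R)
    (N : nat) (x : nat -> R) : R :=
  \sum_(j < N) \sum_(l < k.+1) legendre_weight x j l *
    limn [series (cell_dot x j (horner (legendre_cell x j l))
                    (fun y => Num.sqrt (gamma m) * e m y)) ^+ 2]_m.

End DG.

Section Scheme.
Context {R : realType} {d : measure_display} {Omega : measurableType d}.
Variable P : probability Omega R.
Local Notation mu := (@lebesgue_measure R).

(* A measurable process with values in V_h^k, with almost surely continuous
   sample paths on [0, T] and initial value v0. *)
Definition Vh_process (N k : nat) (T : R) (v0 : 'I_N -> {poly R})
    (v : Omega -> R -> 'I_N -> {poly R}) : Prop :=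
  [/\ forall w t, 0 <= t <= T -> in_Vh k (v w t),
      forall w, v w 0 = v0,
      forall j l, measurable_fun (setT `*` `[0, T])
        (fun z : Omega * R => (v z.1 z.2 j)`_l) &
      {ae P, forall w, forall j l,
        {within `[0, T], continuous (fun t => (v w t j)`_l)}}].

(* [dg_equation lambda0 alpha z v]: the integrated form of
   int_{I_j} dz phi dx = drift(v, phi) dt + int_{I_j} lambda0 phi dW_t dx. *)
Definition dg_equation (a b : R) (e : nat -> R -> R) (gamma : nat -> R)
    (B : nat -> R -> Omega -> R) (N k : nat) (x : nat -> R) (T : R)
    (lambda0 alpha : R) (z v : Omega -> R -> 'I_N -> {poly R}) : Prop :=
  forall (phi : 'I_N -> {poly R}) (j : 'I_N) (t : R),
    in_Vh k phi -> 0 <= t <= T ->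
    exists S : Omega -> R,
      wiener_integral P B a b e gamma
        (fun _ _ y => lambda0 * (\1_(`[x j, x j.+1]) y * (phi j).[y])) t S /\
      {ae P, forall w,
        cell_dot x j (horner (z w t j)) (horner (phi j))
        - cell_dot x j (horner (z w 0 j)) (horner (phi j))
        = \int[mu]_(s in `[0, t]) dg_drift alpha x (v w s) phi j + S w}.

Record dg_solution (a b : R) (e : nat -> R -> R) (gamma : nat -> R)
    (B : nat -> R -> Omega -> R) (N k : nat) (x : nat -> R) (T : R)
    (lambda1 lambda2 alpha : R) (u0 eta0 : 'I_N -> {poly R})
    (u eta : Omega -> R -> 'I_N -> {poly R}) : Prop := DGSolution {
  dg_u_process : Vh_process k T u0 u;
  dg_eta_process : Vh_process k T eta0 eta;
  dg_eta_eq : dg_equation a b e gamma B k x T (- lambda1) alpha eta u;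
  dg_u_eq : dg_equation a b e gamma B k x T lambda2 (- alpha) u eta }.

End Scheme.

(* Main.v *)
Require Import Defs.
From HB Require Import structures.
From mathcomp Require Import all_boot all_order all_algebra.
From mathcomp Require Import all_classical all_reals all_analysis.
From mathcomp Require Import measurable_realfun normal_distribution ring lra.
Import Order.TTheory GRing.Theory Num.Theory.
Import numFieldNormedType.Exports.
Local Open Scope classical_set_scope.
Local Open Scope ring_scope.

(** In the orthonormal basis of normalized Legendre polynomials, the scheme is a
    finite linear system [dU = A U dt + dM] for the coordinates of [u] and [eta],
    driven by the additive noise [M] of the coordinates of the Wiener process.

    The matrix [A] is skew-symmetric ([dg_drift_skew]): the volume terms
    integrate to boundary terms at the interfaces, which the numerical fluxes
    cancel, because [eta^+ u^+ - eta^- u^- = {eta} [u] + {u} [eta]] and because the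
    penalties of the two equations have opposite signs. By Ito's formula the
    energy [|U|^2] thus has no drift besides the quadratic variation of [M],
    which is [(lambda1^2 + lambda2^2) K] per unit of time ([Kconst_coordinates]),
    and its martingale part is the integral of [2 U] against the noise. Its mean
    is therefore affine in time.

    This instance of Ito's formula is proved from the definition of the integral
    in [linear_energy_identity]. The explicit Euler scheme, on nested grids and with
    finitely many modes of the noise, converges to the solution in mean square
    ([euler_converges]); this needs a second moment for the solution, which is
    first obtained by localization ([solution_moment]). The scheme satisfies an
    exact energy identity ([euler_energy]), whose terms pass to the limit: the
    discrete stochastic integrals by Ito's isometry ([ito_isometry]), applied on a
    common refinement of two grids and to the tail of the series of modes, and
    the sum of the squared noises by the covariations of the Brownian motions
    along the grid ([quadratic_variation]). Both rest on the independence of an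
    increment from the past of all the motions ([past_indep]) and on the
    second and fourth moments of the normal law.

    The constant [K] is the sum of [gamma m * |Pi (e m)|^2], where [Pi] is the
    orthogonal projection on [V_h^k]. As [|e m| = 1], Bessel's inequality bounds
    it by the trace, and by Pythagoras the trace exceeds it by the sum of
    [gamma m * |e m - Pi (e m)|^2]. The projection error is at most 1, and it is at
    most the error of the piecewise constant interpolation at the midpoints, which
    the mean value theorem bounds by [(b - a) (h K_m)^2] ([captured_lipschitz]).
    Interpolation between the two bounds gives the order [min(beta, 2)]
    ([gap_rate]). *)

Set Implicit Arguments.
Unset Strict Implicit.
Unset Printing Implicit Defensive.

(** * Square-integrable functions and moment bounds *)

Section square_integrable.
Context {d : measure_display} {T : measurableType d} {R : realType}.
Variable mu : {measure set T -> \bar R}.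
Variables (D : set T) (mD : measurable D).
Implicit Types f g : T -> R.

Definition sqint f :=
  measurable_fun D f /\ mu.-integrable D (fun x => (f x ^+ 2)%:E).

Definition inner f g : R := \int[mu]_(x in D) (f x * g x).

Lemma sqint_mul f g : sqint f -> sqint g ->
  mu.-integrable D (fun x => (f x * g x)%:E).
Proof.
move=> [mf f2] [mg g2].
apply: (@le_integrable _ _ _ mu D mD _ (fun x => (f x ^+ 2)%:E + (g x ^+ 2)%:E)%E).
- by apply/measurable_EFinP; exact: measurable_funM.
- move=> x _; rewrite -EFinD !abse_EFin lee_fin [leRHS]ger0_norm; last first.
    by rewrite addr_ge0// sqr_ge0.
  by rewrite ler_norml; apply/andP; split; nra.
- exact: integrableD.
Qed.

Lemma sqintZ c f : sqint f -> sqint (fun x => c * f x).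
Proof.
move=> [mf f2]; split; first exact: measurable_funM.
rewrite (_ : (fun _ => _) = (fun x => (c ^+ 2)%:E * (f x ^+ 2)%:E)%E); last first.
  by apply/funext => x; rewrite exprMn.
exact: integrableZl.
Qed.

Lemma sqintD f g : sqint f -> sqint g -> sqint (fun x => f x + g x).
Proof.
move=> sf sg; have fg := sqint_mul sf sg; move: sf sg => [mf f2] [mg g2].
split; first exact: measurable_funD.
rewrite (_ : (fun _ => _) = (fun x => (f x ^+ 2)%:E + (2%:E * (f x * g x)%:E
  + (g x ^+ 2)%:E))%E); last first.
  by apply/funext => x; rewrite -EFinM -!EFinD; congr EFin; ring.
by apply: integrableD => //; apply: integrableD => //; exact: integrableZl.
Qed.

Lemma sqint0 : sqint (fun=> 0).
Proof.
split; first exact: measurable_cst.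
by under eq_fun do rewrite expr0n /=; exact: integrable0.
Qed.

Lemma sqint_sum I (s : seq I) (f : I -> T -> R) :
  (forall i, sqint (f i)) -> sqint (fun x => \sum_(i <- s) f i x).
Proof.
move=> sf; elim: s => [|i s IH].
  by under eq_fun do rewrite big_nil; exact: sqint0.
by under eq_fun do rewrite big_cons; exact: sqintD.
Qed.

Lemma sqintB f g : sqint f -> sqint g -> sqint (fun x => f x - g x).
Proof.
move=> sf sg; under eq_fun do rewrite -(mulN1r (g _)).
by apply: sqintD => //; exact: sqintZ.
Qed.

Lemma innerC f g : inner f g = inner g f.
Proof. by apply: eq_Rintegral => x _; rewrite mulrC. Qed.

Lemma innerDl f g h : sqint f -> sqint g -> sqint h ->
  inner (fun x => f x + g x) h = inner f h + inner g h.
Proof.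
move=> sf sg sh; rewrite /inner -RintegralD//; try exact: sqint_mul.
by apply: eq_Rintegral => x _; rewrite mulrDl.
Qed.

Lemma innerZl c f h : sqint f -> sqint h ->
  inner (fun x => c * f x) h = c * inner f h.
Proof.
move=> sf sh; rewrite /inner -RintegralZl//; try exact: sqint_mul.
by apply: eq_Rintegral => x _; rewrite mulrA.
Qed.

Lemma inner0l h : inner (fun=> 0) h = 0.
Proof.
rewrite /inner (@eq_Rintegral _ _ _ mu D (cst 0)); last by move=> x _; rewrite mul0r.
by rewrite Rintegral_cst// mul0r.
Qed.

Lemma inner_suml I (s : seq I) (f : I -> T -> R) h :
  (forall i, sqint (f i)) -> sqint h ->
  inner (fun x => \sum_(i <- s) f i x) h = \sum_(i <- s) inner (f i) h.
Proof.
move=> sf sh; elim: s => [|i s IH].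
  rewrite big_nil -[RHS](inner0l h); congr inner.
  by apply/funext => x; rewrite big_nil.
rewrite big_cons -IH -innerDl//; last exact: sqint_sum.
by congr inner; apply/funext => x; rewrite big_cons.
Qed.

Lemma inner_ge0 f : 0 <= inner f f.
Proof. by apply: Rintegral_ge0 => x _; rewrite -expr2 sqr_ge0. Qed.

Lemma inner_sqrE f : sqint f -> (inner f f)%:E = (\int[mu]_(x in D) (f x ^+ 2)%:E)%E.
Proof.
move=> sf; rewrite /inner /Rintegral fineK; last first.
  by apply: integrable_fin_num => //; exact: sqint_mul.
by apply: eq_integral => x _; rewrite expr2.
Qed.

End square_integrable.

Lemma sqr_sum_le {R : realType} (I : finType) (x : I -> R) :
  (\sum_i x i) ^+ 2 <= #|I|%:R * \sum_i x i ^+ 2.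
Proof.
rewrite expr2 big_distrlr/=.
apply: (@le_trans _ _ (\sum_i \sum_j (x i ^+ 2 / 2 + x j ^+ 2 / 2))).
  apply: ler_sum => i _; apply: ler_sum => j _.
  by have := sqr_ge0 (x i - x j); rewrite sqrrB; lra.
under [leLHS]eq_bigr => i _.
  rewrite big_split/= sumr_const -mulr_suml -[_ *+ #|_|]mulr_natl.
  over.
rewrite big_split/= sumr_const -[_ *+ #|_|]mulr_natl -mulr_sumr -mulr_suml.
by rewrite le_eqVlt; apply/orP; left; apply/eqP; field.
Qed.

Section moments.
Context {d : measure_display} {T : measurableType d} {R : realType}.
Variable P : probability T R.
Implicit Types (X Y : T -> R) (a b c s : R).

(** Bounds on second moments are carried as a predicate with a real bound: a
    finite bound contains integrability, which then need not be mentioned in the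
    estimates. *)
Definition sqle X c :=
  measurable_fun setT X /\ (\int[P]_w (X w ^+ 2)%:E <= c%:E)%E.

Definition able X c :=
  measurable_fun setT X /\ (\int[P]_w `|X w|%:E <= c%:E)%E.

Lemma measurable_sqr X : measurable_fun setT X ->
  measurable_fun setT (fun w => (X w ^+ 2)%:E).
Proof. by move=> mX; apply/measurable_EFinP; exact: measurable_funX. Qed.

Lemma measurable_absE X : measurable_fun setT X ->
  measurable_fun setT (fun w => `|X w|%:E).
Proof. by move=> mX; apply/measurable_EFinP; exact: measurableT_comp. Qed.

Lemma sqle_ge0 X c : sqle X c -> 0 <= c.
Proof.
move=> [_ Xc]; rewrite -lee_fin; apply: le_trans Xc.
by apply: integral_ge0 => w _; rewrite lee_fin sqr_ge0.
Qed.

Lemma sqle_le X a b : a <= b -> sqle X a -> sqle X b.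
Proof. by move=> ab [mX Xa]; split => //; rewrite (le_trans Xa)// lee_fin. Qed.

Lemma able_le X a b : a <= b -> able X a -> able X b.
Proof. by move=> ab [mX Xa]; split => //; rewrite (le_trans Xa)// lee_fin. Qed.

Lemma sqle_ext X Y c : X =1 Y -> sqle X c -> sqle Y c.
Proof. by move=> /funext ->. Qed.

Lemma able_ext X Y c : X =1 Y -> able X c -> able Y c.
Proof. by move=> /funext ->. Qed.

Lemma sqle_conv X Y a b : sqle X a -> X =1 Y -> a <= b -> sqle Y b.
Proof. by move=> Xa /sqle_ext XY ab; apply: XY; exact: sqle_le Xa. Qed.

Lemma able_conv X Y a b : able X a -> X =1 Y -> a <= b -> able Y b.
Proof. by move=> Xa /able_ext XY ab; apply: XY; exact: able_le Xa. Qed.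

Lemma sqle_sqint X c : sqle X c -> sqint P setT X.
Proof.
move=> [mX Xc]; split => //; apply/integrableP; split; first exact: measurable_sqr.
under eq_integral do rewrite abse_EFin ger0_norm ?sqr_ge0//.
by rewrite (le_lt_trans Xc)// ltry.
Qed.

Lemma sqint_sqle X : sqint P setT X -> sqle X (inner P setT X X).
Proof. by move=> sX; split; [case: sX|rewrite inner_sqrE]. Qed.

Lemma sqle_inner X c : sqle X c -> inner P setT X X <= c.
Proof. by move=> Xc; have [_] := Xc; rewrite -inner_sqrE//; exact: sqle_sqint Xc. Qed.

Lemma ge0_le_integralT (f g : T -> \bar R) :
  measurable_fun setT f -> measurable_fun setT g ->
  (forall w, 0 <= f w)%E -> (forall w, f w <= g w)%E ->
  (\int[P]_w f w <= \int[P]_w g w)%E.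
Proof. by move=> mf mg f0 fg; apply: ge0_le_integral. Qed.

(** Young's inequality; the free weight lets one of the two terms keep a
    constant close to 1. *)
Lemma sqleD_weighted X Y a b s : 0 < s -> sqle X a -> sqle Y b ->
  sqle (fun w => X w + Y w) ((1 + s) * a + (1 + s^-1) * b).
Proof.
move=> s0 [mX Xa] [mY Yb]; have s'0 : 0 < s^-1 by rewrite invr_gt0.
split; first exact: measurable_funD.
apply: (@le_trans _ _ (\int[P]_w ((1 + s)%:E * (X w ^+ 2)%:E
                                  + (1 + s^-1)%:E * (Y w ^+ 2)%:E))%E).
  apply: ge0_le_integralT => [||w|w].
  - by apply: measurable_sqr; exact: measurable_funD.
  - by apply: emeasurable_funD; apply: measurable_funeM; exact: measurable_sqr.
  - by rewrite lee_fin sqr_ge0.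
  - rewrite -!EFinM -EFinD lee_fin -subr_ge0.
    rewrite [leRHS](_ : _ = s * (X w - s^-1 * Y w) ^+ 2).
      by rewrite mulr_ge0 ?sqr_ge0// ltW.
    by field; rewrite gt_eqF.
rewrite ge0_integralD//=.
- rewrite !ge0_integralZl_EFin//.
  + rewrite (EFinD (_ * _)) (EFinM (1 + s)) (EFinM (1 + s^-1)).
    apply: leeD; apply: lee_wpmul2l => //; first by rewrite lee_fin; lra.
    by rewrite lee_fin; lra.
  + by move=> w _; rewrite lee_fin sqr_ge0.
  + exact: measurable_sqr.
  + by lra.
  + by move=> w _; rewrite lee_fin sqr_ge0.
  + exact: measurable_sqr.
  + by lra.
- by move=> w _; rewrite -EFinM lee_fin mulr_ge0 ?sqr_ge0//; lra.
- by apply: measurable_funeM; exact: measurable_sqr.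
- by move=> w _; rewrite -EFinM lee_fin mulr_ge0 ?sqr_ge0//; lra.
- by apply: measurable_funeM; exact: measurable_sqr.
Qed.

Lemma sqleD X Y a b : sqle X a -> sqle Y b ->
  sqle (fun w => X w + Y w) (2 * a + 2 * b).
Proof.
move=> Xa Yb; have := sqleD_weighted ltr01 Xa Yb.
by rewrite invr1 (_ : 1 + 1 = 2).
Qed.

Lemma sqleZ k X a : sqle X a -> sqle (fun w => k * X w) (k ^+ 2 * a).
Proof.
move=> [mX Xa]; split; first exact: measurable_funM.
under eq_integral do rewrite exprMn EFinM.
rewrite ge0_integralZl_EFin ?sqr_ge0//=; last 2 first.
  by move=> w _; rewrite lee_fin sqr_ge0.
  exact: measurable_sqr.
by rewrite (EFinM (k ^+ 2)) lee_wpmul2l// lee_fin sqr_ge0.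
Qed.

Lemma sqleN X a : sqle X a -> sqle (fun w => - X w) a.
Proof.
move=> /(sqleZ (-1)); rewrite sqrrN expr1n mul1r; apply: sqle_ext => w.
by rewrite mulN1r.
Qed.

Lemma sqleB X Y a b : sqle X a -> sqle Y b ->
  sqle (fun w => X w - Y w) (2 * a + 2 * b).
Proof. by move=> Xa Yb; apply: sqleD => //; exact: sqleN. Qed.

Lemma sqle_cst c : sqle (fun=> c) (c ^+ 2).
Proof.
split=> //; rewrite (@integral_cst _ _ _ P setT measurableT (c ^+ 2)%:E).
by rewrite [X in (_ * X)%E]probability_setT mule1.
Qed.

Lemma sqle0 : sqle (fun=> 0) 0.
Proof. by have := sqle_cst 0; rewrite expr0n. Qed.

Lemma sqle_ae X Y c : {ae P, forall w, X w = Y w} -> measurable_fun setT Y ->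
  sqle X c -> sqle Y c.
Proof.
move=> XY mY [mX Xc]; split => //; apply: le_trans Xc.
rewrite (ge0_ae_eq_integral measurableT (g := fun w => (X w ^+ 2)%:E))//.
- exact: measurable_sqr.
- exact: measurable_sqr.
- by move=> w _; rewrite lee_fin sqr_ge0.
- by move=> w _; rewrite lee_fin sqr_ge0.
- by apply: filterS XY => w /= ->.
Qed.

Lemma sqle_mono X Y c : measurable_fun setT X ->
  (forall w, X w ^+ 2 <= Y w ^+ 2) -> sqle Y c -> sqle X c.
Proof.
move=> mX XY [mY Yc]; split => //; apply: le_trans Yc.
apply: ge0_le_integralT => [||w|w]; try exact: measurable_sqr.
  by rewrite lee_fin sqr_ge0.
by rewrite lee_fin.
Qed.

Lemma sqle_eps X c : (forall e, 0 < e -> sqle X (c + e)) -> sqle X c.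
Proof.
move=> Xc; have [mX _] := Xc 1 ltr01; split => //.
by apply/lee_addgt0Pr => e e0; rewrite -EFinD; have [] := Xc e e0.
Qed.

(** The factor 2 is the price of writing [X = (X - Y) + Y]; the part of [X - Y]
    is arbitrarily small. *)
Lemma sqle_closed X c :
  (forall e, 0 < e -> exists2 Y, sqle (fun w => X w - Y w) e & sqle Y c) ->
  measurable_fun setT X -> sqle X (2 * c).
Proof.
move=> XY mX; apply: sqle_eps => e e0.
have [Y XYe Yc] : exists2 Y, sqle (fun w => X w - Y w) (e / 2) & sqle Y c.
  by apply: XY; rewrite divr_gt0.
apply: sqle_ext (sqle_le _ (sqleD XYe Yc)) => [w|]; first by rewrite subrK.
by lra.
Qed.

Lemma sqle_sum (I : finType) (X : I -> T -> R) (a : I -> R) :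
  (forall i, sqle (X i) (a i)) ->
  sqle (fun w => \sum_i X i w) (#|I|%:R * \sum_i a i).
Proof.
move=> Xa; have mX i := (Xa i).1.
split; first exact: measurable_sum.
apply: (@le_trans _ _ (\int[P]_w (#|I|%:R%:E * \sum_i (X i w ^+ 2)%:E))%E).
  apply: ge0_le_integralT => [||w|w].
  - by apply: measurable_sqr; exact: measurable_sum.
  - apply: measurable_funeM; apply: emeasurable_sum => i.
    exact: measurable_sqr.
  - by rewrite lee_fin sqr_ge0.
  - rewrite sumEFin -EFinM lee_fin.
    exact: sqr_sum_le.
rewrite ge0_integralZl_EFin//=; last 2 first.
  by move=> w _; apply: sume_ge0 => i _; rewrite lee_fin sqr_ge0.
  by apply: emeasurable_sum => i; exact: measurable_sqr.
rewrite ge0_integral_sum//=; last 2 first.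
  by move=> i; exact: measurable_sqr.
  by move=> i w _; rewrite lee_fin sqr_ge0.
rewrite EFinM lee_wpmul2l ?lee_fin ?ler0n// -sumEFin.
by apply: lee_sum => i _; case: (Xa i).
Qed.

(** Pythagoras: second moments of orthogonal variables add up, without the
    factor that the triangle inequality would cost. *)
Lemma sqle_sum_orthogonal (I : finType) (Y : I -> T -> R) (a : I -> R) :
  (forall i, sqle (Y i) (a i)) ->
  (forall i j, i != j -> inner P setT (Y i) (Y j) = 0) ->
  sqle (fun w => \sum_i Y i w) (\sum_i a i).
Proof.
move=> Ya Yo; have sY i := sqle_sqint (Ya i).
have sS := sqint_sum measurableT (index_enum I) sY.
apply: sqle_le (sqint_sqle sS); rewrite inner_suml//.
apply: ler_sum => i _; rewrite innerC inner_suml// (bigD1 i)//= big1 ?addr0.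
  exact: sqle_inner.
by move=> j ji; rewrite Yo.
Qed.

Lemma ableD X Y a b : able X a -> able Y b -> able (fun w => X w + Y w) (a + b).
Proof.
move=> [mX Xa] [mY Yb]; split; first exact: measurable_funD.
apply: (@le_trans _ _ (\int[P]_w (`|X w|%:E + `|Y w|%:E))%E).
  apply: ge0_le_integralT => [||w|w].
  - by apply: measurable_absE; exact: measurable_funD.
  - by apply: emeasurable_funD; exact: measurable_absE.
  - by rewrite lee_fin.
  - by rewrite -EFinD lee_fin ler_normD.
rewrite ge0_integralD//=; first by rewrite EFinD leeD.
- exact: measurable_absE.
- exact: measurable_absE.
Qed.

Lemma ableZ k X a : able X a -> able (fun w => k * X w) (`|k| * a).
Proof.
move=> [mX Xa]; split; first exact: measurable_funM.
under eq_integral do rewrite normrM EFinM.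
rewrite ge0_integralZl_EFin//=; last exact: measurable_absE.
by rewrite EFinM lee_wpmul2l// lee_fin.
Qed.

Lemma able_sum (I : finType) (X : I -> T -> R) (a : I -> R) :
  (forall i, able (X i) (a i)) -> able (fun w => \sum_i X i w) (\sum_i a i).
Proof.
move=> Xa; elim: (index_enum I) => [|i s IH].
  under eq_fun do rewrite big_nil; rewrite big_nil; split => //.
  by under eq_integral do rewrite normr0; rewrite integral0.
by under eq_fun do rewrite big_cons; rewrite big_cons; exact: ableD.
Qed.

Lemma ableM X Y a b s : 0 < s -> sqle X a -> sqle Y b ->
  able (fun w => X w * Y w) (s * a + s^-1 * b).
Proof.
move=> s0 [mX Xa] [mY Yb]; have s'0 : 0 < s^-1 by rewrite invr_gt0.
split; first exact: measurable_funM.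
apply: (@le_trans _ _ (\int[P]_w (s%:E * (X w ^+ 2)%:E
                                  + s^-1%:E * (Y w ^+ 2)%:E))%E).
  apply: ge0_le_integralT => [||w|w].
  - by apply: measurable_absE; exact: measurable_funM.
  - by apply: emeasurable_funD; apply: measurable_funeM; exact: measurable_sqr.
  - by rewrite lee_fin.
  - rewrite -!EFinM -EFinD lee_fin.
    have h1 : 0 <= s * (X w - s^-1 * Y w) ^+ 2 by rewrite mulr_ge0 ?sqr_ge0// ltW.
    have h2 : 0 <= s * (X w + s^-1 * Y w) ^+ 2 by rewrite mulr_ge0 ?sqr_ge0// ltW.
    have E1 : s * (X w - s^-1 * Y w) ^+ 2
        = s * X w ^+ 2 + s^-1 * Y w ^+ 2 - 2 * (X w * Y w).
      by field; rewrite gt_eqF.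
    have E2 : s * (X w + s^-1 * Y w) ^+ 2
        = s * X w ^+ 2 + s^-1 * Y w ^+ 2 + 2 * (X w * Y w).
      by field; rewrite gt_eqF.
    have ? : 0 <= s * X w ^+ 2 by rewrite mulr_ge0 ?sqr_ge0// ltW.
    have ? : 0 <= s^-1 * Y w ^+ 2 by rewrite mulr_ge0 ?sqr_ge0// ltW.
    by rewrite ler_norml; apply/andP; split; lra.
rewrite ge0_integralD//=.
- rewrite !ge0_integralZl_EFin//.
  + by rewrite (EFinD (_ * _)) (EFinM s) (EFinM s^-1); apply: leeD; apply: lee_wpmul2l => //;
      rewrite lee_fin ltW.
  + by move=> w _; rewrite lee_fin sqr_ge0.
  + exact: measurable_sqr.
  + exact: ltW.
  + by move=> w _; rewrite lee_fin sqr_ge0.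
  + exact: measurable_sqr.
  + exact: ltW.
- by move=> w _; rewrite -EFinM lee_fin mulr_ge0 ?sqr_ge0// ltW.
- by apply: measurable_funeM; exact: measurable_sqr.
- by move=> w _; rewrite -EFinM lee_fin mulr_ge0 ?sqr_ge0// ltW.
- by apply: measurable_funeM; exact: measurable_sqr.
Qed.

Lemma able_sqr X a : sqle X a -> able (fun w => X w ^+ 2) a.
Proof.
move=> [mX Xa]; split; first exact: measurable_funX.
by under eq_integral do rewrite ger0_norm ?sqr_ge0//.
Qed.

Lemma able_sqle s X a : 0 < s -> sqle X a -> able X (s * a + s^-1).
Proof.
move=> s0 /(ableM s0)/(_ (sqle_cst 1)); rewrite expr1n mulr1.
by apply: able_ext => w; rewrite mulr1.
Qed.

Lemma able_integrable X a : able X a -> P.-integrable setT (EFin \o X).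
Proof.
move=> [mX Xa]; apply/integrableP; split; first exact/measurable_EFinP.
by rewrite (le_lt_trans Xa)// ltry.
Qed.

Lemma able_abs_mean X a : able X a -> `|\int[P]_w X w| <= a.
Proof.
move=> Xa; have iX := able_integrable Xa.
apply: le_trans (le_normr_Rintegral measurableT iX) _.
rewrite -lee_fin /Rintegral fineK; first by case: Xa.
apply: integrable_fin_num => //.
by apply: (integrable_norm iX).
Qed.

Lemma able0_ae X : (forall e, 0 < e -> able X e) -> {ae P, forall w, X w = 0}.
Proof.
move=> Xe; have mX := (Xe 1 ltr01).1.
have : (\int[P]_w `|(X w)%:E| = 0)%E.
  apply/eqP; rewrite eq_le; apply/andP; split; last exact: integral_ge0.
  by apply/lee_addgt0Pr => e /Xe[_]; rewrite add0e.
have mXE : measurable_fun setT (EFin \o X) by exact/measurable_EFinP.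
move/(ae_eq_integral_abs P measurableT mXE).
by apply: filterS => w /(_ I) -[].
Qed.

Lemma sqle0_ae X : (forall e, 0 < e -> sqle X e) -> {ae P, forall w, X w = 0}.
Proof.
move=> Xe; apply: able0_ae => e e0.
have h := able_sqle (s := 2 / e) _ (Xe (e ^+ 2 / 4) _).
apply: able_le (h _ _); last 2 first.
- by rewrite divr_gt0.
- by rewrite divr_gt0// exprn_gt0.
- by rewrite le_eqVlt; apply/orP; left; apply/eqP; field; rewrite gt_eqF.
Qed.

Definition cvgL2 (X_ : nat -> T -> R) X :=
  forall e, 0 < e -> \forall n \near \oo, sqle (fun w => X_ n w - X w) e.

Lemma ereal_cvg0P (u : nat -> \bar R) : (forall n, 0 <= u n)%E ->
  (u @ \oo --> 0%E) <-> forall e : R, 0 < e -> \forall n \near \oo, (u n <= e%:E)%E.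
Proof.
move=> u0; split=> [/fine_cvgP[ufin /cvgrPdist_le u_0] e e0|ue].
  have := u_0 e e0; move: ufin; apply: filterS2 => n /= un.
  rewrite sub0r normrN => h; rewrite -(fineK un) lee_fin.
  by rewrite (le_trans _ h)// ler_norm.
apply/fine_cvgP; split.
  have := ue 1 ltr01; apply: filterS => n h.
  by rewrite ge0_fin_numE// (le_lt_trans h)// ltry.
apply/cvgrPdist_le => e e0; have := ue e e0; apply: filterS => n h /=.
rewrite sub0r normrN ger0_norm ?fine_ge0// -lee_fin fineK//.
by rewrite ge0_fin_numE// (le_lt_trans h)// ltry.
Qed.

Lemma cvgL2P (X_ : nat -> T -> R) X : (forall n, measurable_fun setT (X_ n)) ->
  measurable_fun setT X ->
  cvgL2 X_ X <->
  (fun n => 'E_P[fun w => ((X w - X_ n w) ^+ 2)%R])%E @ \oo --> (0 : \bar R).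
Proof.
move=> mX_ mX; rewrite ereal_cvg0P; last first.
  by move=> n; apply: expectation_ge0 => w; exact: sqr_ge0.
have E n : ('E_P[fun w => ((X w - X_ n w) ^+ 2)%R]
    = \int[P]_w ((X_ n w - X w) ^+ 2)%:E)%E.
  rewrite unlock; apply: eq_integral => w _; congr EFin.
  by rewrite -sqrrN opprB.
split=> h e e0; have := h e e0; apply: filterS => n.
  by rewrite E => -[].
by rewrite E; split=> //; exact: measurable_funB.
Qed.

Lemma cvgL2_ae_unique (X_ : nat -> T -> R) X Y : cvgL2 X_ X -> cvgL2 X_ Y ->
  {ae P, forall w, X w = Y w}.
Proof.
move=> XX XY.
suff : {ae P, forall w, X w - Y w = 0} by apply: filterS => w /subr0_eq.
apply: sqle0_ae => e e0.
have e4 : 0 < e / 4 by rewrite divr_gt0.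
have [n [nX nY]] := @filter_ex _ \oo _ _ (filterI (XX _ e4) (XY _ e4)).
apply: sqle_ext (sqle_le _ (sqleB nY nX)) => [w|]; first by ring.
by lra.
Qed.

(** Completeness of L^2: along a subsequence with increments of second moment
    at most 8^-k the sum of the absolute increments has a finite mean, so the
    subsequence converges almost surely; Fatou identifies its limit. *)
Lemma L2_complete (X_ : nat -> T -> R) :
  (forall e, 0 < e -> exists N, forall n p, (N <= n)%N -> (N <= p)%N ->
     sqle (fun w => X_ n w - X_ p w) e) ->
  (forall n, measurable_fun setT (X_ n)) ->
  exists2 X, measurable_fun setT X & cvgL2 X_ X.
Proof.
move=> cX mX.
have e_gt0 k : 0 < (8 ^- k : R) by rewrite invr_gt0 exprn_gt0.
have /choice[N0 N0P] : forall k, exists N, forall n p, (N <= n)%N -> (N <= p)%N ->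
    sqle (fun w => X_ n w - X_ p w) (8 ^- k).
  by move=> k; exact: cX.
pose N := fix N k := if k is k'.+1 then maxn (N0 k'.+1) (N k').+1 else N0 0%N.
have N0N k : (N0 k <= N k)%N by case: k => //= k; rewrite leq_maxl.
have NS k : (N k < N k.+1)%N by rewrite /= leq_max ltnSn orbT.
have kN k : (k <= N k)%N.
  by elim: k => // k IH; exact: leq_ltn_trans IH (NS k).
pose D k w := X_ (N k.+1) w - X_ (N k) w.
have DP k : sqle (D k) (8 ^- k).
  by apply: N0P; rewrite ?(leq_trans (N0N k))// ltnW// NS.
have mD k : measurable_fun setT (D k) by case: (DP k).
have D1 k : able (D k) (4 / (2 ^ k.+1)%:R).
  have p0 : (0 : R) < 2 ^+ k by rewrite exprn_gt0.
  have h := @able_sqle (2 ^+ k) (D k) _ p0 (DP k).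
  apply: able_le h; rewrite natrX exprS.
  rewrite (_ : 8 = 2 * 2 * 2); last by ring.
  rewrite !exprMn (_ : _ + _ = 2 ^+ k / (2 ^+ k * 2 ^+ k * 2 ^+ k) + 1 / 2 ^+ k); last first.
    by rewrite div1r.
  have p1 : (1 : R) <= 2 ^+ k by rewrite exprn_ege1// ler1n.
  rewrite [leRHS](_ : _ = 1 / 2 ^+ k + 1 / 2 ^+ k); last by field; rewrite gt_eqF.
  rewrite lerD2r (_ : 2 ^+ k / _ = (1 / 2 ^+ k) * (1 / 2 ^+ k)); last first.
    by field; rewrite gt_eqF.
  by rewrite ler_piMr// !div1r ?invr_ge0 ?(ltW p0)// invf_le1.
have sumD : (\int[P]_w (\sum_(k <oo) `|D k w|%:E) < +oo)%E.
  rewrite integral_nneseries//; last by move=> k; exact: measurable_absE.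
  apply: (@le_lt_trans _ _ (\sum_(k <oo) (4 / (2 ^ k.+1)%:R)%:E)%E).
    apply: lee_nneseries => [k _ _|k _]; first exact: integral_ge0.
    by case: (D1 k).
  by apply: le_lt_trans (epsilon_trick0 xpredT _) (ltry _).
have mS : measurable_fun setT (fun w => \sum_(k <oo) `|D k w|%:E)%E.
  by apply: ge0_emeasurable_sum => [k w _ _|k _]; [|exact: measurable_absE].
have iS : P.-integrable setT (fun w => \sum_(k <oo) `|D k w|%:E)%E.
  apply/integrableP; split => //.
  by under eq_integral do rewrite gee0_abs ?nneseries_ge0//.
have aeS := integrable_ae measurableT iS.
pose Y w := limn_esup (fun k => (X_ (N k) w)%:E).
have mY : measurable_fun setT Y.
  by apply: measurable_fun_limn_esup => k; exact/measurable_EFinP.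
have good : {ae P, forall w, (fun k => X_ (N k) w) @ \oo --> fine (Y w)}.
  apply: filterS aeS => w /(_ I) /= Sw.
  have cS : cvgn (series (fun k => D k w)).
    apply: normed_cvg; apply: nondecreasing_is_cvgn.
      apply/nondecreasing_seqP => m.
      rewrite -[_ m.+1]/(series (fun k => `|D k w|) m.+1).
      by rewrite -[leLHS]/(series (fun k => `|D k w|) m) seriesEnat/= big_nat_recr//= lerDl.
    exists (fine (\sum_(k <oo) `|D k w|%:E)%E) => _ [k _ <-].
    rewrite -lee_fin fineK// /series/= -sumEFin.
    exact: nneseries_lim_ge.
  have E : (fun k => X_ (N k) w) = (fun k => X_ (N 0%N) w + series (fun k => D k w) k).
    by apply/funext => k; exact: (eq_sum_telescope (fun k => X_ (N k) w)).
  have cX' : cvgn (fun k => X_ (N k) w).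
    by rewrite E; apply: is_cvgD => //; exact: is_cvg_cst.
  have EL : (fun k => (X_ (N k) w)%:E) @ \oo --> (limn (fun k => X_ (N k) w))%:E.
    by apply: cvg_EFin; [exact: nearW|exact: cX'].
  have YE : Y w = (limn (fun k => X_ (N k) w))%:E.
    rewrite /Y is_cvg_limn_esupE; first exact/cvg_lim.
    by apply/cvg_ex; eexists; exact: EL.
  by rewrite YE.
exists (fine \o Y); first exact: measurableT_comp.
move=> e e0; have [M MP] := cX e e0.
near=> n.
have Mn : (M <= n)%N by near: n; exists M.
split; first by apply: measurable_funB => //; exact: measurableT_comp.
have mf k : measurable_fun setT (fun w => ((X_ n w - X_ (N k) w) ^+ 2)%:E).
  by apply: measurable_sqr; exact: measurable_funB.
have f0 k w : [set: T] w -> (0 <= ((X_ n w - X_ (N k) w) ^+ 2)%:E)%E.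
  by move=> _; rewrite lee_fin sqr_ge0.
rewrite (ge0_ae_eq_integral measurableT
  (g := fun w => limn_einf (fun k => ((X_ n w - X_ (N k) w) ^+ 2)%:E))).
- apply: le_trans (fatou P measurableT mf f0) _.
  apply: le_trans (limn_einf_sup _) _.
  rewrite limn_esup_lim; apply: lime_le; first exact: is_cvg_esups.
  exists M => // k /= Mk; apply: ge_ereal_sup => _ [p /= kp <-].
  have [_] : sqle (fun w => X_ n w - X_ (N p) w) e.
    by apply: MP => //; rewrite (leq_trans Mk)// (leq_trans kp).
  by [].
- by apply: measurable_sqr; apply: measurable_funB => //; exact: measurableT_comp.
- rewrite /limn_einf; apply: measurableT_comp => //.
  by apply: measurable_fun_limn_esup => k; exact: measurableT_comp.
- by move=> w _; rewrite lee_fin sqr_ge0.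
- move=> w _; rewrite limn_einf_lim; apply: lime_ge; first exact: is_cvg_einfs.
  by near=> k; apply: le_ereal_inf_tmp => _ [p /= kp <-]; exact: f0.
- apply: filterS good => w Yw _.
  have h : (fun k => ((X_ n w - X_ (N k) w) ^+ 2)%:E) @ \oo
           --> ((X_ n w - fine (Y w)) ^+ 2)%:E.
    apply: cvg_EFin; first exact: nearW.
    by rewrite expr2; under eq_fun do rewrite expr2; apply: cvgM;
      apply: cvgB => //; exact: cvg_cst.
  rewrite is_cvg_limn_einfE; first exact/esym/cvg_lim.
  by apply/cvg_ex; eexists; exact: h.
Unshelve. all: by end_near. Qed.

Definition smallL2 (X_ : nat -> T -> R) :=
  forall e, 0 < e -> \forall n \near \oo, sqle (X_ n) e.

Definition smallL1 (X_ : nat -> T -> R) :=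
  forall e, 0 < e -> \forall n \near \oo, able (X_ n) e.

Lemma cvg0_le (c : nat -> R) : c @ \oo --> (0 : R) ->
  forall e, 0 < e -> \forall n \near \oo, c n <= e.
Proof.
move=> /cvgrPdist_le h e /h; apply: filterS => n.
by rewrite sub0r normrN => /(le_trans (ler_norm _)).
Qed.

Lemma smallL2_bound (X_ : nat -> T -> R) (c : nat -> R) : c @ \oo --> (0 : R) ->
  (forall n, sqle (X_ n) (c n)) -> smallL2 X_.
Proof.
move=> c0 Xc e /(cvg0_le c0); apply: filterS => n h; exact: sqle_le h (Xc n).
Qed.

Lemma smallL1_bound (X_ : nat -> T -> R) (c : nat -> R) : c @ \oo --> (0 : R) ->
  (forall n, able (X_ n) (c n)) -> smallL1 X_.
Proof.
move=> c0 Xc e /(cvg0_le c0); apply: filterS => n h; exact: able_le h (Xc n).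
Qed.

Lemma smallL1D (X_ Y_ : nat -> T -> R) : smallL1 X_ -> smallL1 Y_ ->
  smallL1 (fun n w => X_ n w + Y_ n w).
Proof.
move=> hX hY e e0; have e2 : 0 < e / 2 by rewrite divr_gt0.
apply: filterS2 (hX _ e2) (hY _ e2) => n h1 h2.
by rewrite (splitr e); exact: ableD.
Qed.

Lemma smallL1Z c (X_ : nat -> T -> R) : smallL1 X_ -> smallL1 (fun n w => c * X_ n w).
Proof.
move=> hX e e0; have c1 : 0 < `|c| + 1 by rewrite ltr_wpDl.
apply: filterS (hX (e / (`|c| + 1)) _) => [n h|]; last by rewrite divr_gt0.
apply: able_le (ableZ c h); rewrite mulrCA ler_piMr// ?ltW//.
by rewrite ltr_pdivrMr// mul1r ltrDl.
Qed.

Lemma smallL2D (X_ Y_ : nat -> T -> R) : smallL2 X_ -> smallL2 Y_ ->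
  smallL2 (fun n w => X_ n w + Y_ n w).
Proof.
move=> hX hY e e0; have e2 : 0 < e / 4 by rewrite divr_gt0.
apply: filterS2 (hX _ e2) (hY _ e2) => n h1 h2.
by apply: sqle_le (sqleD h1 h2); lra.
Qed.

Lemma smallL2Z c (X_ : nat -> T -> R) : smallL2 X_ -> smallL2 (fun n w => c * X_ n w).
Proof.
move=> hX e e0; have c1 : 0 < c ^+ 2 + 1 by rewrite ltr_wpDl// sqr_ge0.
apply: filterS (hX (e / (c ^+ 2 + 1)) _) => [n h|]; last by rewrite divr_gt0.
apply: sqle_le (sqleZ c h); rewrite mulrCA ler_piMr// ?ltW//.
by rewrite ltr_pdivrMr// mul1r ltrDl.
Qed.

Lemma smallL2_sum r (X_ : nat -> nat -> T -> R) : (forall m, smallL2 (X_ ^~ m)) ->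
  smallL2 (fun n w => \sum_(m < r) X_ n m w).
Proof.
move=> hX; elim: r => [|r IH].
  move=> e e0; near=> n; under eq_fun do rewrite big_ord0.
  by apply: sqle_le (ltW e0) sqle0.
under [X in smallL2 X]eq_fun do under eq_fun do rewrite big_ord_recr/=.
exact: smallL2D.
Unshelve. all: by end_near. Qed.

Lemma smallL2_L1 (X_ : nat -> T -> R) : smallL2 X_ -> smallL1 X_.
Proof.
move=> hX e e0; apply: filterS (hX (e ^+ 2 / 4) _) => [n h|]; last first.
  by rewrite divr_gt0// exprn_gt0.
apply: able_le (@able_sqle (2 / e) _ _ _ h); last by rewrite divr_gt0.
by rewrite le_eqVlt; apply/orP; left; apply/eqP; field; rewrite gt_eqF.
Qed.

(** Young's inequality with a weight of order [1 / e], which makes the bounded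
    factor contribute at most [e / 2]. *)
Lemma smallL1M (X_ Y_ : nat -> T -> R) b : smallL2 X_ -> (forall n, sqle (Y_ n) b) ->
  smallL1 (fun n w => X_ n w * Y_ n w).
Proof.
move=> hX hY e e0.
have b0 : 0 <= b := sqle_ge0 (hY 0%N).
have b1 : 0 < b + 1 by rewrite ltr_wpDl.
pose s := 2 * (b + 1) / e.
have s0 : 0 < s by rewrite divr_gt0// mulr_gt0.
have e2 : 0 < e / 2 / s by apply: divr_gt0 => //; exact: divr_gt0.
apply: filterS (hX _ e2) => n h.
apply: able_le (ableM s0 h (hY n)).
rewrite (mulrC s) divfK ?gt_eqF// [leRHS]splitr lerD2l /s invf_div.
rewrite mulrAC ler_pdivrMr ?mulr_gt0// [leRHS](_ : _ = e * (b + 1)); last by field.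
by apply: ler_wpM2l; [exact: ltW|rewrite lerDl].
Qed.

Lemma sqle_linear_comb (I : finType) (a : I -> R) (X : I -> T -> R) c :
  (forall i, sqle (X i) c) ->
  sqle (fun w => \sum_i a i * X i w) (#|I|%:R * (\sum_i a i ^+ 2) * c).
Proof.
move=> Xc; apply: sqle_le (sqle_sum (fun i => sqleZ (a i) (Xc i))).
by rewrite -mulr_suml mulrA.
Qed.

End moments.

(** * Moments of the centred normal law *)

Section normal_moments.
Context {R : realType}.
Local Notation mu := (@lebesgue_measure R).
Variables (sigma : R) (s0 : 0 < sigma).
Let s_neq0 : sigma != 0. Proof. by rewrite gt_eqF. Qed.
Local Notation phi := (normal_pdf 0 sigma).

Lemma ge0_integral_normal_prob (f : R -> \bar R) : (forall x, 0 <= f x)%E ->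
  measurable_fun setT f ->
  (\int[normal_prob 0 sigma]_x f x = \int[mu]_x (f x * (phi x)%:E))%E.
Proof.
move=> f0 mf; have dom := normal_prob_dominates 0 sigma.
rewrite -(Radon_Nikodym_SigmaFinite.change_of_variables dom f0 measurableT mf).
apply: ae_eq_integral => //.
- apply: emeasurable_funM => //.
  exact: measurable_int (Radon_Nikodym_SigmaFinite.f_integrable dom).
- apply: emeasurable_funM => //; apply/measurable_EFinP.
  exact: measurable_normal_pdf.
- apply: ae_eqe_mul2l.
  apply: integral_ae_eq => //.
  + exact: Radon_Nikodym_SigmaFinite.f_integrable.
  + by apply/measurable_EFinP; exact: measurable_normal_pdf.
  + by move=> E _ mE; rewrite -Radon_Nikodym_SigmaFinite.f_integral.
Qed.

(** Doubling the standard deviation absorbs a factor [x^4]. This gives at once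
    the integrability of all the powers up to 4 and a bound on the fourth moment.
    With [y = x^2 / (2 sigma^2)], [y^2 expR (- y) <= 64 / 9 * expR (- (y / 4))],
    and [57] is [8 * 64 / 9] rounded up. *)
Lemma normal_pdf_wide (x : R) :
  x ^+ 4 * phi x <= 57 * sigma ^+ 4 * normal_pdf 0 (2 * sigma) x.
Proof.
have s20 : 2 * sigma != 0 by rewrite mulf_neq0.
rewrite !normal_pdfE// /normal_peak /normal_fun !subr0.
set y := x ^+ 2 / (sigma ^+ 2 *+ 2).
have s2 : 0 < sigma ^+ 2 by rewrite exprn_gt0.
have y0 : 0 <= y by rewrite divr_ge0 ?sqr_ge0// mulrn_wge0// ltW.
have -> : - x ^+ 2 / (sigma ^+ 2 *+ 2) = - y by rewrite mulNr.
have -> : - x ^+ 2 / ((2 * sigma) ^+ 2 *+ 2) = - (y / 4).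
  by rewrite /y; field; rewrite s_neq0.
have -> : Num.sqrt ((2 * sigma) ^+ 2 * pi *+ 2) = 2 * Num.sqrt (sigma ^+ 2 * pi *+ 2).
  rewrite exprMn -mulrA -mulrnAr sqrtrM ?sqr_ge0// sqrtr_sqr ger0_norm//.
rewrite invfM.
have -> : x ^+ 4 = 4 * sigma ^+ 4 * y ^+ 2.
  by rewrite /y; field; rewrite s_neq0.
set p := (Num.sqrt _)^-1.
have p0 : 0 <= p by rewrite invr_ge0 sqrtr_ge0.
have key : y ^+ 2 * expR (- y) <= 64 / 9 * expR (- (y / 4)).
  have -> : - y = - (y / 4) - (3 * y / 4) by field.
  rewrite expRD mulrA mulrAC mulrC [leRHS]mulrC ler_wpM2l ?expR_ge0//.
  have -> : - (3 * y / 4) = - (3 * y / 8) + - (3 * y / 8) by field.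
  rewrite expRD expRN.
  have h : 1 + 3 * y / 8 <= expR (3 * y / 8) by exact: expR_ge1Dx.
  have h0 : 0 < expR (3 * y / 8) by exact: expR_gt0.
  rewrite -invfM ler_pdivrMr ?mulr_gt0//.
  nra.
have s4 : 0 <= sigma ^+ 4 by rewrite exprn_ge0// ltW.
have E1 : 0 <= expR (- (y / 4)) by exact: expR_ge0.
rewrite (_ : _ * (p * _) = (4 * sigma ^+ 4 * p) * (y ^+ 2 * expR (- y))); last by ring.
apply: (@le_trans _ _ ((4 * sigma ^+ 4 * p) * (64 / 9 * expR (- (y / 4))))).
  by rewrite ler_wpM2l// mulr_ge0// mulr_ge0.
rewrite [leRHS](_ : _ = (57 / 2) * (sigma ^+ 4 * p * expR (- (y / 4)))); last by field.
rewrite [leLHS](_ : _ = (256 / 9) * (sigma ^+ 4 * p * expR (- (y / 4)))); last by field.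
apply: ler_wpM2r; last by lra.
by apply: mulr_ge0 => //; exact: mulr_ge0.
Qed.

Lemma normal_pdf_pow_le (k : nat) (x : R) : (k <= 4)%N ->
  `|x| ^+ k * phi x <= phi x + x ^+ 4 * phi x.
Proof.
move=> k4; rewrite -[X in _ <= X + _]mul1r -mulrDl ler_wpM2r ?normal_pdf_ge0//.
have x4 : x ^+ 4 = `|x| ^+ 4 by rewrite -normrX ger0_norm// exprn_even_ge0.
have [x1|x1] := leP `|x| 1.
  apply: (@le_trans _ _ 1); first by rewrite exprn_ile1.
  by rewrite lerDl exprn_even_ge0.
by rewrite x4 (le_trans (ler_weXn2l (ltW x1) k4))// lerDr.
Qed.

Lemma integrable_normal_pow (k : nat) : (k <= 4)%N ->
  mu.-integrable setT (fun x => (x ^+ k * phi x)%:E).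
Proof.
move=> k4.
have i1 := integrable_normal_pdf 0 sigma.
have i2 : mu.-integrable setT (fun x : R => (x ^+ 4 * phi x)%:E).
  apply: (@le_integrable _ _ _ mu setT measurableT _
    (fun x => (57 * sigma ^+ 4)%:E * (normal_pdf 0 (2 * sigma) x)%:E)%E).
  - apply/measurable_EFinP; apply: measurable_funM.
      exact: measurable_funX.
    exact: measurable_normal_pdf.
  - move=> x _; rewrite -EFinM !abse_EFin lee_fin ger0_norm; last first.
      by rewrite mulr_ge0 ?normal_pdf_ge0// exprn_even_ge0.
    by rewrite (le_trans (normal_pdf_wide x))// ler_norm.
  - by apply: integrableZl => //; exact: integrable_normal_pdf.
apply: (@le_integrable _ _ _ mu setT measurableT _
    (fun x => (phi x)%:E + (x ^+ 4 * phi x)%:E)%E).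
- apply/measurable_EFinP; apply: measurable_funM.
    exact: measurable_funX.
  exact: measurable_normal_pdf.
- move=> x _; rewrite -EFinD !abse_EFin lee_fin normrM normrX.
  rewrite (ger0_norm (normal_pdf_ge0 _ _ _)).
  by rewrite (le_trans (normal_pdf_pow_le x k4))// ler_norm.
- exact: integrableD.
Qed.

Lemma is_derive_normal_pdf (x : R) : is_derive x (1 : R) phi (- (x / sigma ^+ 2) * phi x).
Proof.
have E : phi = (fun x => normal_peak sigma * expR (- (2 * sigma ^+ 2)^-1 * x ^+ 2)).
  apply/funext => y; rewrite normal_pdfE// /normal_fun subr0; congr (_ * expR _).
  by field; rewrite s_neq0.
rewrite E; apply: is_derive_eq.
rewrite /GRing.scale/=; field.
by rewrite s_neq0.
Qed.

Lemma is_derive_normal_xpdf (x : R) :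
  is_derive x (1 : R) (fun x => - sigma ^+ 2 * (x * phi x))
    ((x ^+ 2 - sigma ^+ 2) * phi x).
Proof.
have ? := is_derive_normal_pdf x.
by apply: is_derive_eq; rewrite /GRing.scale/=; field; rewrite s_neq0.
Qed.

Let mu_tail x : 1 <= x -> x * phi x <= 57 * sigma ^+ 4 * normal_peak (2 * sigma) / x.
Proof.
move=> x1; have x0 : 0 < x by rewrite (lt_le_trans ltr01).
have := normal_pdf_wide x.
have s20 : 2 * sigma != 0 by rewrite mulf_neq0.
have ub : 57 * sigma ^+ 4 * normal_pdf 0 (2 * sigma) x
    <= 57 * sigma ^+ 4 * normal_peak (2 * sigma).
  by rewrite ler_wpM2l ?normal_pdf_ub// mulr_ge0// exprn_ge0// ltW.
move=> /le_trans/(_ ub) h; rewrite ler_pdivlMr//; apply: le_trans h.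
rewrite mulrAC ler_wpM2r ?normal_pdf_ge0// (_ : x * x = x ^+ 2)//.
by rewrite ler_weXn2l.
Qed.

Lemma cvg_normal_xpdf : x * phi x @[x --> +oo] --> (0 : R).
Proof.
set C := 57 * sigma ^+ 4 * normal_peak (2 * sigma).
apply: (@squeeze_cvgr _ _ _ _ (fun=> 0) (fun x => C * x^-1)).
- near=> x; apply/andP; split.
    by rewrite mulr_ge0 ?normal_pdf_ge0//; near: x; exact: nbhs_pinfty_ge.
  by apply: mu_tail; near: x; exact: nbhs_pinfty_ge.
- exact: cvg_cst.
- rewrite -[X in _ --> X](mulr0 C); apply: cvgM; first exact: cvg_cst.
  by apply/gtr0_cvgV0; [exact: nbhs_pinfty_gt|exact: cvg_id].
Unshelve. all: by end_near. Qed.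

Let cphi : continuous phi. Proof. exact: continuous_normal_pdf. Qed.

Let cpow k : continuous (fun x : R => x ^+ k * phi x).
Proof. by move=> x; apply: cvgM; [exact: exprn_continuous|exact: cphi]. Qed.

Let cg : continuous (fun x : R => (x ^+ 2 - sigma ^+ 2) * phi x).
Proof.
move=> x; apply: cvgM; last exact: cphi.
by apply: cvgB; [exact: exprn_continuous|exact: cvg_cst].
Qed.

Let ig : mu.-integrable setT (fun x => ((x ^+ 2 - sigma ^+ 2) * phi x)%:E).
Proof.
have i2 := @integrable_normal_pow 2 isT.
have i0 := integrableZl measurableT (sigma ^+ 2) (integrable_normal_pdf 0 sigma).
have := integrableB measurableT i2 i0; apply: eq_integrable => // x _.
by rewrite -EFinM -EFinB mulrBl.
Qed.

(** The integrand is the derivative of [- sigma^2 * x * phi x], which vanishes at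
    0 and at infinity. It changes sign at [sigma], where the integral is cut. *)
Lemma integral_normal_half :
  \int[mu]_(x in `[0, +oo[) ((x ^+ 2 - sigma ^+ 2) * phi x) = 0.
Proof.
pose F x := - sigma ^+ 2 * (x * phi x).
have cF : continuous F.
  by move=> x; apply/differentiable_continuous/derivable1_diffP;
    have := is_derive_normal_xpdf x; case.
have F'E x : F^`()%classic x = (x ^+ 2 - sigma ^+ 2) * phi x.
  by rewrite derive1E; have [_ ->] := is_derive_normal_xpdf x.
have dF x : derivable F x 1 by have := is_derive_normal_xpdf x; case.
have F0 : F x @[x --> +oo] --> (0 : R).
  rewrite -[X in _ --> X](mulr0 (- sigma ^+ 2)).
  by apply: cvgM; [exact: cvg_cst|exact: cvg_normal_xpdf].
have E1 : \int[mu]_(x in `[0, sigma]) ((x ^+ 2 - sigma ^+ 2) * phi x) = F sigma - F 0.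
  rewrite /Rintegral (@continuous_FTC2 _ _ F)//.
  - by apply: continuous_subspaceT.
  - split; first by move=> x _; exact: dF.
    + by apply: cvg_at_right_filter; exact: cF.
    + by apply: cvg_at_left_filter; exact: cF.
have E2 : \int[mu]_(x in `[sigma, +oo[) ((x ^+ 2 - sigma ^+ 2) * phi x) = 0 - F sigma.
  rewrite /Rintegral (@ge0_continuous_FTC2y _ _ F _ 0)//.
  - move=> x sx; rewrite mulr_ge0 ?normal_pdf_ge0// subr_ge0.
    by rewrite lerXn2r ?nnegrE// ltW// (lt_le_trans s0).
  - by apply: continuous_subspaceT.
  - by apply: cvg_at_right_filter; exact: cF.
have -> : `[0, +oo[%classic = `[0, sigma[ `|` `[sigma, +oo[ :> set R.
  by rewrite -itv_bndbnd_setU// bnd_simp ltW.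
rewrite Rintegral_setU//=; last 2 first.
- by apply: integrableS ig => //; exact: measurableU.
- by rewrite disj_set2E; apply/eqP; rewrite -subset0 => x [] /=;
    rewrite !in_itv/= andbT => /andP[_ xs]; rewrite leNgt xs.
rewrite Rintegral_itv_bndo_bndc; last exact: integrableS ig.
by rewrite E1 E2 /F mul0r mulr0; ring.
Qed.

Lemma integral_normal_sqr : (\int[mu]_x (x ^+ 2 * phi x)%:E = (sigma ^+ 2)%:E)%E.
Proof.
have pN x : phi (- x) = phi x by rewrite !normal_pdfE// /normal_fun !subr0 sqrrN.
have i2 := @integrable_normal_pow 2 isT.
have i0 := integrableZl measurableT (sigma ^+ 2) (integrable_normal_pdf 0 sigma).
have half := integral_normal_half.
have i2' : mu.-integrable `[0%R, +oo[ (fun x => (x ^+ 2 * phi x)%:E).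
  exact: integrableS i2.
have i0' : mu.-integrable `[0%R, +oo[ (fun x => (sigma ^+ 2 * phi x)%:E).
  by apply: integrableS i0.
have {}half : \int[mu]_(x in `[0%R, +oo[) (x ^+ 2 * phi x)
    = sigma ^+ 2 * \int[mu]_(x in `[0%R, +oo[) phi x.
  rewrite -RintegralZl//; last by apply: integrableS (integrable_normal_pdf 0 sigma).
  apply: subr0_eq; rewrite -RintegralB// -[RHS]half.
  by apply: eq_Rintegral => x _; rewrite mulrBl.
rewrite ge0_symfun_integralT; last 3 first.
- by move=> x; rewrite mulr_ge0 ?normal_pdf_ge0// sqr_ge0.
- exact: cpow.
- by move=> x /=; rewrite sqrrN pN.
have := integral_normal_pdf 0 sigma.
rewrite ge0_symfun_integralT; last 3 first.
- by move=> x; rewrite normal_pdf_ge0.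
- exact: cphi.
- by move=> x /=; rewrite pN.
rewrite -set_itvcy => one.
have F1 : (\int[mu]_(x in `[0%R, +oo[) (phi x)%:E)%E \is a fin_num.
  by apply: integrable_fin_num => //; apply: integrableS (integrable_normal_pdf 0 sigma).
have F2 : (\int[mu]_(x in `[0%R, +oo[) (x ^+ 2 * phi x)%:E)%E \is a fin_num.
  exact: integrable_fin_num.
move: one; rewrite -(fineK F1) -(fineK F2) -!EFinM => -[one]; congr EFin.
by rewrite -/(Rintegral _ _ _) half mulrCA /Rintegral one mulr1.
Qed.

Lemma integral_normal_id : \int[mu]_x (x * phi x) = 0.
Proof.
have pN x : phi (- x) = phi x by rewrite !normal_pdfE// /normal_fun !subr0 sqrrN.
have i1 : mu.-integrable setT (fun x => (x * phi x)%:E).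
  exact: (@integrable_normal_pow 1 isT).
have ia : mu.-integrable setT (fun x => (`|x| * phi x)%:E).
  have := integrable_norm i1; apply: eq_integrable => // x _ /=.
  by rewrite normrM (ger0_norm (normal_pdf_ge0 _ _ _)).
have E1 : \int[mu]_x (`|x| * phi x) = 2 * \int[mu]_(x in `[0, +oo[) (x * phi x).
  rewrite /Rintegral ge0_symfun_integralT; last 3 first.
  - by move=> x; rewrite mulr_ge0 ?normal_pdf_ge0.
  - by move=> x; apply: cvgM; [exact: norm_continuous|exact: cphi].
  - by move=> x /=; rewrite normrN pN.
  rewrite -set_itvcy fineM//; last first.
    by apply: integrable_fin_num => //; apply: integrableS ia.
  congr (_ * fine _); apply: eq_integral => x; rewrite inE/= in_itv/= andbT => x0.
  by rewrite ger0_norm.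
have E2 : \int[mu]_x (`|x| * phi x + x * phi x)
    = 2 * \int[mu]_(x in `[0, +oo[) (x * phi x).
  rewrite -RintegralZl//; last exact: integrableS i1.
  rewrite [RHS]Rintegral_mkcond; apply: eq_Rintegral => x _.
  rewrite patchE; have [x0|x0] := leP 0 x.
    by rewrite mem_set/= ?in_itv/= ?x0// ger0_norm//; ring.
  rewrite memNset/= ?in_itv/= ?andbT; first by rewrite ltr0_norm// mulNr addNr.
  by apply/negP; rewrite -ltNge.
move: E2; rewrite RintegralD// E1 => /eqP.
by rewrite addrC -subr_eq0 addrK => /eqP.
Qed.

End normal_moments.

(** * Independence *)

Section independence.
Context {d : measure_display} {T : measurableType d} {R : realType}.
Variable P : probability T R.
Implicit Types (C D : set (set T)) (X Y : T -> R).

Definition indep2 C D :=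
  forall A B, C A -> D B -> P (A `&` B) = (P A * P B)%E.

(** Two finite measures that agree on a pi-system agree on the sigma-algebra it
    generates; here both are functions of the event in [C]. *)
Lemma indep2_sigma C D : C `<=` measurable -> D `<=` measurable ->
  setI_closed C -> C setT -> indep2 C D -> indep2 <<s C >> D.
Proof.
move=> mC mD IC CT CD A B sCA DB.
have mB := mD _ DB.
have PB : P B \is a fin_num by exact: fin_num_measure.
have PB0 : 0 <= fine (P B) by rewrite fine_ge0.
have -> : P (A `&` B) = mscale (NngNum PB0) P A; last by rewrite /mscale/= fineK// muleC.
rewrite -[LHS]/(mrestr P mB A).
apply: (@g_sigma_algebra_measure_unique _ _ _ C mC (fun=> setT) (fun=> CT)) => //.
- by rewrite bigcup_const.
- by move=> E CE /=; rewrite /mrestr /mscale/= CD// muleC fineK.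
- by move=> _ /=; rewrite /mrestr setTI ltey_eq PB.
Qed.

Lemma indep2S C D C' D' : C' `<=` C -> D' `<=` D -> indep2 C D -> indep2 C' D'.
Proof. by move=> CC DD CD A B /CC ? /DD ?; exact: CD. Qed.

Lemma rv_eventsP X (G : set (set T)) :
  rv_events X `<=` G <-> forall V, measurable V -> G (X @^-1` V).
Proof.
split=> [XG V mV|XG _ [V mV <-]]; last by rewrite setTI; exact: XG.
by apply: XG; exists V; rewrite ?setTI.
Qed.

Lemma rv_events_measurable X : rv_events X `<=` measurable <->
  measurable_fun setT X.
Proof.
rewrite rv_eventsP; split=> mX; last by move=> V mV; rewrite -[_ @^-1` _]setTI; exact: mX.
by move=> _ V mV; rewrite setTI; exact: mX.
Qed.

Variables (X Y : T -> R).
Hypotheses (mX : measurable_fun setT X) (mY : measurable_fun setT Y).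
Hypothesis XY : indep2 (rv_events X) (rv_events Y).

Let X' : {mfun T >-> R} := mfun_Sub (mem_set mX).
Let Y' : {mfun T >-> R} := mfun_Sub (mem_set mY).
Let mZ : measurable_fun setT (fun w => (X w, Y w)).
Proof. exact: measurable_fun_pair. Qed.
Let Z' : {mfun T >-> (R * R)%type} := mfun_Sub (mem_set mZ).

Let joint_law : forall E, measurable E ->
  (distribution P X' \x distribution P Y')%E E = distribution P Z' E.
Proof.
apply: product_measure_unique => A B mA mB.
by rewrite /distribution /pushforward -XY//; [exists A|exists B]; rewrite ?setTI.
Qed.

(** The joint law is the product of the laws, so Tonelli's theorem applies. *)
Lemma ge0_integral_indep (h : R * R -> \bar R) : measurable_fun setT h ->
  (forall z, 0 <= h z)%E ->
  (\int[P]_w h (X w, Y w) =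
   \int[distribution P X']_x \int[distribution P Y']_y h (x, y))%E.
Proof.
move=> mh h0; rewrite -[RHS]fubini_tonelli1//.
rewrite (eq_measure_integral (distribution P Z')); last by move=> A mA _; exact: joint_law.
by rewrite ge0_integral_distribution.
Qed.

Lemma ge0_integralM_indep (f g : R -> R) : measurable_fun setT f ->
  measurable_fun setT g -> (forall x, 0 <= f x) -> (forall x, 0 <= g x) ->
  (\int[P]_w (f (X w) * g (Y w))%:E =
   (\int[P]_w (f (X w))%:E) * (\int[P]_w (g (Y w))%:E))%E.
Proof.
move=> mf mg f0 g0.
rewrite (ge0_integral_indep (h := fun z => (f z.1 * g z.2)%:E)); last 2 first.
- apply/measurable_EFinP; apply: measurable_funM; exact: measurableT_comp.
- by move=> z; rewrite lee_fin mulr_ge0.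
have gY : (\int[distribution P Y']_y (g y)%:E = \int[P]_w (g (Y w))%:E)%E.
  by rewrite ge0_integral_distribution//; exact/measurable_EFinP.
under eq_integral => x _.
  under eq_integral do rewrite /= EFinM.
  rewrite ge0_integralZl_EFin//; last 2 first.
  - by move=> y _; rewrite lee_fin.
  - exact/measurable_EFinP.
  over.
rewrite ge0_integralZr//=.
- by rewrite gY ge0_integral_distribution//; exact/measurable_EFinP.
- exact/measurable_EFinP.
- by move=> x _; rewrite lee_fin.
- by apply: integral_ge0 => x _; rewrite lee_fin.
Qed.

Lemma integrableM_indep : P.-integrable setT (EFin \o X) ->
  P.-integrable setT (EFin \o Y) ->
  P.-integrable setT (fun w => (X w * Y w)%:E).
Proof.
move=> /integrableP[_ iX] /integrableP[_ iY]; apply/integrableP; split.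
  by apply/measurable_EFinP; exact: measurable_funM.
under eq_integral do rewrite abse_EFin normrM.
rewrite (ge0_integralM_indep (f := fun x => `|x|) (g := fun x => `|x|))//.
by rewrite lte_mul_pinfty// ?integral_ge0// ge0_fin_numE ?integral_ge0.
Qed.

Lemma RintegralM_indep : P.-integrable setT (EFin \o X) ->
  P.-integrable setT (EFin \o Y) ->
  \int[P]_w (X w * Y w) = (\int[P]_w X w) * \int[P]_w Y w.
Proof.
move=> iX iY; have iXY := integrableM_indep iX iY.
have mh : measurable_fun [set: R * R] (fun z => (z.1 * z.2)%:E).
  by apply/measurable_EFinP; apply: measurable_funM.
have ih : (distribution P X' \x distribution P Y')%E.-integrable setT
    (fun z => (z.1 * z.2)%:E).
  apply/integrableP; split => //.
  rewrite (eq_measure_integral (distribution P Z')); last by move=> A mA _; exact: joint_law.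
  rewrite ge0_integral_distribution//; last exact: measurableT_comp.
  by case/integrableP: iXY.
have EX : (\int[distribution P X']_x x%:E = \int[P]_w (X w)%:E)%E.
  by rewrite integral_distribution//; exact/measurable_EFinP.
have EY : (\int[distribution P Y']_x x%:E = \int[P]_w (Y w)%:E)%E.
  by rewrite integral_distribution//; exact/measurable_EFinP.
have iY' : (distribution P Y').-integrable setT (fun y : R => y%:E).
  apply/integrableP; split; first exact/measurable_EFinP.
  rewrite ge0_integral_distribution//; last by apply: measurableT_comp => //; exact/measurable_EFinP.
  by case/integrableP: iY.
have iX' : (distribution P X').-integrable setT (fun y : R => y%:E).
  apply/integrableP; split; first exact/measurable_EFinP.
  rewrite ge0_integral_distribution//; last by apply: measurableT_comp => //; exact/measurable_EFinP.
  by case/integrableP: iX.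
have E : (\int[P]_w (X w * Y w)%:E = (\int[P]_w (X w)%:E) * \int[P]_w (Y w)%:E)%E.
  transitivity (\int[distribution P Z']_z (z.1 * z.2)%:E)%E.
    by rewrite integral_distribution.
  rewrite -(eq_measure_integral (distribution P Z') (fun A mA _ => joint_law mA)).
  rewrite -integral12_prod_meas1// /fubini_F.
  under eq_integral => x _.
    under eq_integral do rewrite /= EFinM.
    rewrite integralZl//.
    over.
  rewrite EY -(fineK (integrable_fin_num measurableT iY)) -EX.
  exact: integralZr.
by rewrite /Rintegral E fineM//; exact: integrable_fin_num.
Qed.

End independence.

Section gaussian_variable.
Context {d : measure_display} {T : measurableType d} {R : realType}.
Variable P : probability T R.
Variables (X : T -> R) (t : R).
Hypotheses (t0 : 0 < t) (mX : measurable_fun setT X).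
Hypothesis lawX : forall V : set R, measurable V ->
  P (X @^-1` V) = normal_prob 0 (Num.sqrt t) V.
Let s0 : 0 < Num.sqrt t. Proof. by rewrite sqrtr_gt0. Qed.
(* The normal law is a measure on the Borel sets in the guise of the type
   generated by the half-open intervals, whence the type of the target. *)
Let X' : {mfun T >-> measurableTypeR R} := @mfun_Sub _ _ T (measurableTypeR R) X (mem_set mX).

Let ge0_law (f : R -> \bar R) : measurable_fun setT f -> (forall x, 0 <= f x)%E ->
  (\int[P]_w f (X w) = \int[lebesgue_measure]_x (f x * (normal_pdf 0 (Num.sqrt t) x)%:E))%E.
Proof.
move=> mf f0; rewrite -ge0_integral_normal_prob//.
rewrite -[LHS]/(\int[P]_w (f \o X') w)%E -ge0_integral_distribution//.
apply: (@eq_measure_integral _ (measurableTypeR R) R setT (normal_prob 0 (Num.sqrt t))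
  (distribution P X') f) => A mA _.
exact: lawX.
Qed.

Lemma gaussian_second_moment : (\int[P]_w (X w ^+ 2)%:E = t%:E)%E.
Proof.
rewrite (ge0_law (f := fun x => (x ^+ 2)%:E)); last 2 first.
- by apply/measurable_EFinP; exact: measurable_funX.
- by move=> x; rewrite lee_fin sqr_ge0.
under eq_integral do rewrite -EFinM.
by rewrite integral_normal_sqr// sqr_sqrtr// ltW.
Qed.

(** The exact value is [3 * t^2]; only the order in [t] matters below. *)
Lemma gaussian_fourth_moment : sqle P (fun w => X w ^+ 2) (57 * t ^+ 2).
Proof.
split; first exact: measurable_funX.
under eq_integral do rewrite -exprM.
rewrite (ge0_law (f := fun x => (x ^+ 4)%:E)); last 2 first.
- by apply/measurable_EFinP; exact: measurable_funX.
- by move=> x; rewrite lee_fin exprn_even_ge0.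
have s4 : Num.sqrt t ^+ 4 = t ^+ 2 by rewrite (exprM _ 2 2) sqr_sqrtr// ltW.
apply: (@le_trans _ _ (\int[lebesgue_measure]_x
    ((57 * t ^+ 2)%:E * (normal_pdf 0 (2 * Num.sqrt t) x)%:E))%E).
  apply: ge0_le_integral => //=.
  - by move=> x _; rewrite -EFinM lee_fin mulr_ge0 ?normal_pdf_ge0// exprn_even_ge0.
  - apply: emeasurable_funM; apply/measurable_EFinP; first exact: measurable_funX.
    exact: measurable_normal_pdf.
  - by apply: measurable_funeM; apply/measurable_EFinP; exact: measurable_normal_pdf.
  - by move=> x _; rewrite -!EFinM lee_fin -s4 normal_pdf_wide.
rewrite ge0_integralZl_EFin//=.
- by rewrite integral_normal_pdf mule1.
- by move=> x _; rewrite lee_fin normal_pdf_ge0.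
- by apply/measurable_EFinP; exact: measurable_normal_pdf.
- by rewrite mulr_ge0// sqr_ge0.
Qed.

Lemma gaussian_mean : \int[P]_w X w = 0.
Proof.
have i1 : (lebesgue_measure).-integrable setT
    (fun x : R => (x * normal_pdf 0 (Num.sqrt t) x)%:E).
  exact: (@integrable_normal_pow _ _ s0 1 isT).
have mpos : measurable_fun [set: R] (fun x : R => (EFin^\+ x)%E).
  exact: measurable_funepos.
have mneg : measurable_fun [set: R] (fun x : R => (EFin^\- x)%E).
  exact: measurable_funeneg.
rewrite /Rintegral integralE.
have -> : (\int[P]_x (fun x0 => (X x0)%:E)^\+ x
    = \int[P]_w (fun x : R => EFin^\+ x) (X w))%E.
  by apply: eq_integral => w _; rewrite !funeposE.
have -> : (\int[P]_x (fun x0 => (X x0)%:E)^\- x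
    = \int[P]_w (fun x : R => EFin^\- x) (X w))%E.
  by apply: eq_integral => w _; rewrite !funenegE.
rewrite !ge0_law//.
have := integral_normal_id s0; rewrite /Rintegral integralE => H.
rewrite -[RHS]H; congr (fine (_ - _)); apply: eq_integral => x _.
  by rewrite !funeposE -EFin_max -EFin_max -EFinM maxr_pMl ?normal_pdf_ge0// mul0r.
by rewrite !funenegE -!EFinN -EFin_max -EFin_max -EFinM maxr_pMl ?normal_pdf_ge0// mul0r mulNr.
Qed.

End gaussian_variable.

(** * The past of a family of Brownian motions *)

Section generated_measurability.
Context {d : measure_display} {T : measurableType d} {R : realType}.
Implicit Types (G : set (set T)) (X Y : T -> R).

Definition gmeas G X := rv_events X `<=` <<s G >>.

Lemma gmeasP G X : gmeas G X <->
  measurable_fun [set: g_sigma_algebraType G] (X : g_sigma_algebraType G -> R).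
Proof.
rewrite /gmeas rv_eventsP; split => h; first by move=> _ V mV; rewrite setTI; exact: h.
by move=> V mV; rewrite -[_ @^-1` _]setTI; exact: h.
Qed.

Lemma gmeasS G G' X : G `<=` <<s G' >> -> gmeas G X -> gmeas G' X.
Proof.
move=> GG' GX; apply: subset_trans GX _; apply: smallest_sub => //.
Qed.

Lemma gmeas_gen G X : rv_events X `<=` G -> gmeas G X.
Proof. by move=> XG; apply: subset_trans XG _; exact: sub_sigma_algebra. Qed.

Lemma gmeas_cst G c : gmeas G (fun=> c).
Proof. by apply/gmeasP; exact: measurable_cst. Qed.

Lemma gmeasD G X Y : gmeas G X -> gmeas G Y -> gmeas G (fun w => X w + Y w).
Proof. by move=> /gmeasP mX /gmeasP mY; apply/gmeasP; exact: measurable_funD. Qed.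

Lemma gmeasB G X Y : gmeas G X -> gmeas G Y -> gmeas G (fun w => X w - Y w).
Proof. by move=> /gmeasP mX /gmeasP mY; apply/gmeasP; exact: measurable_funB. Qed.

Lemma gmeasM G X Y : gmeas G X -> gmeas G Y -> gmeas G (fun w => X w * Y w).
Proof. by move=> /gmeasP mX /gmeasP mY; apply/gmeasP; exact: measurable_funM. Qed.

Lemma gmeas_sum G I (s : seq I) (X : I -> T -> R) : (forall i, gmeas G (X i)) ->
  gmeas G (fun w => \sum_(i <- s) X i w).
Proof.
move=> GX; elim: s => [|i s IH].
  by under eq_fun do rewrite big_nil; exact: gmeas_cst.
by under eq_fun do rewrite big_cons; exact: gmeasD.
Qed.

Lemma gmeas_all G (I : eqType) (s : seq I) (X : I -> T -> R) (V : I -> set R) :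
  (forall i, i \in s -> gmeas G (X i)) -> (forall i, measurable (V i)) ->
  <<s G >> [set w | forall i, i \in s -> V i (X i w)].
Proof.
move=> GX mV; pose GT : measurableType _ := g_sigma_algebraType G.
elim: s GX => [GX|i s IH GX].
  by rewrite (_ : mkset _ = setT)//; [exact: (@measurableT _ GT)|apply/seteqP].
rewrite (_ : mkset _ = X i @^-1` V i `&` [set w | forall j, j \in s -> V j (X j w)]).
  apply: (@measurableI _ GT); last by apply: IH => j js; apply: GX; rewrite inE js orbT.
  by move/rv_eventsP : (GX i (mem_head _ _)); exact.
apply/seteqP; split => w /= h.
  by split => [|j js]; apply: h; rewrite inE ?eqxx// js orbT.
by move=> j; rewrite inE => /orP[/eqP->|js]; [exact: h.1|exact: h.2].
Qed.

End generated_measurability.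

Section product_rule.
Context {d : measure_display} {T : measurableType d} {R : realType}.
Variable P : probability T R.

Lemma measure_ae_eq (A A' : set T) : measurable A -> measurable A' ->
  {ae P, forall w, A w <-> A' w} -> P A = P A'.
Proof.
move=> mA mA' AA'; rewrite -(setIT A) -(setIT A').
rewrite -!integral_indic//.
apply: ge0_ae_eq_integral => //.
- by apply/measurable_EFinP; exact: measurable_indic.
- by apply/measurable_EFinP; exact: measurable_indic.
apply: filterS AA' => w [h1 h2] _; rewrite !indicE.
suff -> : (w \in A) = (w \in A') by [].
by apply/idP/idP => /set_mem h; apply/mem_set; [exact: h1|exact: h2].
Qed.

(** Joint independence of n + 1 classes makes the sigma-algebra generated by the
    first n of them independent of the last one: the finite intersections form
    a pi-system on which the product rule holds. *)
Lemma indep_events_sigma n (F : nat -> set (set T)) :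
  (forall i, F i `<=` measurable) -> (forall i, setI_closed (F i)) ->
  (forall i, F i setT) -> indep_events P n.+1 F ->
  indep2 P <<s \bigcup_(i in `I_n) F i >> (F n).
Proof.
move=> mF IF FT ind.
pose C := [set A | exists2 E : nat -> set T, (forall i, F i (E i)) &
                     A = \bigcap_(i in `I_n) E i].
have CF : \bigcup_(i in `I_n) F i `<=` <<s C >>.
  move=> A [i /= ni FA]; apply: sub_sigma_algebra.
  exists (fun j => if j == i then A else setT); first by move=> j; case: eqP => [->|].
  by apply/seteqP; split=> [w Aw j _|w /(_ i ni)]; [case: eqP|rewrite eqxx].
have mC : C `<=` measurable.
  move=> _ [E FE ->]; rewrite bigcap_mkord.
  by apply: bigsetI_measurable => i _; apply: mF (FE _).
suff : indep2 P <<s C >> (F n).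
  by apply: indep2S => //; apply: smallest_sub => //; exact: smallest_sigma_algebra.
have prodC (E : nat -> set T) : (forall i, F i (E i)) ->
    P (\bigcap_(i in `I_n) E i) = (\prod_(i < n) P (E i))%E.
  move=> FE; have := ind (fun i => if i == n then setT else E i).
  rewrite big_ord_recr/= eqxx probability_setT mule1.
  rewrite (_ : \bigcap_(i in `I_n.+1) _ = \bigcap_(i in `I_n) E i); last first.
    apply/seteqP; split => w h i /= ni.
      by have := h i (ltnW ni); rewrite (ltn_eqF ni).
    case: eqP => // /eqP ni'; apply: h; rewrite /= ltn_neqAle ni'.
    by rewrite -ltnS.
  move=> -> => [|i _]; last by case: ifP.
  by apply: eq_bigr => i _; rewrite (ltn_eqF (ltn_ord i)).
apply: indep2_sigma => //.
- move=> _ _ [E FE ->] [E' FE' ->]; exists (fun i => E i `&` E' i).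
    by move=> i; exact: IF.
  by rewrite bigcapI.
- by exists (fun=> setT) => //; rewrite bigcapT.
move=> _ B [E FE ->] FB; rewrite prodC//.
have := ind (fun i => if i == n then B else E i).
rewrite big_ord_recr/= eqxx.
rewrite (_ : \bigcap_(i in `I_n.+1) _ = \bigcap_(i in `I_n) E i `&` B); last first.
  apply/seteqP; split => w.
    move=> h; split; last by have := h n (ltnSn n); rewrite eqxx.
    by move=> i /= ni; have := h i (ltnW ni); rewrite (ltn_eqF ni).
  move=> [h Bw] i /= ni; case: eqP => // /eqP ni'; apply: h.
  by rewrite /= ltn_neqAle ni' -ltnS.
move=> -> => [|i _]; last by case: eqP => [->|].
by congr (_ * _)%E; apply: eq_bigr => i _; rewrite (ltn_eqF (ltn_ord i)).
Qed.

End product_rule.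

Section brownian_past.
Context {d : measure_display} {T : measurableType d} {R : realType}.
Variable P : probability T R.

Definition history (W : R -> T -> R) (s : R) : set (set T) :=
  [set A | exists2 r, 0 <= r <= s & rv_events (W r) A].

Lemma rv_eventsI (X : T -> R) : setI_closed (rv_events X).
Proof.
move=> _ _ [U mU <-] [V mV <-]; exists (U `&` V); first exact: measurableI.
by rewrite !setTI.
Qed.

Lemma rv_eventsT (X : T -> R) : rv_events X setT.
Proof. by exists setT => //; rewrite setTI. Qed.

(** An event of the history of [W] depends on finitely many values of [W], that
    is, as [W 0 = 0] almost surely, on finitely many increments between 0 and [s];
    these are independent of the increment from [s] to [t]. *)
Lemma history_indep (W : R -> T -> R) s t : brownian_motion P W -> 0 <= s <= t ->
  indep2 P <<s history W s >> (rv_events (fun w => W t w - W s w)).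
Proof.
move=> bW /andP[s0 st]; have t0 := le_trans s0 st.
have mW r : 0 <= r -> measurable_fun setT (W r) by exact: bm_rv bW r.
have minc r r' : 0 <= r -> 0 <= r' -> measurable_fun setT (fun w => W r w - W r' w).
  by move=> ? ?; apply: measurable_funB; exact: mW.
pose C := [set A | exists rs : seq R, exists V : R -> set R,
  [/\ forall r, r \in rs -> 0 <= r <= s, forall r, measurable (V r) &
      A = [set w | forall r, r \in rs -> V r (W r w)]]].
have HC : history W s `<=` <<s C >>.
  move=> _ [r rs [V mV <-]]; apply: sub_sigma_algebra.
  exists [:: r], (fun=> V); split => //.
    by move=> r'; rewrite inE => /eqP ->.
  rewrite setTI; apply/seteqP; split=> [w Vw r'|w]; first by rewrite inE => /eqP ->.
  by apply; rewrite inE.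
have mC : C `<=` measurable.
  move=> _ [rs [V [rs0 mV ->]]].
  have -> : measurable = <<s (@measurable _ T) >> by rewrite sigma_algebra_id//;
    exact: sigma_algebra_measurable.
  apply: gmeas_all => // r /rs0/andP[r0 _]; apply: gmeas_gen.
  by apply/rv_events_measurable; exact: mW.
suff : indep2 P <<s C >> (rv_events (fun w => W t w - W s w)).
  by apply: indep2S => //; apply: smallest_sub => //; exact: smallest_sigma_algebra.
apply: indep2_sigma => //.
- by apply/rv_events_measurable; exact: minc.
- move=> _ _ [rs [V [rs0 mV ->]]] [rs' [V' [rs0' mV' ->]]].
  exists (rs ++ rs'), (fun r => (if r \in rs then V r else setT) `&`
                               (if r \in rs' then V' r else setT)); split.
  + by move=> r; rewrite mem_cat => /orP[/rs0|/rs0'].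
  + by move=> r; apply: measurableI; case: ifP.
  + apply/seteqP; split => w /=.
      move=> [h h'] r _; split; case: ifPn => // rin; [exact: h|exact: h'].
    move=> h; split => r rin.
      by have [|+ _] := h r; [rewrite mem_cat rin|rewrite rin].
    by have [|_] := h r; [rewrite mem_cat rin orbT|rewrite rin].
- by exists [::], (fun=> setT); split => //; apply/seteqP.
move=> _ D [rs [V [rs0 mV ->]]] DD.
(* the increments of W along 0, the sorted times, s and t are independent *)
pose l := 0 :: sort <=%R rs ++ [:: s; t].
pose n := (size rs).+1.
pose tau i := nth t l i.
have sz : size l = n.+2 by rewrite /l /= size_cat size_sort addn2.
have sl : sorted <=%R l.
  rewrite /l /= cat_path/=; apply/andP; split.
    rewrite path_sortedE; last exact: le_trans.
    rewrite sort_sorted ?andbT; last exact: le_total.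
    by apply/allP => r; rewrite mem_sort => /rs0/andP[].
  rewrite st andbT andbT.
  have : last 0 (sort <=%R rs) \in 0 :: sort <=%R rs by exact: mem_last.
  by rewrite inE mem_sort => /orP[/eqP ->//|/rs0/andP[]].
have tau0 : tau 0%N = 0 by [].
have taun : tau n = s by rewrite /tau /l /n /= nth_cat size_sort ltnn subnn.
have taun1 : tau n.+1 = t.
  by rewrite /tau /l /n /= nth_cat size_sort ltnNge leqnSn /= subSnn.
have taumono i : tau i <= tau i.+1.
  have [il|il] := ltnP i.+1 (size l).
    by apply: (sortedP t sl).
  rewrite /tau [leRHS]nth_default//.
  have [il'|il'] := ltnP i (size l); last by rewrite nth_default.
  have -> : i = n.+1 by apply/eqP; rewrite eqn_leq -ltnS -sz il' -ltnS -sz.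
  by rewrite -/(tau _) taun1.
have tau_ge0 i : 0 <= tau i by elim: i => [|i IH]; rewrite ?tau0// (le_trans IH).
pose F i := rv_events (fun w => W (tau i.+1) w - W (tau i) w).
have mF i : F i `<=` measurable by apply/rv_events_measurable; exact: minc.
have ind : indep_events P n.+1 F by apply: (bm_indep bW) => //; rewrite tau0.
have := indep_events_sigma mF (fun i => @rv_eventsI _) (fun i => @rv_eventsT _) ind.
rewrite {2}/F taun taun1; set G := \bigcup_(i in `I_n) F i => indG.
pose A' := [set w | forall r, r \in rs -> V r (W r w - W 0 w)].
have GA' : <<s G >> A'.
  apply: gmeas_all => // r rin.
  have [i ni ->] : exists2 i, (i < n)%N & r = tau i.+1.
    exists (index r (sort <=%R rs)).
      by rewrite /n ltnS -(size_sort <=%R) index_size.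
    rewrite /tau /l/= nth_cat; case: ifPn; rewrite -?leqNgt => h.
      by rewrite nth_index// mem_sort.
    by move: h; rewrite leqNgt index_mem mem_sort rin.
  have -> : (fun w => W (tau i.+1) w - W 0 w)
      = (fun w => \sum_(j < i.+1) (W (tau j.+1) w - W (tau j) w)).
    apply/funext => w; rewrite -(big_mkord xpredT (fun j => W (tau j.+1) w - W (tau j) w)).
    by rewrite telescope_sumr// tau0.
  apply: gmeas_sum => j; apply: gmeas_gen => E FE; exists j => //=.
  exact: leq_trans (ltn_ord j) ni.
have mG : <<s G >> `<=` measurable.
  apply: smallest_sub; first exact: sigma_algebra_measurable.
  by apply: bigcup_sub => i _; exact: mF.
have AA' : {ae P, forall w, [set w | forall r, r \in rs -> V r (W r w)] w <-> A' w}.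
  by apply: filterS (bm_0 bW) => w W0; rewrite /A'/= W0;
    split => h r /h; rewrite subr0.
have mD : measurable D by apply: (rv_events_measurable _).2 DD; exact: minc.
have mA : measurable [set w | forall r, r \in rs -> V r (W r w)].
  by apply: mC; exists rs, V.
rewrite (measure_ae_eq mA (mG _ GA') AA') -(indG _ _ GA' DD).
apply: measure_ae_eq; try exact: measurableI (mG _ GA') mD.
  exact: measurableI.
by apply: filterS AA' => w h; split => -[] /h.
Qed.

Variable B : nat -> R -> T -> R.
Hypothesis hB : independent_brownian_motions P B.

(** The filtration is enlarged by the whole paths of the other motions: the
    increments of [B m] after [s] are still independent of it, and a product of
    increments of distinct motions becomes a coefficient times an increment. *)
Definition past (m : nat) (s : R) : set (set T) :=
  history (B m) s `|` [set A | exists m', [/\ m' != m & process_sigma (B m') A]].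

Lemma past_indep m s t : 0 <= s <= t ->
  indep2 P <<s past m s >> (rv_events (fun w => B m t w - B m s w)).
Proof.
move=> /andP[s0 st]; have t0 := le_trans s0 st.
have [bB iB] := hB.
have mB m' r : 0 <= r -> measurable_fun setT (B m' r) by exact: bm_rv (bB m') r.
have mps m' : process_sigma (B m') `<=` measurable.
  apply: smallest_sub; first exact: sigma_algebra_measurable.
  by move=> A [r r0]; apply: (rv_events_measurable _).2; exact: mB.
have mh : <<s history (B m) s >> `<=` process_sigma (B m).
  by apply: sub_sigma_algebra2 => A [r /andP[r0 _] rA]; exists r.
pose C := [set A | exists n (E : nat -> set T), [/\ (m < n)%N,
   <<s history (B m) s >> (E m), forall i, process_sigma (B i) (E i) &
   A = \bigcap_(i in `I_n) E i]].
have psT i : process_sigma (B i) setT.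
  exact: (@measurableT _ (g_sigma_algebraType [set A | exists2 s, 0 <= s & rv_events (B i s) A])).
have hT : <<s history (B m) s >> setT.
  exact: (@measurableT _ (g_sigma_algebraType (history (B m) s))).
have PC : past m s `<=` <<s C >>.
  move=> A [hA|[m' [m'm pA]]]; apply: sub_sigma_algebra.
    have hA' : <<s history (B m) s >> A by exact: sub_sigma_algebra.
    exists m.+1, (fun i => if i == m then A else setT); split => //.
    - by rewrite eqxx.
    - by move=> i; case: eqP => [->|//]; exact: mh.
    - apply/seteqP; split=> [w Aw i _|w /(_ m (ltnSn m))]; last by rewrite eqxx.
      by case: eqP.
  exists (maxn m m').+1, (fun i => if i == m' then A else setT); split => //.
  - by rewrite ltnS leq_maxl.
  - by rewrite eq_sym (negbTE m'm).
  - by move=> i; case: eqP => [->|].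
  - apply/seteqP; split=> [w Aw i _|w]; first by case: eqP.
    by move=> /(_ m'); rewrite eqxx; apply; rewrite /= ltnS leq_maxr.
have mC : C `<=` measurable.
  move=> _ [n [E [_ _ pE ->]]]; rewrite bigcap_mkord.
  by apply: bigsetI_measurable => i _; apply: mps (pE _).
have mDelta : rv_events (fun w => B m t w - B m s w) `<=` measurable.
  by apply/rv_events_measurable; apply: measurable_funB; exact: mB.
suff : indep2 P <<s C >> (rv_events (fun w => B m t w - B m s w)).
  by apply: indep2S => //; apply: smallest_sub => //; exact: smallest_sigma_algebra.
apply: indep2_sigma => //.
- move=> _ _ [n [E [mn hE pE ->]]] [n' [E' [mn' hE' pE' ->]]].
  exists (maxn n n'), (fun i => (if (i < n)%N then E i else setT) `&`
                               (if (i < n')%N then E' i else setT)); split.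
  + by rewrite leq_max mn.
  + rewrite mn mn'.
    exact: (@measurableI _ (g_sigma_algebraType (history (B m) s))).
  + move=> i; apply: (@measurableI _ (g_sigma_algebraType
      [set A | exists2 s, 0 <= s & rv_events (B i s) A])).
      by case: ifP => _; [exact: pE|exact: psT].
    by case: ifP => _; [exact: pE'|exact: psT].
  + apply/seteqP; split => w /=.
      by move=> [h h'] i _; split; case: ifPn => // ni; [exact: h|exact: h'].
    move=> h; split => i /= ni.
      by have [|+ _] := h i; [rewrite /= leq_max ni|rewrite ni].
    by have [|_] := h i; [rewrite /= leq_max ni orbT|rewrite ni].
- by exists m.+1, (fun=> setT); split => //; rewrite bigcapT.
move=> _ D [n [E [mn hE pE ->]]] DD.
have pD : process_sigma (B m) D.
  move: D DD; apply: gmeasB; apply: gmeas_gen => A rA; [by exists t|by exists s].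
rewrite iB; last by move=> i _; exact: pE.
pose E' i := if i == m then E m `&` D else E i.
have -> : \bigcap_(i in `I_n) E i `&` D = \bigcap_(i in `I_n) E' i.
  apply/seteqP; split => w.
    by move=> [h Dw] i /= ni; rewrite /E'; case: eqP => [_|_]; [split=> //; exact: (h m mn)|exact: h].
  move=> h; split; last by have := h m mn; rewrite /E' eqxx => -[].
  by move=> i /= ni; have := h i ni; rewrite /E'; case: eqP => [-> []|].
rewrite iB; last first.
  move=> i _; rewrite /E'; case: eqP => [->|_]; last exact: pE.
  apply: (@measurableI _ (g_sigma_algebraType
    [set A | exists2 s, 0 <= s & rv_events (B m s) A])) => //; exact: pE.
rewrite (bigD1 (Ordinal mn))//= [in RHS](bigD1 (Ordinal mn))//= {1}/E' eqxx.
rewrite (history_indep (bB m) _ hE DD) ?s0//.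
rewrite (eq_bigr (fun i : 'I_n => P (E i))); last first.
  by move=> i; rewrite /E' -val_eqE/= => /negbTE ->.
by rewrite muleAC.
Qed.

Lemma filtration_past m s : filtration B s `<=` <<s past m s >>.
Proof.
apply: sub_sigma_algebra2 => A [m' [r [/andP[r0 rs] rA]]].
have [E|m'm] := eqVneq m' m; first by left; exists r; rewrite -?E// r0.
by right; exists m'; split => //; apply: sub_sigma_algebra; exists r.
Qed.

Lemma gmeas_filtration_past m s (X : T -> R) :
  rv_events X `<=` filtration B s -> gmeas (past m s) X.
Proof. by move=> h; apply: subset_trans h (@filtration_past m s). Qed.

Lemma gmeas_other_past m m' s r : m' != m -> 0 <= r -> gmeas (past m s) (B m' r).
Proof.
move=> m'm r0; apply: gmeas_gen => A rA; right; exists m'; split => //.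
by apply: sub_sigma_algebra; exists r.
Qed.

Lemma gmeas_history_past m s r : 0 <= r <= s -> gmeas (past m s) (B m r).
Proof. by move=> rs; apply: gmeas_gen => A rA; left; exists r. Qed.

Lemma gmeas_past_measurable m s (X : T -> R) : gmeas (past m s) X ->
  measurable_fun setT X.
Proof.
move=> h; apply/rv_events_measurable; apply: subset_trans h _.
apply: smallest_sub; first exact: sigma_algebra_measurable.
have [bB _] := hB.
have mB m' r : 0 <= r -> rv_events (B m' r) `<=` measurable.
  by move=> r0; apply/rv_events_measurable; exact: bm_rv (bB m') r r0.
move=> A [[r /andP[r0 _]]|[m' [_]]]; first exact: mB.
move: A; apply: smallest_sub; first exact: sigma_algebra_measurable.
by move=> A [r r0]; exact: mB.
Qed.

End brownian_past.

(** * Increments of Brownian motions and Ito's isometry *)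

Section increments.
Context {d : measure_display} {T : measurableType d} {R : realType}.
Variable P : probability T R.
Variable B : nat -> R -> T -> R.
Hypothesis hB : independent_brownian_motions P B.

Definition incr m (s t : R) (w : T) := B m t w - B m s w.

Let mB m r : 0 <= r -> measurable_fun setT (B m r).
Proof. exact: bm_rv (hB.1 m) r. Qed.

Lemma measurable_incr m s t : 0 <= s -> 0 <= t -> measurable_fun setT (incr m s t).
Proof. by move=> s0 t0; apply: measurable_funB; exact: mB. Qed.

Lemma incr_second_moment m s t : 0 <= s <= t ->
  (\int[P]_w (incr m s t w ^+ 2)%:E = (t - s)%:E)%E.
Proof.
move=> /andP[s0]; rewrite le_eqVlt => /orP[/eqP ->|st].
  rewrite subrr -[RHS](@integral0 _ _ _ P setT); apply: eq_integral => w _.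
  by rewrite /incr subrr expr0n.
have t0 : 0 <= t by rewrite (le_trans s0)// ltW.
apply: gaussian_second_moment; rewrite ?subr_gt0//; first exact: measurable_incr.
by move=> V mV; exact: bm_normal (hB.1 m) s t s0 st V mV.
Qed.

Lemma sqle_incr m s t : 0 <= s <= t -> sqle P (incr m s t) (t - s).
Proof.
move=> st; split; last by rewrite incr_second_moment.
by have /andP[s0 st'] := st; apply: measurable_incr => //; exact: le_trans st'.
Qed.

Lemma sqle_incr_sqr m s t : 0 <= s <= t ->
  sqle P (fun w => incr m s t w ^+ 2) (57 * (t - s) ^+ 2).
Proof.
move=> /andP[s0]; rewrite le_eqVlt => /orP[/eqP ->|st].
  rewrite subrr expr0n mulr0; apply: sqle_ext (sqle0 P) => w.
  by rewrite /incr subrr expr0n.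
have t0 : 0 <= t by rewrite (le_trans s0)// ltW.
apply: gaussian_fourth_moment; rewrite ?subr_gt0//; first exact: measurable_incr.
by move=> V mV; exact: bm_normal (hB.1 m) s t s0 st V mV.
Qed.

Lemma incr_mean m s t : 0 <= s <= t -> \int[P]_w incr m s t w = 0.
Proof.
move=> /andP[s0]; rewrite le_eqVlt => /orP[/eqP ->|st].
  rewrite (@eq_Rintegral _ _ _ P setT (cst 0)).
    by rewrite Rintegral_cst// mul0r.
  by move=> w _; rewrite /incr subrr.
have t0 : 0 <= t by rewrite (le_trans s0)// ltW.
apply: (@gaussian_mean _ _ _ _ _ (t - s)); rewrite ?subr_gt0//.
  exact: measurable_incr.
by move=> V mV; exact: bm_normal (hB.1 m) s t s0 st V mV.
Qed.

Lemma sqle_integrable X c : sqle P X c -> P.-integrable setT (EFin \o X).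
Proof. by move=> /(able_sqle ltr01)/able_integrable. Qed.

Lemma rv_events_comp (X : T -> R) (f : R -> R) : measurable_fun setT f ->
  rv_events (f \o X) `<=` rv_events X.
Proof.
move=> mf _ [V mV <-]; exists (f @^-1` V) => //.
by rewrite -[_ @^-1` _]setTI; exact: mf.
Qed.

Lemma past_mean0 m s t Z (f : R -> R) : 0 <= s <= t -> gmeas (past B m s) Z ->
  P.-integrable setT (EFin \o Z) -> measurable_fun setT f ->
  P.-integrable setT (EFin \o (f \o incr m s t)) ->
  \int[P]_w (f (incr m s t w)) = 0 ->
  \int[P]_w (Z w * f (incr m s t w)) = 0.
Proof.
move=> st pZ iZ mf iD D0; have /andP[s0 st'] := st; have t0 := le_trans s0 st'.
rewrite -[LHS]/(\int[P]_w (Z w * (f \o incr m s t) w)) RintegralM_indep//.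
- by rewrite [X in _ * X]D0 mulr0.
- exact: (gmeas_past_measurable hB pZ).
- by apply: measurableT_comp => //; exact: measurable_incr.
- move=> A D ZA DD; apply: (past_indep hB (m := m) st); first exact: pZ.
  exact: (rv_events_comp mf) DD.
Qed.

(** Martingale property: the increment after [s] is centred and independent of
    the past at [s]. *)
Lemma past_incr_mean0 m s t Z : 0 <= s <= t -> gmeas (past B m s) Z ->
  P.-integrable setT (EFin \o Z) ->
  \int[P]_w (Z w * incr m s t w) = 0.
Proof.
move=> st pZ iZ; apply: (past_mean0 (f := id)) => //.
  exact: sqle_integrable (sqle_incr m st).
exact: incr_mean.
Qed.

Lemma past_incr_sqr_mean0 m s t Z : 0 <= s <= t -> gmeas (past B m s) Z ->
  P.-integrable setT (EFin \o Z) ->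
  \int[P]_w (Z w * (incr m s t w ^+ 2 - (t - s))) = 0.
Proof.
move=> st pZ iZ; apply: (past_mean0 (f := fun x => x ^+ 2 - (t - s))) => //.
- by apply: measurable_funB => //; exact: measurable_funX.
- exact: sqle_integrable (sqleB (sqle_incr_sqr m st) (sqle_cst P (t - s))).
- rewrite RintegralB//.
  + rewrite Rintegral_cst// [X in _ * X](_ : _ = 1); last first.
      by rewrite [X in fine X]probability_setT.
    rewrite mulr1 /Rintegral incr_second_moment// subrr//.
  + exact: sqle_integrable (sqle_incr_sqr m st).
  + exact: sqle_integrable (sqle_cst P (t - s)).
Qed.

Lemma sqle_past_incr m s t Z c : 0 <= s <= t -> gmeas (past B m s) Z ->
  sqle P Z c -> sqle P (fun w => Z w * incr m s t w) (c * (t - s)).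
Proof.
move=> st pZ [mZ Zc]; have /andP[s0 st'] := st; have t0 := le_trans s0 st'.
have mI := @measurable_incr m s t s0 t0.
split; first exact: measurable_funM.
under eq_integral do rewrite exprMn.
rewrite (ge0_integralM_indep mZ mI _ (f := fun x => x ^+ 2) (g := fun x => x ^+ 2)).
- by rewrite incr_second_moment// EFinM lee_wpmul2r// lee_fin subr_ge0.
- by move=> A D ZA DD; apply: (past_indep hB (m := m) st) => //; exact: pZ.
- exact: measurable_funX.
- exact: measurable_funX.
- by move=> x; exact: sqr_ge0.
- by move=> x; exact: sqr_ge0.
Qed.

Lemma gmeas_past_incr m s m' r r' : 0 <= r -> 0 <= r' ->
  m' != m \/ (r <= s /\ r' <= s) -> gmeas (past B m s) (incr m' r r').
Proof.
move=> r0 r'0 h; have [E|m'm] := eqVneq m' m.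
  case: h => [|[rs r's]]; first by rewrite E eqxx.
  by rewrite E; apply: gmeasB; apply: gmeas_history_past; apply/andP.
by apply: gmeasB; exact: gmeas_other_past.
Qed.

Lemma gmeas_past_filtration m s r (X : T -> R) : r <= s ->
  rv_events X `<=` filtration B r -> gmeas (past B m s) X.
Proof.
move=> rs XF; apply: gmeas_filtration_past; apply: subset_trans XF _.
apply: sub_sigma_algebra2 => A [m' [q [/andP[q0 qr] qA]]].
by exists m', q; rewrite q0 (le_trans qr).
Qed.

Section grid.
Variable tm : nat -> R.
Hypotheses (tm0 : 0 <= tm 0%N) (tmS : forall i, tm i <= tm i.+1).

Lemma grid_ge0 i : 0 <= tm i.
Proof. by elim: i => // i IH; exact: le_trans (tmS i). Qed.

Lemma grid_le i j : (i <= j)%N -> tm i <= tm j.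
Proof.
move=> ij; rewrite -(subnK ij); elim: (j - i)%N => // k IH.
by rewrite addSn (le_trans IH).
Qed.

Let dB m i := incr m (tm i) (tm i.+1).
Let stp i : 0 <= tm i <= tm i.+1. Proof. by rewrite grid_ge0 tmS. Qed.

(** Ito's isometry (as an upper bound): distinct terms are orthogonal, because
    the increment of the later one, or of the other Brownian motion, is centered
    and independent of all the other factors. *)
Lemma ito_isometry n r (X : nat -> nat -> T -> R) (c : nat -> nat -> R) :
  (forall i m, (i < n)%N -> (m < r)%N -> rv_events (X i m) `<=` filtration B (tm i)) ->
  (forall i m, (i < n)%N -> (m < r)%N -> sqle P (X i m) (c i m)) ->
  sqle P (fun w => \sum_(i < n) \sum_(m < r) X i m w * dB m i w)
    (\sum_(i < n) \sum_(m < r) c i m * (tm i.+1 - tm i)).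
Proof.
move=> FX Xc.
pose Y (p : 'I_n * 'I_r) w := X p.1 p.2 w * dB p.2 p.1 w.
have FX' (p : 'I_n * 'I_r) m s : tm p.1 <= s -> gmeas (past B m s) (X p.1 p.2).
  by move=> /gmeas_past_filtration; apply; apply: FX.
have YcP p : sqle P (Y p) (c p.1 p.2 * (tm p.1.+1 - tm p.1)).
  by apply: sqle_past_incr => //; [exact: FX'|exact: Xc].
suff YO p q : p != q -> inner P setT (Y p) (Y q) = 0.
  have := sqle_sum_orthogonal YcP YO.
  rewrite -(pair_bigA_idem _ (fun (i : 'I_n) (m : 'I_r) => c i m 
    * (tm i.+1 - tm i)))//=; last by rewrite addr0.
  apply: sqle_ext => w.
  by rewrite -(pair_bigA_idem _ (fun (i : 'I_n) (m : 'I_r) => X i m w * dB m i w))//= addr0.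
have main (p' q' : 'I_n * 'I_r) : ((p'.1 < q'.1)%N || (p'.1 == q'.1) && (p'.2 != q'.2)) ->
    inner P setT (Y p') (Y q') = 0.
  move: p' q' => [i m] [j m'] /= h.
  have ij : (i <= j)%N by case/orP: h => [/ltnW//|/andP[/eqP -> _]].
  rewrite /inner -[RHS](@past_incr_mean0 m' (tm j) (tm j.+1)
    (fun w => Y (i, m) w * X j m' w) (stp j)).
  - by apply: eq_Rintegral => w _; rewrite {2}/Y /= mulrA.
  - apply: gmeasM; last by apply: (FX' (j, m')).
    apply: gmeasM; first by apply: (FX' (i, m)) => /=; exact: grid_le.
    apply: gmeas_past_incr; rewrite ?grid_ge0//.
    case/orP: h => [ij'|/andP[_ mm']]; last by left; rewrite -val_eqE in mm'.
    by right; split; exact: grid_le.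
  - apply: (@sqint_mul _ _ _ P setT measurableT); apply: sqle_sqint; first exact: YcP.
    exact: Xc.
move=> pq; have [h|h] := boolP ((p.1 < q.1)%N || (p.1 == q.1) && (p.2 != q.2)).
  exact: main.
rewrite innerC; apply: main; move: p q pq h => [i m] [j m'] /=.
rewrite negb_or -leqNgt leq_eqVlt negb_and negbK eq_sym => pq.
move=> /andP[/orP[/eqP ij|->]//].
have {}ij : i = j by apply/val_inj.
rewrite ij !eqxx/= ltnn/= => mm'; move: pq; rewrite ij.
by move=> pq; apply: contra pq => /eqP ->.
Qed.

(** Quadratic covariation: the sum of the products of the increments differs
    from its mean by a sum of orthogonal terms of size the step squared. *)
Lemma quadratic_variation n m m' :
  sqle P (fun w => \sum_(i < n) (dB m i w * dB m' i w - (m == m')%:R * (tm i.+1 - tm i)))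
    (\sum_(i < n) 116 * (tm i.+1 - tm i) ^+ 2).
Proof.
pose Y (i : 'I_n) w := dB m i w * dB m' i w - (m == m')%:R * (tm i.+1 - tm i).
have dBpast i m1 s m2 : tm i.+1 <= s -> gmeas (past B m2 s) (dB m1 i).
  move=> h; apply: gmeas_past_incr; rewrite ?grid_ge0//.
  by right; split => //; exact: le_trans h.
have Ypast (i : 'I_n) s m2 : tm i.+1 <= s -> gmeas (past B m2 s) (Y i).
  move=> h; apply: gmeasB; last exact: gmeas_cst.
  by apply: gmeasM; exact: dBpast.
have YcP i : sqle P (Y i) (116 * (tm i.+1 - tm i) ^+ 2).
  rewrite /Y; have [<-|mm'] := eqVneq m m'.
    apply: sqle_ext (sqle_le _ (sqleB (sqle_incr_sqr m (stp i))
      (sqle_cst P (tm i.+1 - tm i)))) => [w|]; first by rewrite mul1r -expr2.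
    by rewrite le_eqVlt; apply/orP; left; apply/eqP; ring.
  apply: sqle_ext (sqle_le _ (@sqle_past_incr m' _ _ (dB m i) _ (stp i) _
     (sqle_incr m (stp i)))) => [w||].
  - by rewrite mul0r subr0.
  - by rewrite -expr2; have := sqr_ge0 (tm i.+1 - tm i); lra.
  - by apply: gmeas_past_incr; rewrite ?grid_ge0//; left.
apply: (sqle_sum_orthogonal YcP).
suff main (i j : 'I_n) : (i < j)%N -> inner P setT (Y i) (Y j) = 0.
  by move=> i j ij; have [|/main|/val_inj E] := ltngtP i j;
    [exact: main|rewrite innerC|rewrite E eqxx in ij].
move=> ij; have tij : tm i.+1 <= tm j by exact: grid_le.
have sYi := sqle_sqint (YcP i).
rewrite /inner; have [mm'|mm'] := eqVneq m m'; last first.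
  rewrite -[RHS](@past_incr_mean0 m' (tm j) (tm j.+1)
    (fun w => Y i w * dB m j w) (stp j)).
  - apply: eq_Rintegral => w _; rewrite /Y/= (negbTE mm') !mul0r !subr0.
    by rewrite !mulrA.
  - apply: gmeasM; first exact: Ypast.
    by apply: gmeas_past_incr; rewrite ?grid_ge0//; left.
  - apply: (@sqint_mul _ _ _ P setT measurableT) => //.
    exact: sqle_sqint (sqle_incr m (stp j)).
rewrite -[RHS](@past_incr_sqr_mean0 m (tm j) (tm j.+1) (Y i) (stp j)).
- by apply: eq_Rintegral => w _; congr (_ * _); rewrite /Y mm' eqxx mul1r -expr2.
- exact: Ypast.
- exact: sqle_integrable (YcP i).
Qed.

End grid.
End increments.

(** * Ito integrals of deterministic constants *)

Section integral_along_grid.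
Context {R : realType}.
Local Notation mu := (@lebesgue_measure R).
Variable tm : nat -> R.

Lemma ge0_integral_grid n (h : R -> \bar R) :
  (forall i, (i < n)%N -> tm i <= tm i.+1) ->
  measurable_fun `[tm 0%N, tm n] h ->
  (forall s, 0 <= h s)%E ->
  (\int[mu]_(s in `[tm 0%N, tm n]) h s
   = \sum_(i < n) \int[mu]_(s in `[tm i, tm i.+1[) h s)%E.
Proof.
move=> tmS mh h0.
have le0 i : (i <= n)%N -> tm 0%N <= tm i.
  elim: i => // i IH ni; exact: le_trans (IH (ltnW ni)) (tmS i ni).
have mco : measurable_fun `[tm 0%N, tm n[ h.
  by apply: measurable_funS mh => //; exact: subset_itv_co_cc.
rewrite -integral_itv_bndo_bndc//; move: mco {mh}; elim: n tmS le0 => [|n IH] tmS le0 mh.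
  by rewrite set_itv_ge ?bnd_simp ?ltxx// integral_set0 big_ord0.
have Sn : tm n <= tm n.+1 by exact: tmS.
have E : `[tm 0%N, tm n.+1[%classic = `[tm 0%N, tm n[ `|` `[tm n, tm n.+1[ :> set R.
  by rewrite -itv_bndbnd_setU// bnd_simp// le0// leqnSn.
rewrite E in mh *; rewrite ge0_integral_setU//=; last first.
  by rewrite disj_set2E; apply/eqP; rewrite -subset0 => x [] /=;
    rewrite !in_itv/= => /andP[_ xs] /andP[]; rewrite leNgt xs.
rewrite big_ord_recr/= IH//.
- by move=> i ni; apply: tmS; exact: ltnW.
- by move=> i ni; apply: le0; exact: leqW.
- by apply: measurable_funS mh => //; exact: measurableU.
Qed.

Lemma integral_cst_co (x y c : R) : x <= y ->
  (\int[mu]_(s in `[x, y[) c%:E = (c * (y - x))%:E)%E.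
Proof.
move=> xy; rewrite integral_cst//= lebesgue_measure_itv/= lte_fin.
case: ltP => [_|yx]; first by rewrite -EFinB -EFinM.
have -> : y = x by apply/le_anti; rewrite yx xy.
by rewrite subrr mulr0 mule0.
Qed.

End integral_along_grid.

Section ito.
Context {d : measure_display} {T : measurableType d} {R : realType}.
Variable P : probability T R.
Variable B : nat -> R -> T -> R.
Hypothesis hB : independent_brownian_motions P B.
Local Notation mu := (@lebesgue_measure R).
Local Notation elementary := (@elementary R d T).

Lemma elementary_val_cell (f : elementary) n (w : T) (s : R) i :
  el_size f = n -> (forall i, (i < n)%N -> el_time f i <= el_time f i.+1) ->
  (i < n)%N -> el_time f i <= s < el_time f i.+1 ->
  elementary_val f w s = el_coef f i w.
Proof.
move=> sf tS ni si; rewrite /elementary_val; rewrite sf.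
rewrite (bigD1 (Ordinal ni))//= big1 ?addr0.
  by rewrite indicE mem_set/= ?in_itv//= mulr1.
have mono j k : (j <= k)%N -> (k <= n)%N -> el_time f j <= el_time f k.
  move=> jk; rewrite -(subnK jk); elim: (k - j)%N => // l IH h.
  by rewrite addSn (le_trans (IH _))//; [exact: ltnW|apply: tS].
move=> j ji; rewrite indicE memNset/= ?mulr0//= in_itv/=.
move: si => /andP[i_s si] /andP[js sj].
move: ji; rewrite -val_eqE/= neq_ltn => /orP[ji|ij].
  have := mono j.+1 i ji (ltnW ni); rewrite leNgt => /negP; apply.
  exact: le_lt_trans i_s sj.
have := mono i.+1 j ij (ltnW (ltn_ord j)); rewrite leNgt => /negP; apply.
exact: le_lt_trans js si.
Qed.

Lemma ito_isometry1 (tm : nat -> R) m n (X : nat -> T -> R) (c : nat -> R) :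
  0 <= tm 0%N -> (forall i, (i < n)%N -> tm i <= tm i.+1) ->
  (forall i, (i < n)%N -> rv_events (X i) `<=` filtration B (tm i)) ->
  (forall i, (i < n)%N -> sqle P (X i) (c i)) ->
  sqle P (fun w => \sum_(i < n) X i w * incr B m (tm i) (tm i.+1) w)
    (\sum_(i < n) c i * (tm i.+1 - tm i)).
Proof.
move=> tm0 tmS FX Xc.
(* the grid is stopped at its last time to be monotone everywhere *)
pose tm' i := tm (minn i n).
have tm'S i : tm' i <= tm' i.+1.
  rewrite /tm'; have [ni|ni] := ltnP i n.
    by rewrite (minn_idPl ni) tmS.
  by rewrite (minn_idPr (leqW ni)).
have tm'E i : (i <= n)%N -> tm' i = tm i by move=> ni; rewrite /tm' (minn_idPl ni).
pose X' i m' : T -> R := if m' == m then X i else fun=> 0.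
pose c' i m' : R := if m' == m then c i else 0.
have F0 r : rv_events (fun _ : T => 0 : R) `<=` filtration B r by exact: gmeas_cst.
have := @ito_isometry _ _ _ _ _ hB tm' _ tm'S n m.+1 X' c' _ _.
rewrite /tm' min0n => /(_ tm0).
have -> : \sum_(i < n) \sum_(m0 < m.+1) c' i m0 * (tm (minn i.+1 n) - tm (minn i n))
    = \sum_(i < n) c i * (tm i.+1 - tm i).
  apply: eq_bigr => i _; rewrite big_ord_recr/= big1 ?add0r.
    by rewrite /c' eqxx -/(tm' _) -/(tm' _) !tm'E// ltnW.
  by move=> j _; rewrite /c' (ltn_eqF (ltn_ord j)) mul0r.
move=> h; apply: sqle_ext (h _ _) => [w|i m' ni _|i m' ni _].
- apply: eq_bigr => i _; rewrite big_ord_recr/= big1 ?add0r.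
    by rewrite /X' eqxx -/(tm' _) -/(tm' _) !tm'E// ltnW.
  by move=> j _; rewrite /X' (ltn_eqF (ltn_ord j)) mul0r.
- rewrite /X' -/(tm' _) tm'E ?(ltnW ni)//; case: eqP => _; last exact: F0.
  exact: FX.
- by rewrite /X' /c'; case: eqP => _; [exact: Xc|exact: sqle0].
Qed.

Lemma measurable_filtration s (X : T -> R) : rv_events X `<=` filtration B s ->
  measurable_fun setT X.
Proof.
move=> h; apply: (gmeas_past_measurable hB (m := 0%N) (s := s)).
exact: (gmeas_filtration_past).
Qed.

Lemma expectation_sqr (X : T -> R) :
  ('E_P[fun w => (X w ^+ 2)%R] = \int[P]_w (X w ^+ 2)%:E)%E.
Proof. by rewrite unlock. Qed.

(** Both terms are integrals of elementary processes on a common grid, so the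
    isometry compares them through their integrands. *)
Lemma elementary_cst_isometry m (c t : R) (f : elementary) (eps : R) :
  elementary_on P B t f ->
  (\int[P]_w \int[mu]_(s in `[0%R, t]) (((c - elementary_val f w s) ^+ 2)%R)%:E
    <= eps%:E)%E ->
  sqle P (fun w => c * incr B m 0 t w - elementary_int (B m) f w) eps.
Proof.
case: f => n tm co; rewrite /elementary_on /elementary_int /=.
set f := Elementary _ _ _.
move=> [t0 tn tS Fco E2] le_eps.
have mco i : (i < n)%N -> measurable_fun setT (co i).
  by move=> /Fco; exact: measurable_filtration.
have sco i : (i < n)%N -> sqint P setT (co i).
  move=> ni; split; first exact: mco.
  apply/integrableP; split; first by apply: measurable_sqr; exact: mco.
  under eq_integral do rewrite abse_EFin ger0_norm ?sqr_ge0//.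
  by rewrite -expectation_sqr; exact: E2.
have scco i : (i < n)%N -> sqint P setT (fun w => c - co i w).
  move=> ni; apply: sqintB => //; [exact: sqle_sqint (sqle_cst P c)|exact: sco].
have F i : (i < n)%N -> rv_events (fun w => c - co i w) `<=` filtration B (tm i).
  by move=> ni; apply: gmeasB; [exact: gmeas_cst|exact: Fco].
have tm0 : 0 <= tm 0%N by rewrite t0.
have := ito_isometry1 m tm0 tS F (fun i ni => sqint_sqle (scco i ni)).
move=> /sqle_conv; apply => [w|].
  under [LHS]eq_bigr do rewrite mulrBl.
  rewrite sumrB; congr (_ - _).
  rewrite -mulr_sumr -(big_mkord xpredT (fun i => incr B m (tm i) (tm i.+1) w)).
  by rewrite telescope_sumr// t0 tn.
rewrite -lee_fin; apply: le_trans le_eps.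
rewrite le_eqVlt; apply/orP; left; apply/eqP.
transitivity (\int[P]_w \sum_(i < n) ((tm i.+1 - tm i)%:E * ((c - co i w) ^+ 2)%:E))%E.
  rewrite ge0_integral_sum//=; last 2 first.
  - move=> i; apply: measurable_funeM; apply: measurable_sqr.
    by case: (scco i (ltn_ord i)).
  - by move=> i w _; rewrite -EFinM lee_fin mulr_ge0 ?sqr_ge0// subr_ge0 tS.
  rewrite -sumEFin; apply: eq_bigr => i _.
  rewrite ge0_integralZl_EFin//.
  - by rewrite -inner_sqrE//; [rewrite -EFinM mulrC|exact: scco].
  - by move=> w _; rewrite lee_fin sqr_ge0.
  - by apply: measurable_sqr; case: (scco i (ltn_ord i)).
  - by rewrite subr_ge0 tS.
apply: eq_integral => w _; rewrite -{1}t0 -tn ge0_integral_grid//; last 2 first.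
- apply/measurable_EFinP; apply: measurable_funX; apply: measurable_funB => //.
  rewrite /elementary_val; apply: measurable_sum => i.
  by apply: measurable_funM => //; exact: measurable_indic.
- by move=> s; rewrite lee_fin sqr_ge0.
apply: eq_bigr => i _.
rewrite -EFinM mulrC -integral_cst_co ?tS//.
apply: eq_integral => s; rewrite inE/= in_itv/= => si.
by rewrite (@elementary_val_cell f n w s i).
Qed.

(** The constant process is itself elementary: any other approximation has
    integrals with the same limit in mean square. *)
Lemma ito_integral_cst m (c t : R) (J : T -> R) : 0 <= t ->
  ito_integral P B m (fun _ _ => c) t J ->
  {ae P, forall w, J w = c * incr B m 0 t w}.
Proof.
move=> t0 [_ mJ [g [gon gL2 gJ]]].
have mI : measurable_fun setT (fun w => c * incr B m 0 t w).
  by apply: measurable_funM => //; exact: (measurable_incr hB).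
have mg n : measurable_fun setT (elementary_int (B m) (g n)).
  have [t00 tn tS Fco _] := gon n.
  have tge i : (i <= el_size (g n))%N -> 0 <= el_time (g n) i.
    elim: i => [|i IH ni]; first by rewrite t00.
    exact: le_trans (IH (ltnW ni)) (tS i ni).
  apply: measurable_sum => i; apply: measurable_funM.
    exact: measurable_filtration (Fco i (ltn_ord i)).
  by apply: (measurable_incr hB) => //; apply: tge => //; exact: ltnW.
apply: (@cvgL2_ae_unique _ _ _ _ (fun n => elementary_int (B m) (g n))).
  exact/cvgL2P.
move=> e e0; move/ereal_cvg0P : gL2 => /(_ _) gL2.
apply: filterS (gL2 _ e e0) => [n h|n]; last first.
  by apply: integral_ge0 => w _; apply: integral_ge0 => s _; rewrite lee_fin sqr_ge0.
 have := elementary_cst_isometry m (gon n) h.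
by move=> /sqleN; apply: sqle_ext => w; rewrite opprB.
Qed.

Lemma ae_forall_lt n (Q : nat -> T -> Prop) : (forall m, {ae P, forall w, Q m w}) ->
  {ae P, forall w, forall m, (m < n)%N -> Q m w}.
Proof.
move=> h; elim: n => [|n IH]; first exact: aeW.
apply: filterS2 IH (h n) => w h1 h2 m; rewrite ltnS leq_eqVlt => /orP[/eqP->//|].
exact: h1.
Qed.

Lemma wiener_integral_cst (a b : R) (e : nat -> R -> R) (gamma : nat -> R)
    (f : R -> R) (t : R) (S : T -> R) : 0 <= t ->
  wiener_integral P B a b e gamma (fun _ _ => f) t S ->
  measurable_fun setT S /\
  cvgL2 P (fun n w => \sum_(m < n)
    Num.sqrt (gamma m) * dotL2 a b f (e m) * incr B m 0 t w) S.
Proof.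
move=> t0 [mS [J [iJ JS]]]; split => // eps eps0.
have mJ m : measurable_fun setT (J m) by case: (iJ m).
have JE m := ito_integral_cst t0 (iJ m).
have mI m : measurable_fun setT (incr B m 0 t) by exact: (measurable_incr hB).
move/cvgL2P : JS => /(_ _ mS eps eps0) H.
apply: filterS (H _) => [n|n]; last first.
  by apply: measurable_sum => m; exact: measurable_funM.
apply: sqle_ae; last first.
  apply: measurable_funB => //; apply: measurable_sum => m; exact: measurable_funM.
apply: filterS (ae_forall_lt n JE) => w h; congr (_ - _).
by apply: eq_bigr => m _; rewrite h// mulrA.
Qed.

End ito.

(** * Time integrals of measurable processes *)

Section time_integrals.
Context {d : measure_display} {T : measurableType d} {R : realType}.
Variable P : probability T R.
Local Notation mu := (@lebesgue_measure R).
Implicit Types (Y : T -> R -> R) (r s c : R).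

Definition jointly_measurable Y :=
  measurable_fun [set: T * R] (fun z => Y z.1 z.2).

Lemma jointly_measurable_path Y w : jointly_measurable Y ->
  measurable_fun setT (Y w).
Proof. by move=> mY; exact: (measurableT_comp mY (pair1_measurable w)). Qed.

Lemma jointly_measurable_at Y s : jointly_measurable Y ->
  measurable_fun setT (Y ^~ s).
Proof. by move=> mY; exact: (measurableT_comp mY (pair2_measurable s)). Qed.

Let emeasurable_on Y (D : set R) : measurable D -> jointly_measurable Y ->
  measurable_fun [set: T * R] (fun z => ((fun s => (Y z.1 s)%:E) \_ D) z.2).
Proof.
move=> mD mY.
rewrite (_ : (fun z => _) = ((fun z : T * R => (Y z.1 z.2)%:E) \_ (setT `*` D))).
  apply/(measurable_restrictT _ _).1; first exact: measurableX.
  by apply: measurable_funTS; exact/measurable_EFinP.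
apply/funext => -[w s]; rewrite !patchE/=.
suff -> : (s \in D) = ((w, s) \in [set: T] `*` D) by [].
by apply/idP/idP => /set_mem h; apply/mem_set; [split|case: h].
Qed.

Lemma measurable_ge0_time_integral Y (D : set R) : measurable D ->
  jointly_measurable Y -> (forall w s, 0 <= Y w s) ->
  measurable_fun setT (fun w => \int[mu]_(s in D) (Y w s)%:E)%E.
Proof.
move=> mD mY Y0.
under eq_fun do rewrite integral_mkcond.
apply: (@measurable_fun_fubini_tonelli_F _ _ T (measurableTypeR R) R mu
  (fun z => ((fun s => (Y z.1 s)%:E) \_ D) z.2)).
  exact: emeasurable_on.
by move=> z; rewrite patchE; case: ifP; rewrite ?lee_fin.
Qed.

Lemma time_integral_swap Y (D : set R) : measurable D ->
  jointly_measurable Y -> (forall w s, 0 <= Y w s) ->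
  (\int[P]_w \int[mu]_(s in D) (Y w s)%:E = \int[mu]_(s in D) \int[P]_w (Y w s)%:E)%E.
Proof.
move=> mD mY Y0.
under eq_integral do rewrite integral_mkcond.
rewrite (@fubini_tonelli _ _ T (measurableTypeR R) R P mu
  (fun z => ((fun s => (Y z.1 s)%:E) \_ D) z.2)).
- rewrite [RHS]integral_mkcond; apply: eq_integral => s _; rewrite patchE.
  under eq_integral do rewrite patchE/=.
  by case: ifP => //; rewrite integral0.
- exact: emeasurable_on.
- by move=> z; rewrite patchE; case: ifP; rewrite ?lee_fin.
Qed.

Lemma jointly_measurable_sqr Y : jointly_measurable Y ->
  jointly_measurable (fun w s => Y w s ^+ 2).
Proof. by move=> mY; exact: measurable_funX. Qed.

Lemma measurable_time_integral Y (D : set R) : measurable D ->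
  jointly_measurable Y -> measurable_fun setT (fun w => \int[mu]_(s in D) Y w s).
Proof.
move=> mD mY; apply: measurableT_comp => //.
under eq_fun do rewrite integralE.
apply: emeasurable_funB.
  rewrite (_ : (fun w => _) = (fun w => \int[mu]_(s in D) (Num.max (Y w s) 0)%:E)%E).
    apply: measurable_ge0_time_integral => //; first exact: measurable_maxr.
    by move=> w s; rewrite le_max lexx orbT.
  by apply/funext => w; apply: eq_integral => s _; rewrite funeposE EFin_max.
rewrite (_ : (fun w => _) = (fun w => \int[mu]_(s in D) (Num.max (- Y w s) 0)%:E)%E).
  apply: measurable_ge0_time_integral => //.
    by apply: measurable_maxr => //; exact: measurableT_comp.
  by move=> w s; rewrite le_max lexx orbT.
by apply/funext => w; apply: eq_integral => s _; rewrite funenegE EFin_max.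
Qed.

(** Tonelli's theorem exchanges the mean and the time integral. *)
Lemma mean_sqr_time_integral Y r s c : r <= s -> jointly_measurable Y ->
  (forall q, r <= q <= s -> sqle P (Y ^~ q) c) ->
  (\int[P]_w \int[mu]_(q in `[r, s]) (Y w q ^+ 2)%:E <= (c * (s - r))%:E)%E.
Proof.
move=> rs mY Yc; rewrite time_integral_swap//; last 2 first.
- exact: jointly_measurable_sqr.
- by move=> w q; exact: sqr_ge0.
apply: (@le_trans _ _ (\int[mu]_(q in `[r, s]) c%:E)%E).
  apply: ge0_le_integral => //=.
  - by move=> q _; apply: integral_ge0 => w _; rewrite lee_fin sqr_ge0.
  - apply: measurable_funTS.
    apply: (@measurable_fun_fubini_tonelli_G _ _ T (measurableTypeR R) R P
      (fun z => (Y z.1 z.2 ^+ 2)%:E)).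
      by apply/measurable_EFinP; exact: jointly_measurable_sqr.
    by move=> z; rewrite lee_fin sqr_ge0.
  - by move=> q; rewrite in_itv/= => /Yc[].
rewrite -integral_itv_bndo_bndc//; by rewrite integral_cst_co.
Qed.

(** Cauchy-Schwarz in time; when the square is not integrable there is nothing
    to prove. *)
Lemma sqr_Rintegral_le (f : R -> R) r s : r <= s -> measurable_fun setT f ->
  (((\int[mu]_(q in `[r, s]) f q) ^+ 2)%:E
    <= (s - r)%:E * \int[mu]_(q in `[r, s]) (f q ^+ 2)%:E)%E.
Proof.
move=> rs mf; have mI : measurable `[r, s]%classic by [].
have f2 : (0 <= \int[mu]_(q in `[r, s]) (f q ^+ 2)%:E)%E.
  by apply: integral_ge0 => q _; rewrite lee_fin sqr_ge0.
move: rs; rewrite le_eqVlt => /orP[/eqP <-|rs].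
  by rewrite set_itv1 Rintegral_set1 expr0n subrr mul0e.
have [foo|/negP] := boolP (\int[mu]_(q in `[r, s]) (f q ^+ 2)%:E < +oo)%E; last first.
  move/negP; rewrite -leNgt leye_eq => /eqP ->.
  by rewrite gt0_muley ?leey// lte_fin subr_gt0.
have sf : sqint mu `[r, s] f.
  split; first exact: measurable_funTS.
  apply/integrableP; split.
    by apply/measurable_EFinP/measurable_funTS; exact: measurable_funX.
  by under eq_integral do rewrite abse_EFin ger0_norm ?sqr_ge0//.
have lth : mu `[r, s]%classic = (s - r)%:E.
  by rewrite lebesgue_measure_itv/= lte_fin rs EFinB.
have s1 : sqint mu `[r, s] (fun=> 1).
  split; first exact: measurable_cst.
  apply/integrableP; split; first exact/measurable_EFinP.
  under eq_integral do rewrite expr1n abse1.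
  by rewrite integral_cst//= mul1e [X in (X < _)%E]lth ltry.
have E11 : inner mu `[r, s] (fun=> 1) (fun=> 1) = s - r.
  rewrite /inner (@eq_Rintegral _ _ _ mu _ (cst 1)); last by move=> q _; rewrite mulr1.
  by rewrite Rintegral_cst// mul1r [X in fine X]lth.
have E1f : inner mu `[r, s] (fun=> 1) f = \int[mu]_(q in `[r, s]) f q.
  by apply: eq_Rintegral => q _; rewrite mul1r.
rewrite -inner_sqrE// -EFinM lee_fin -E1f.
set x := inner mu `[r, s] (fun=> 1) f.
pose y := inner mu `[r, s] f f.
rewrite -[X in _ <= _ * X]/y.
have sr0 : 0 < s - r by rewrite subr_gt0.
(* the square of f minus its mean has a nonnegative integral *)
pose m := - (x / (s - r)).
have := @inner_ge0 _ _ _ mu `[r, s] (fun q => m * 1 + f q).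
have mI' : measurable (`[r, s]%classic : set (measurableTypeR R)) by [].
have s1m := sqintZ mI' m s1.
have sg := sqintD mI' s1m sf.
have e1 : inner mu `[r, s] (fun=> 1) (fun q => m * 1 + f q) = m * (s - r) + x.
  by rewrite innerC (innerDl mI' s1m sf s1) (innerZl mI' m s1 s1) E11 innerC.
have e2 : inner mu `[r, s] f (fun q => m * 1 + f q) = m * x + y.
  by rewrite innerC (innerDl mI' s1m sf sf) (innerZl mI' m s1 sf).
rewrite (innerDl mI' s1m sf sg) (innerZl mI' m s1 sg) e1 e2 /m => h.
rewrite -subr_ge0.
have -> : (s - r) * y - x ^+ 2 = (s - r) *
  (- (x / (s - r)) * (- (x / (s - r)) * (s - r) + x) + (- (x / (s - r)) * x + y)).
  by field; rewrite gt_eqF.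
by rewrite mulr_ge0// ltW.
Qed.

Lemma sqle_time_integral Y r s c : r <= s -> jointly_measurable Y ->
  (forall q, r <= q <= s -> sqle P (Y ^~ q) c) ->
  sqle P (fun w => \int[mu]_(q in `[r, s]) Y w q) (c * (s - r) ^+ 2).
Proof.
move=> rs mY Yc; split; first exact: measurable_time_integral.
apply: (@le_trans _ _ (\int[P]_w ((s - r)%:E *
    \int[mu]_(q in `[r, s]) (Y w q ^+ 2)%:E))%E).
  apply: ge0_le_integralT => [||w|w].
  - by apply: measurable_sqr; exact: measurable_time_integral.
  - apply: measurable_funeM; apply: measurable_ge0_time_integral => //.
      exact: jointly_measurable_sqr.
    by move=> w q; exact: sqr_ge0.
  - by rewrite lee_fin sqr_ge0.
  - by apply: sqr_Rintegral_le => //; exact: jointly_measurable_path.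
rewrite ge0_integralZl_EFin ?subr_ge0//=; last 2 first.
- by move=> w _; apply: integral_ge0 => q _; rewrite lee_fin sqr_ge0.
- apply: measurable_ge0_time_integral => //; first exact: jointly_measurable_sqr.
  by move=> w q; exact: sqr_ge0.
rewrite expr2 mulrA mulrC EFinM lee_wpmul2l ?lee_fin ?subr_ge0//.
exact: mean_sqr_time_integral.
Qed.

End time_integrals.

(** * Energy of linear systems with additive noise *)

(** The system is [dU = A U dt + dM], where the martingales [M i] are the sums of the
    [sg i m * B m]; it is given in integrated form, almost surely at each time. *)
Section linear_sde.
Context {d : measure_display} {T : measurableType d} {R : realType}.
Variable P : probability T R.
Variable B : nat -> R -> T -> R.
Hypothesis hB : independent_brownian_motions P B.
Local Notation mu := (@lebesgue_measure R).
Variables (I : finType) (A : I -> I -> R) (sg : I -> nat -> R) (u0 : I -> R).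
Variables (tf : R) (U : I -> T -> R -> R) (M : I -> R -> T -> R).
Hypothesis tf0 : 0 <= tf.
Hypothesis hsg : forall i, cvgn (series (fun m => sg i m ^+ 2)).
Hypothesis mU : forall i, jointly_measurable (U i).
Hypothesis cU : {ae P, forall w, forall i, {within `[0, tf], continuous (U i w)}}.
Hypothesis U0 : forall i w, U i w 0 = u0 i.
Hypothesis mM : forall i s, 0 <= s <= tf -> measurable_fun setT (M i s).
Hypothesis cM : forall i s, 0 <= s <= tf ->
  cvgL2 P (fun n w => \sum_(m < n) sg i m * incr B m 0 s w) (M i s).
Hypothesis eqU : forall i s, 0 <= s <= tf -> {ae P, forall w,
  U i w s = u0 i + \int[mu]_(q in `[0, s]) (\sum_j A i j * U j w q) + M i s w}.

Local Notation AU i w q := (\sum_j A i j * U j w q).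

(** The variance per unit of time of the martingale [M i]. *)
Definition noise_rate i := limn (series (fun m => sg i m ^+ 2)).

Lemma noise_rate_ge i n : \sum_(m < n) sg i m ^+ 2 <= noise_rate i.
Proof.
rewrite [leLHS](_ : _ = series (fun m => sg i m ^+ 2) n); last by rewrite seriesEord.
apply: nondecreasing_cvgn_le; last exact: hsg.
by apply/nondecreasing_seqP => m; rewrite !seriesEord/= big_ord_recr/= lerDl sqr_ge0.
Qed.

Lemma noise_rate_ge0 i : 0 <= noise_rate i.
Proof. by have := noise_rate_ge i 0; rewrite big_ord0. Qed.

Lemma sqle_white_noise (c : nat -> R) n r s : 0 <= r <= s ->
  sqle P (fun w => \sum_(m < n) c m * incr B m r s w)
    ((\sum_(m < n) c m ^+ 2) * (s - r)).
Proof.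
move=> /andP[r0 rs]; pose tm i := if i is 0%N then r else s.
have tmS i : tm i <= tm i.+1 by case: i.
have FX i m : (i < 1)%N -> (m < n)%N -> rv_events (fun _ : T => c m) `<=` filtration B (tm i).
  by move=> _ _; exact: gmeas_cst.
have := @ito_isometry _ _ _ _ _ hB tm r0 tmS 1 n (fun _ m _ => c m)
  (fun _ m => c m ^+ 2) FX (fun i m _ _ => sqle_cst P (c m)).
by move=> /sqle_conv; apply => [w|]; rewrite big_ord1//= mulr_suml.
Qed.

(** The partial sums of the noise satisfy the bound by the isometry, and it passes
    to the limit. *)
Lemma sqle_noise_incr i r s : 0 <= r <= s -> s <= tf ->
  sqle P (fun w => M i s w - M i r w) (2 * (noise_rate i * (s - r))).
Proof.
move=> /andP[r0 rs] stf; have s0 := le_trans r0 rs.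
have rtf : 0 <= r <= tf by rewrite r0 (le_trans rs).
have stf' : 0 <= s <= tf by rewrite s0.
apply: sqle_closed; last by apply: measurable_funB; exact: mM.
move=> e e0; have e4 : 0 < e / 4 by rewrite divr_gt0.
have [n [ns nr]] := @filter_ex _ \oo _ _ (filterI (cM i stf' e4) (cM i rtf e4)).
exists (fun w => \sum_(m < n) sg i m * incr B m r s w).
  apply: sqle_conv (sqleB nr ns) _ _ => [w|]; last by lra.
  have -> : \sum_(m < n) sg i m * incr B m r s w
      = \sum_(m < n) sg i m * incr B m 0 s w - \sum_(m < n) sg i m * incr B m 0 r w.
    by rewrite -sumrB; apply: eq_bigr => m _; rewrite /incr; ring.
  by ring.
apply: sqle_le (sqle_white_noise (sg i) n _); last by rewrite r0.
by rewrite ler_wpM2r ?noise_rate_ge ?subr_ge0.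
Qed.

Lemma sqle_noise_tail i n s : 0 <= s <= tf ->
  sqle P (fun w => M i s w - \sum_(m < n) sg i m * incr B m 0 s w)
    (2 * ((noise_rate i - \sum_(m < n) sg i m ^+ 2) * s)).
Proof.
move=> stf; have /andP[s0 _] := stf.
apply: sqle_closed; last first.
  apply: measurable_funB; first exact: mM.
  by apply: measurable_sum => m; apply: measurable_funM => //; exact: (measurable_incr hB).
move=> e e0.
have [p [np ps]] := @filter_ex _ \oo _ _ (filterI (nbhs_infty_ge n) (cM i stf e0)).
pose c m := if (m < n)%N then 0 else sg i m.
have split_sum (f : nat -> R) :
    \sum_(m < p) (if (m < n)%N then 0 else f m) = \sum_(m < p) f m - \sum_(m < n) f m.
  rewrite -(subnKC np) !big_split_ord/=.
  rewrite big1 ?add0r; last by move=> m _; rewrite ltn_ord.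
  rewrite (addrC (\sum_(_ < n) _)) addrK; apply: eq_bigr => m _.
  by rewrite ltnNge leq_addr.
exists (fun w => \sum_(m < p) c m * incr B m 0 s w).
  apply: sqle_conv (sqleN ps) _ _ => [w|//].
  have -> : \sum_(m < p) c m * incr B m 0 s w = \sum_(m < p) sg i m * incr B m 0 s w
      - \sum_(m < n) sg i m * incr B m 0 s w.
    rewrite -(split_sum (fun m => sg i m * incr B m 0 s w)).
    by apply: eq_bigr => m _; rewrite /c; case: ifP; rewrite ?mul0r.
  by ring.
have s00 : (0 : R) <= 0 <= s by apply/andP.
apply: sqle_le (sqle_white_noise c p s00); rewrite subr0 ler_wpM2r//.
have -> : \sum_(m < p) c m ^+ 2 = \sum_(m < p) sg i m ^+ 2 - \sum_(m < n) sg i m ^+ 2.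
  rewrite -(split_sum (fun m => sg i m ^+ 2)).
  by apply: eq_bigr => m _; rewrite /c; case: ifP; rewrite ?expr0n.
by rewrite lerD2r noise_rate_ge.
Qed.

Lemma jointly_measurable_drift i : jointly_measurable (fun w q => AU i w q).
Proof.
apply: measurable_sum => j; apply: measurable_funM => //; exact: mU.
Qed.

Lemma continuous_drift w i : (forall j, {within `[0, tf], continuous (U j w)}) ->
  {within `[0, tf], continuous (fun q => AU i w q)}.
Proof.
move=> cw; elim: (index_enum I) => [|j s IH].
  rewrite (_ : (fun q => _) = fun=> 0); last by apply/funext => q; rewrite big_nil.
  by apply: continuous_subspaceT => x; exact: cvg_cst.
rewrite (_ : (fun q => _) = fun q => A i j * U j w q + \sum_(j <- s) A i j * U j w q); last first.
  by apply/funext => q; rewrite big_cons.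
move=> x; apply: cvgD; last exact: IH.
by apply: cvgM; [exact: cvg_cst|exact: cw].
Qed.

Lemma integrable_sub (f : R -> R) r s : {within `[0, tf], continuous f} ->
  0 <= r -> s <= tf -> mu.-integrable `[r, s] (EFin \o f).
Proof.
move=> cf r0 stf.
have : mu.-integrable `[0, tf] (EFin \o f).
  by apply: continuous_compact_integrable => //; exact: segment_compact.
apply: integrableS => //; apply: subset_itv; by rewrite bnd_simp.
Qed.

Lemma Rintegral_split (f : R -> R) r s : {within `[0, tf], continuous f} ->
  0 <= r <= s -> s <= tf ->
  \int[mu]_(q in `[0, s]) f q = \int[mu]_(q in `[0, r]) f q + \int[mu]_(q in `[r, s]) f q.
Proof.
move=> cf /andP[r0 rs] stf.
have i0s := integrable_sub cf (lexx 0) stf.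
have irs := integrable_sub cf r0 stf.
apply/eqP; rewrite addrC -subr_eq; apply/eqP.
rewrite (Rintegral_itvB i0s) ?bnd_simp//.
rewrite Rintegral_itv_obnd_cbnd//; apply: integrableS irs => //.
exact: subset_itv_oc_cc.
Qed.

Lemma eqU_step i r s : 0 <= r <= s -> s <= tf -> {ae P, forall w,
  U i w s = U i w r + \int[mu]_(q in `[r, s]) AU i w q + (M i s w - M i r w)}.
Proof.
move=> rs stf; have /andP[r0 rs'] := rs.
have rtf : 0 <= r <= tf by rewrite r0 (le_trans rs').
have stf' : 0 <= s <= tf by rewrite (le_trans r0).
apply: filterS3 cU (eqU i stf') (eqU i rtf) => w cw -> ->.
rewrite (Rintegral_split (continuous_drift cw) rs stf).
by ring.
Qed.

Definition drift_bound : R := \sum_i \sum_j A i j ^+ 2.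
Local Notation nI := (#|I|%:R : R).

Lemma drift_bound_ge i j : A i j ^+ 2 <= drift_bound.
Proof.
rewrite /drift_bound (bigD1 i)//= (bigD1 j)//= -addrA lerDl addr_ge0// sumr_ge0//.
  by move=> *; exact: sqr_ge0.
by move=> *; apply: sumr_ge0 => *; exact: sqr_ge0.
Qed.

Lemma drift_bound_ge0 : 0 <= drift_bound.
Proof. by apply: sumr_ge0 => i _; apply: sumr_ge0 => j _; exact: sqr_ge0. Qed.

Lemma sqle_drift i (x : I -> T -> R) c : (forall j, sqle P (x j) c) ->
  sqle P (fun w => \sum_j A i j * x j w) (nI ^+ 2 * drift_bound * c).
Proof.
move=> xc; have c0 j := sqle_ge0 (xc j).
have h j : sqle P (fun w => A i j * x j w) (drift_bound * c).
  apply: sqle_le (sqleZ (A i j) (xc j)).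
  by rewrite ler_wpM2r ?drift_bound_ge// (c0 j).
apply: sqle_le (sqle_sum h); rewrite sumr_const -[_ *+ #|_|]mulr_natl.
by rewrite expr2 !mulrA.
Qed.

(** ** Moments of the solution *)

Definition energy_integral w := (\int[mu]_(q in `[0%R, tf]) (\sum_j U j w q ^+ 2)%:E)%E.

Lemma measurable_energy_integral : measurable_fun setT energy_integral.
Proof.
apply: measurable_ge0_time_integral => //.
  by apply: measurable_sum => j; apply: measurable_funX; exact: mU.
by move=> w q; apply: sumr_ge0 => j _; exact: sqr_ge0.
Qed.

(** The solution has continuous paths but is not known to have second moments.
    Its trajectories are therefore first restricted to an event on which their
    energy is bounded. The event is not adapted, which is harmless: the noise is
    additive, and multiplying by the indicator commutes with the drift. *)
Definition small_energy (c : nat) : set T := [set w | (energy_integral w <= c%:R%:E)%E].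

Lemma measurable_small_energy c : measurable (small_energy c).
Proof.
rewrite (_ : small_energy c = energy_integral @^-1` [set x | (x <= c%:R%:E)%E]).
  rewrite -[X in measurable X]setTI; apply: measurable_energy_integral => //.
  by rewrite -set_itvNyc; exact: emeasurable_itv.
by [].
Qed.

Let chi c w : R := \1_(small_energy c) w.

Let chi01 c w : chi c w = 0 \/ chi c w = 1.
Proof. by rewrite /chi indicE; case: (_ \in _); [right|left]. Qed.

Let mchi c : measurable_fun setT (chi c).
Proof. exact: measurable_indic (measurable_small_energy c). Qed.

Let sqle_chi c X b : sqle P X b -> sqle P (fun w => chi c w * X w) b.
Proof.
move=> Xb; have mX := Xb.1; apply: sqle_mono Xb; first exact: measurable_funM.
by move=> w; case: (chi01 c w) => ->; rewrite ?mul0r ?mul1r// expr0n sqr_ge0.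
Qed.

Let localized_step c i r s b K : 0 <= r <= s -> s <= tf ->
  (forall j q, r <= q <= s -> sqle P (fun w => chi c w * U j w q) b) ->
  sqle P (fun w => chi c w * U i w r) K ->
  sqle P (fun w => chi c w * U i w s)
    (4 * K + 8 * (noise_rate i * (s - r)) + 2 * (nI ^+ 2 * drift_bound * b * (s - r) ^+ 2)).
Proof.
move=> rs stf Ub UK; have /andP[r0 rs'] := rs.
have rtf : 0 <= r <= tf by rewrite r0 (le_trans rs').
have stf' : 0 <= s <= tf by rewrite (le_trans r0).
have mchiU j : jointly_measurable (fun w q => chi c w * U j w q).
  apply: measurable_funM; last exact: mU.
  exact: (measurableT_comp (mchi c) measurable_fst).
have mD : jointly_measurable (fun w q => \sum_j A i j * (chi c w * U j w q)).
  by apply: measurable_sum => j; apply: measurable_funM => //; exact: mchiU.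
have h1 := sqle_time_integral rs' mD (fun q qrs => sqle_drift i (fun j => Ub j q qrs)).
have h2 := sqle_chi c (sqle_noise_incr i rs stf).
have h := sqleD (sqleD UK h2) h1.
apply: (sqle_ae _ _ (sqle_le _ h)); last 1 first.
- rewrite le_eqVlt; apply/orP; left; apply/eqP; ring.
- apply: filterS (eqU_step i rs stf) => w ->.
  have -> : \int[mu]_(q in `[r, s]) (\sum_j A i j * (chi c w * U j w q))
      = chi c w * \int[mu]_(q in `[r, s]) AU i w q.
    case: (chi01 c w) => E; rewrite E ?mul0r ?mul1r.
      rewrite (@eq_Rintegral _ _ _ mu _ (cst 0)) ?Rintegral_cst ?mul0r// => q _.
      by rewrite big1// => j _; rewrite mul0r mulr0.
    by apply: eq_Rintegral => q _; apply: eq_bigr => j _; rewrite mul1r.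
  by ring.
- by apply: measurable_funM => //; exact: jointly_measurable_at.
Qed.

(** Absorption: a finite a priori bound, however large, improves to the
    limit [2 * D] of the iterates of [b |-> D + b / 2]. *)
Lemma half_fixpoint (Q : R -> Prop) D : 0 <= D ->
  (forall b b', b <= b' -> Q b -> Q b') ->
  (forall b, (forall e, 0 < e -> Q (b + e)) -> Q b) ->
  (exists2 b, 0 <= b & Q b) -> (forall b, 0 <= b -> Q b -> Q (D + b / 2)) -> Q (2 * D).
Proof.
move=> D0 Qle Qe [b b0 Qb] Qs.
have h n : Q (2 * D + b / 2 ^+ n).
  elim: n => [|n IH]; first by apply: Qle Qb; rewrite expr0 divr1 lerDr mulr_ge0.
  apply: Qle (Qs _ _ IH); last first.
    by rewrite addr_ge0 ?mulr_ge0// invr_ge0 exprn_ge0.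
  have p0 : (2 : R) ^+ n != 0 by rewrite expf_neq0.
  by rewrite exprS le_eqVlt; apply/orP; left; apply/eqP; field.
apply: Qe => e e0.
have [n nP] : exists n, b / 2 ^+ n <= e.
  exists (Num.bound (b / e)); rewrite ler_pdivrMr ?exprn_gt0// mulrC -ler_pdivrMr//.
  apply: le_trans (ltW (archi_boundP _)) _; first by rewrite divr_ge0// ltW.
  by rewrite -natrX ler_nat ltnW// ltn_expl.
by apply: Qle (h n); rewrite lerD2l.
Qed.

(** On the event, the integral of the drift is bounded by Cauchy-Schwarz in time. *)
Lemma localized_bound c : exists2 b, 0 <= b &
  forall i s, 0 <= s <= tf -> sqle P (fun w => chi c w * U i w s) b.
Proof.
pose v := \sum_i noise_rate i.
have v0 : 0 <= v by apply: sumr_ge0 => i _; exact: noise_rate_ge0.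
pose b0 := \sum_i u0 i ^+ 2.
have b00 : 0 <= b0 by apply: sumr_ge0 => i _; exact: sqr_ge0.
have c0 : 0 <= c%:R :> R by exact: ler0n.
have a0 := drift_bound_ge0; have n0 : 0 <= nI := ler0n _ _.
exists (4 * b0 + 8 * (v * tf) + 2 * (tf * (nI * drift_bound * c%:R))).
  by rewrite !addr_ge0 ?mulr_ge0.
move=> i s stf; have /andP[s0 stf'] := stf.
have mI0 : measurable_fun setT (fun w => \int[mu]_(q in `[0%R, s]) AU i w q).
  by apply: measurable_time_integral => //; exact: jointly_measurable_drift.
have h1 : sqle P (fun w => chi c w * \int[mu]_(q in `[0%R, s]) AU i w q)
    (tf * (nI * drift_bound * c%:R)).
  split; first exact: measurable_funM.
  apply: (@le_trans _ _ (\int[P]_w (tf * (nI * drift_bound * c%:R))%:E)%E); last first.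
    rewrite integral_cst//= [X in (_ * X)%E]probability_setT mule1//.
  apply: ge0_le_integralT => [||w|w].
  - by apply: measurable_sqr; exact: measurable_funM.
  - exact: measurable_cst.
  - by rewrite lee_fin sqr_ge0.
  rewrite /chi indicE; have [/set_mem wc|_] := boolP (w \in small_energy c); last first.
    by rewrite mul0r expr0n lee_fin !mulr_ge0.
  rewrite mul1r; apply: le_trans (sqr_Rintegral_le s0 _) _.
    exact: jointly_measurable_path (jointly_measurable_drift i).
  rewrite subr0 EFinM; apply: lee_pmul => //.
  - by apply: integral_ge0 => q _; rewrite lee_fin sqr_ge0.
  apply: (@le_trans _ _ (\int[mu]_(q in `[0%R, tf])
      ((nI * drift_bound)%:E * (\sum_j U j w q ^+ 2)%:E))%E).
    apply: (@le_trans _ _ (\int[mu]_(q in `[0%R, tf]) (AU i w q ^+ 2)%:E)%E).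
      apply: ge0_subset_integral => //.
      - apply/measurable_EFinP/measurable_funTS; apply: measurable_funX.
        exact: jointly_measurable_path (jointly_measurable_drift i).
      - by move=> q _; rewrite lee_fin sqr_ge0.
      - by apply: subset_itv; rewrite bnd_simp.
    apply: ge0_le_integral => //.
    - by move=> q _; rewrite lee_fin sqr_ge0.
    - apply/measurable_EFinP/measurable_funTS; apply: measurable_funX.
      exact: jointly_measurable_path (jointly_measurable_drift i).
    - apply: measurable_funeM; apply/measurable_EFinP/measurable_funTS.
      apply: measurable_sum => j; apply: measurable_funX.
      exact: jointly_measurable_path (mU j).
    - move=> q _; rewrite -EFinM lee_fin; apply: le_trans (sqr_sum_le _) _.
      rewrite -mulrA ler_wpM2l// mulr_sumr; apply: ler_sum => j _.
      by rewrite exprMn ler_wpM2r ?sqr_ge0// drift_bound_ge.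
  rewrite ge0_integralZl_EFin ?mulr_ge0//; last 2 first.
  - by move=> q _; rewrite lee_fin sumr_ge0// => j _; exact: sqr_ge0.
  - apply/measurable_EFinP/measurable_funTS.
    apply: measurable_sum => j; apply: measurable_funX.
    exact: jointly_measurable_path (mU j).
  rewrite (EFinM (nI * drift_bound)); apply: lee_wpmul2l; last exact: wc.
  by rewrite lee_fin mulr_ge0.
have h2 := sqle_chi c (sqle_noise_incr i (r := 0) (s := s) _ stf').
have h3 := sqle_chi c (sqle_cst P (u0 i)).
have h := sqleD (sqleD h3 (h2 _)) h1.
apply: (sqle_ae _ _ (sqle_le _ (h _))).
- apply: filterS (eqU_step i (r := 0) (s := s) _ stf') => [w ->|].
    by rewrite U0; ring.
  by rewrite lexx.
- by apply: measurable_funM => //; exact: jointly_measurable_at.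
- rewrite subr0.
  have e1 : u0 i ^+ 2 <= b0.
    by rewrite /b0 (bigD1 i)//= lerDl sumr_ge0// => j _; exact: sqr_ge0.
  have e2 : noise_rate i * s <= v * tf.
    apply: ler_pM => //; first exact: noise_rate_ge0.
    by rewrite /v (bigD1 i)//= lerDl sumr_ge0// => j _; exact: noise_rate_ge0.
  by lra.
- by rewrite lexx.
Qed.

(** The bound does not depend on the localization: over a short time the drift
    can be absorbed, and [0, tf] is covered by finitely many short intervals. *)
Lemma localized_moment : exists2 K, 0 <= K &
  forall c i s, 0 <= s <= tf -> sqle P (fun w => chi c w * U i w s) K.
Proof.
pose v := \sum_i noise_rate i.
have v0 : 0 <= v by apply: sumr_ge0 => i _; exact: noise_rate_ge0.
have vi i : noise_rate i <= v.
  by rewrite /v (bigD1 i)//= lerDl sumr_ge0// => j _; exact: noise_rate_ge0.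
have a0 := drift_bound_ge0; have n0 : 0 <= nI := ler0n _ _.
pose L := nI ^+ 2 * drift_bound.
have L0 : 0 <= L by rewrite mulr_ge0// sqr_ge0.
pose tau := (2 * (L + 1))^-1.
have tau0 : 0 < tau by rewrite invr_gt0 mulr_gt0//; lra.
have tauL : 2 * (L * tau ^+ 2) <= 2^-1.
  rewrite /tau expr2 [leLHS](_ : _ = (L / (L + 1) / (L + 1)) / 2); last first.
    by field; lra.
  rewrite ler_pdivrMr// mulVf// ler_pdivrMr; last lra.
  rewrite mul1r ler_pdivrMr; last lra.
  by nra.
suff h n : exists2 K, 0 <= K & forall c i s, 0 <= s <= tf -> s <= n%:R * tau ->
    sqle P (fun w => chi c w * U i w s) K.
  have [K K0 KP] := h (Num.bound (tf / tau)).
  exists K => // c i s /andP[s0 stf]; apply: KP; first by rewrite s0.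
  rewrite -ler_pdivrMr//; apply: le_trans (ltW (archi_boundP _)); last first.
    by rewrite divr_ge0// ltW.
  by rewrite ler_wpM2r// invr_ge0 ltW.
elim: n => [|n [K K0 KP]].
  exists (\sum_i u0 i ^+ 2); first by apply: sumr_ge0 => i _; exact: sqr_ge0.
  move=> c i s /andP[s0 _]; rewrite mul0r => s0'.
  have -> : s = 0 by apply/le_anti; rewrite s0 s0'.
  under eq_fun do rewrite U0; apply: sqle_chi.
  apply: sqle_le (sqle_cst P (u0 i)).
  by rewrite (bigD1 i)//= lerDl sumr_ge0// => j _; exact: sqr_ge0.
have D0 : 0 <= 4 * K + 8 * (v * tau) by rewrite addr_ge0 ?mulr_ge0// ltW.
exists (K + 2 * (4 * K + 8 * (v * tau))); first by rewrite addr_ge0// mulr_ge0.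
move=> c i s stf sn; have /andP[s0 stf'] := stf.
have [sn'|sn'] := leP s (n%:R * tau).
  by apply: sqle_le (KP c i s stf sn'); rewrite lerDl mulr_ge0.
set r := n%:R * tau in sn'.
have r0 : 0 <= r by rewrite mulr_ge0// ltW.
have rtf : r <= tf by rewrite (le_trans _ stf')// ltW.
pose Q b := forall j q, r <= q <= s -> sqle P (fun w => chi c w * U j w q) b.
suff : Q (2 * (4 * K + 8 * (v * tau))).
  move=> /(_ i s); rewrite lexx (ltW sn') => /(_ isT); apply: sqle_le.
  by rewrite lerDr.
apply: half_fixpoint => //.
- by move=> b b' bb' Qb j q rq; exact: sqle_le (Qb j q rq).
- by move=> b Qb j q rq; apply: sqle_eps => e e0; exact: Qb.
- have [b b0 bP] := localized_bound c; exists b => // j q /andP[rq qs].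
  by apply: bP; rewrite (le_trans r0 rq) (le_trans qs).
move=> b b0 Qb j q /andP[rq qs].
have rq' : 0 <= r <= q by rewrite r0.
have qtf : q <= tf by exact: le_trans stf'.
have Ur : sqle P (fun w => chi c w * U j w r) K by apply: KP; rewrite ?r0.
have Qb' j' q' : r <= q' <= q -> sqle P (fun w => chi c w * U j' w q') b.
  by move=> /andP[rq'' q'q]; apply: Qb; rewrite rq'' (le_trans q'q).
have := localized_step rq' qtf Qb' Ur.
have qr : q - r <= tau.
  by move: (le_trans qs sn); rewrite -natr1 mulrDl mul1r -/r; lra.
have qr0 : 0 <= q - r by rewrite subr_ge0.
apply: sqle_le.
have e1 : noise_rate j * (q - r) <= v * tau by apply: ler_pM => //; exact: noise_rate_ge0.
have e2 : (q - r) ^+ 2 <= tau ^+ 2 by rewrite lerXn2r ?nnegrE// ltW.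
have e3 : 2 * (L * b * (q - r) ^+ 2) <= b / 2.
    apply: (@le_trans _ _ (b * (2 * (L * tau ^+ 2)))).
      rewrite [leLHS](_ : _ = b * (2 * (L * (q - r) ^+ 2))); last by ring.
      by rewrite ler_wpM2l// ler_wpM2l// ler_wpM2l.
    by rewrite ler_wpM2l.
by move: e3; rewrite -/L; lra.
Qed.

(** Continuous paths have finite energy, so the restriction is eventually
    inactive. *)
Lemma small_energy_ae : {ae P, forall w, exists n, forall c, (n <= c)%N -> chi c w = 1}.
Proof.
apply: filterS cU => w cw.
have fin : (energy_integral w < +oo)%E.
  have cs : {within `[0, tf], continuous (fun q => \sum_j U j w q ^+ 2)}.
    elim: (index_enum I) => [|j s IH].
      rewrite (_ : (fun q => _) = fun=> 0); last by apply/funext => q; rewrite big_nil.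
      by apply: continuous_subspaceT => x; exact: cvg_cst.
    rewrite (_ : (fun q => _) = fun q => U j w q * U j w q + \sum_(j <- s) U j w q ^+ 2); last first.
      by apply/funext => q; rewrite big_cons expr2.
    move=> x; apply: cvgD; last exact: IH.
    by apply: cvgM; exact: cw.
  exact: integrable_lty (integrable_sub cs (lexx 0) (lexx tf)).
have fin' : energy_integral w \is a fin_num.
  rewrite ge0_fin_numE//; apply: integral_ge0 => q _.
  by rewrite lee_fin sumr_ge0// => j _; exact: sqr_ge0.
exists (Num.bound (fine (energy_integral w))) => c nc.
rewrite /chi indicE mem_set// /small_energy/= -(fineK fin') lee_fin.
apply: le_trans (ltW (archi_boundP _)) _; last by rewrite ler_nat.
apply: fine_ge0; apply: integral_ge0 => q _.
by rewrite lee_fin sumr_ge0// => j _; exact: sqr_ge0.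
Qed.

(** Fatou's lemma removes the restriction. *)
Lemma solution_moment : exists2 K, 0 <= K &
  forall i s, 0 <= s <= tf -> sqle P (fun w => U i w s) K.
Proof.
have [K K0 KP] := localized_moment; exists K => // i s stf.
have mUs : measurable_fun setT (fun w => U i w s) by exact: jointly_measurable_at.
split => //.
have mf c : measurable_fun setT (fun w => ((chi c w * U i w s) ^+ 2)%:E).
  by apply: measurable_sqr; exact: measurable_funM.
rewrite (ge0_ae_eq_integral measurableT
  (g := fun w => limn_einf (fun c => ((chi c w * U i w s) ^+ 2)%:E))).
- apply: le_trans (fatou P measurableT mf _) _.
    by move=> c w _; rewrite lee_fin sqr_ge0.
  apply: le_trans (limn_einf_sup _) _.
  rewrite limn_esup_lim; apply: lime_le; first exact: is_cvg_esups.
  exists 0%N => // k _; apply: ge_ereal_sup => _ [p /= _ <-].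
  by have [] := KP p i s stf.
- exact: measurable_sqr.
- rewrite /limn_einf; apply: measurableT_comp => //.
  by apply: measurable_fun_limn_esup => k; exact: measurableT_comp.
- by move=> w _; rewrite lee_fin sqr_ge0.
- move=> w _; rewrite limn_einf_lim; apply: lime_ge; first exact: is_cvg_einfs.
  by near=> k; apply: le_ereal_inf_tmp => _ [p /= kp <-]; rewrite lee_fin sqr_ge0.
- apply: filterS small_energy_ae => w [n nP] _.
  have h : (fun c => ((chi c w * U i w s) ^+ 2)%:E) @ \oo --> ((U i w s) ^+ 2)%:E.
    apply: cvg_near_cst; exists n => // c /= /nP ->; by rewrite mul1r.
  rewrite is_cvg_limn_einfE; first exact/esym/cvg_lim.
  by apply/cvg_ex; eexists; exact: h.
Unshelve. all: by end_near. Qed.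

Lemma solution_increment : exists2 C, 0 <= C &
  forall i r s, 0 <= r <= s -> s <= tf ->
    sqle P (fun w => U i w s - U i w r) (C * (s - r)).
Proof.
have [K K0 KP] := solution_moment.
pose v := \sum_i noise_rate i.
have v0 : 0 <= v by apply: sumr_ge0 => i _; exact: noise_rate_ge0.
have a0 := drift_bound_ge0; have n0 : 0 <= nI := ler0n _ _.
pose L := nI ^+ 2 * drift_bound * K.
have L0 : 0 <= L by rewrite !mulr_ge0// sqr_ge0.
exists (2 * (L * tf) + 4 * v); first by rewrite addr_ge0 ?mulr_ge0.
move=> i r s rs stf; have /andP[r0 rs'] := rs.
have vi : noise_rate i <= v.
  by rewrite /v (bigD1 i)//= lerDl sumr_ge0// => j _; exact: noise_rate_ge0.
have h1 : sqle P (fun w => \int[mu]_(q in `[r, s]) AU i w q) (L * (s - r) ^+ 2).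
  apply: sqle_time_integral => //; first exact: jointly_measurable_drift.
  move=> q /andP[rq qs]; apply: sqle_drift => j; apply: KP.
  by rewrite (le_trans r0 rq) (le_trans qs).
have h := sqleD h1 (sqle_noise_incr i rs stf).
apply: (sqle_ae _ _ (sqle_le _ h)).
- by apply: filterS (eqU_step i rs stf) => w ->; ring.
- by apply: measurable_funB; exact: jointly_measurable_at.
have sr0 : 0 <= s - r by rewrite subr_ge0.
have e1 : L * (s - r) ^+ 2 <= L * tf * (s - r).
  rewrite expr2 mulrA ler_wpM2r// ler_wpM2l//; lra.
have e2 : noise_rate i * (s - r) <= v * (s - r) by rewrite ler_wpM2r.
by nra.
Qed.

(** ** Explicit Euler scheme with truncated noise *)

(** Powers of 8 make the grids nested and so fine that [n^2 * step n] tends to 0: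
    at level [n] the scheme keeps [n] modes of the noise, hence [n^2] covariations. *)
Definition step n : R := tf / (8 ^ n)%:R.
Definition tm n k : R := k%:R * step n.

Fixpoint euler n k i w : R :=
  if k is k'.+1 then euler n k' i w + step n * (\sum_j A i j * euler n k' j w)
    + \sum_(m < n) sg i m * incr B m (tm n k') (tm n k'.+1) w
  else u0 i.

Lemma pow8_gt0 n : 0 < (8 ^ n)%:R :> R.
Proof. by rewrite ltr0n expn_gt0. Qed.

Lemma step_ge0 n : 0 <= step n.
Proof. by rewrite divr_ge0// ltW// pow8_gt0. Qed.

Lemma tm_ge0 n k : 0 <= tm n k.
Proof. by rewrite mulr_ge0 ?step_ge0. Qed.

Lemma tm_step n k : tm n k.+1 - tm n k = step n.
Proof. by rewrite /tm -natr1; ring. Qed.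

Lemma tmS n k : tm n k <= tm n k.+1.
Proof. by rewrite -subr_ge0 tm_step step_ge0. Qed.

Lemma tm0 n : tm n 0 = 0.
Proof. by rewrite /tm mul0r. Qed.

Lemma tm_last n : tm n (8 ^ n) = tf.
Proof. by rewrite /tm /step mulrC divfK// gt_eqF// pow8_gt0. Qed.

Lemma tm_le n k k' : (k <= k')%N -> tm n k <= tm n k'.
Proof. by move=> kk'; rewrite ler_wpM2r ?step_ge0// ler_nat. Qed.

Lemma tm_tf n k : (k <= 8 ^ n)%N -> 0 <= tm n k <= tf.
Proof. by move=> kn; rewrite tm_ge0 -(tm_last n) tm_le. Qed.

Lemma step_sum n : (8 ^ n)%:R * step n = tf.
Proof. exact: tm_last. Qed.

Lemma cvg_step : step n @[n --> \oo] --> (0 : R).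
Proof.
rewrite /step -[X in _ --> X](mulr0 tf); apply: cvgM; first exact: cvg_cst.
have : (8^-1 : R) ^+ n @[n --> \oo] --> (0 : R).
  by apply: cvg_expr; rewrite ger0_norm// invf_lt1//; lra.
apply: cvg_trans; apply: near_eq_cvg; near=> n.
by rewrite natrX exprVn.
Unshelve. all: by end_near. Qed.

Definition filtration_events (s : R) : set (set T) :=
  [set E | exists m r, 0 <= r <= s /\ rv_events (B m r) E].

Lemma gmeas_filtration_le (X : T -> R) r s : r <= s ->
  gmeas (filtration_events r) X -> gmeas (filtration_events s) X.
Proof.
move=> rs; apply: gmeasS => E [m [q [/andP[q0 qr] qE]]].
apply: sub_sigma_algebra; exists m, q; split => //.
by rewrite q0 (le_trans qr).
Qed.

Lemma gmeas_filtration_incr m r s q : 0 <= r <= q -> 0 <= s <= q ->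
  gmeas (filtration_events q) (incr B m r s).
Proof.
move=> r0 s0; apply: gmeasB; apply: gmeas_gen => E bE; by [exists m, s|exists m, r].
Qed.

Lemma gmeas_euler n k i : gmeas (filtration_events (tm n k)) (euler n k i).
Proof.
elim: k i => [|k IH] i /=; first exact: gmeas_cst.
have IH' j := gmeas_filtration_le (tmS n k) (IH j).
apply: gmeasD; first apply: gmeasD => //.
  apply: gmeasM; first exact: gmeas_cst.
  by apply: gmeas_sum => j; apply: gmeasM => //; exact: gmeas_cst.
apply: gmeas_sum => m; apply: gmeasM; first exact: gmeas_cst.
by apply: gmeas_filtration_incr; rewrite ?tm_ge0/= ?tmS.
Qed.

Lemma measurable_euler n k i : measurable_fun setT (euler n k i).
Proof. by apply: (measurable_filtration hB (s := tm n k)); exact: gmeas_euler. Qed.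

Lemma euler_sum n k i w : euler n k i w =
  u0 i + step n * (\sum_(l < k) \sum_j A i j * euler n l j w)
  + \sum_(m < n) sg i m * incr B m 0 (tm n k) w.
Proof.
elim: k => [|k IH] /=.
  rewrite big_ord0 mulr0 addr0 big1 ?addr0// => m _.
  by rewrite tm0 /incr subrr mulr0.
rewrite IH big_ord_recr/= mulrDr.
have -> : \sum_(m < n) sg i m * incr B m 0 (tm n k.+1) w
    = \sum_(m < n) sg i m * incr B m 0 (tm n k) w
      + \sum_(m < n) sg i m * incr B m (tm n k) (tm n k.+1) w.
  by rewrite -big_split; apply: eq_bigr => m _; rewrite /incr /=; ring.
by ring.
Qed.

Let defect n l i w :=
  \int[mu]_(q in `[tm n l, tm n l.+1]) (\sum_j A i j * (U j w q - U j w (tm n l))).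

(** The solution satisfies the recursion of the scheme, with all the modes of the
    noise, up to the variation of the drift inside each time step. *)
Lemma solution_sum n k i : (k <= 8 ^ n)%N -> {ae P, forall w,
  U i w (tm n k) = u0 i + step n * (\sum_(l < k) \sum_j A i j * U j w (tm n l))
    + \sum_(l < k) defect n l i w + M i (tm n k) w}.
Proof.
elim: k => [_|k IH kn].
  have := eqU i (tm_tf (leq0n (8 ^ n)%N)); apply: filterS => w.
  by rewrite tm0 !big_ord0 set_itv1 Rintegral_set1 mulr0 !addr0.
have kk : 0 <= tm n k <= tm n k.+1 by rewrite tm_ge0 tmS.
have /andP[_ ktf] := tm_tf kn.
apply: filterS3 cU (IH (ltnW kn)) (eqU_step i kk ktf) => w cw -> ->.
rewrite !big_ord_recr/=.
suff -> : \int[mu]_(q in `[tm n k, tm n k.+1]) AU i w q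
    = defect n k i w + step n * \sum_j A i j * U j w (tm n k) by ring.
have iA : mu.-integrable `[tm n k, tm n k.+1] (EFin \o (fun q => AU i w q)).
  exact: integrable_sub (continuous_drift cw) (tm_ge0 _ _) ktf.
have ic : mu.-integrable `[tm n k, tm n k.+1] (EFin \o (fun=> AU i w (tm n k))).
  apply: integrable_sub => //; last exact: tm_ge0.
  by apply: continuous_subspaceT => x; exact: cvg_cst.
have E : \int[mu]_(q in `[tm n k, tm n k.+1]) AU i w (tm n k)
    = step n * AU i w (tm n k).
  rewrite Rintegral_cst//= mulrC; congr (_ * _).
  rewrite [X in fine X](_ : _ = (step n)%:E)// -(tm_step n k).
  rewrite [LHS]lebesgue_measure_itv/= lte_fin.
  have [_|h] := ltP (tm n k) (tm n k.+1); first by rewrite EFinB.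
  by have -> : tm n k.+1 = tm n k; [apply/le_anti; rewrite h tmS|rewrite subrr].
rewrite -E -RintegralD//.
  apply: eq_Rintegral => q _; rewrite -big_split/=.
  by apply: eq_bigr => j _; ring.
have -> : (EFin \o (fun q => \sum_j A i j * (U j w q - U j w (tm n k)))) =
   (fun q => (AU i w q)%:E - (AU i w (tm n k))%:E)%E.
  apply/funext => q /=; rewrite -EFinB; congr EFin.
  by rewrite -sumrB; apply: eq_bigr => j _; ring.
exact: integrableB.
Qed.

Lemma sum_geometric (x : R) (e : R) k :
  \sum_(l < k) x * (e * (1 + x) ^+ l) = e * ((1 + x) ^+ k - 1).
Proof.
elim: k => [|k IH]; first by rewrite big_ord0 expr0 subrr mulr0.
by rewrite big_ord_recr/= IH exprS; ring.
Qed.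

(** Discrete Gronwall: at each step the error grows by the factor
    [1 + c * step n], and the defects and the neglected modes contribute [d0 n]. *)
Lemma euler_converges : exists delta : nat -> R,
  [/\ delta @ \oo --> (0 : R), forall n, 0 <= delta n &
      forall n k i, (k <= 8 ^ n)%N ->
        sqle P (fun w => U i w (tm n k) - euler n k i w) (delta n)].
Proof.
have [C C0 CP] := solution_increment.
have a0 := drift_bound_ge0; have n0 : 0 <= nI := ler0n _ _.
pose L := nI ^+ 2 * drift_bound.
have L0 : 0 <= L by rewrite mulr_ge0// sqr_ge0.
pose tail n := \sum_i (noise_rate i - \sum_(m < n) sg i m ^+ 2).
have taili0 i n : 0 <= noise_rate i - \sum_(m < n) sg i m ^+ 2.
  by rewrite subr_ge0 noise_rate_ge.
have tail0 n : 0 <= tail n by apply: sumr_ge0 => i _; exact: taili0.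
pose d0 n := 4 * (tf ^+ 2 * (L * C) * step n) + 4 * (tf * tail n).
have d00 n : 0 <= d0 n by rewrite addr_ge0// !mulr_ge0 ?step_ge0// sqr_ge0.
pose c := 4 * (tf * L).
have c0 : 0 <= c by rewrite !mulr_ge0.
have cs0 n : 0 <= c * step n by rewrite mulr_ge0 ?step_ge0.
have defectP n l i : (l < 8 ^ n)%N -> sqle P (defect n l i) (L * C * step n ^+ 3).
  move=> ln; have -> : L * C * step n ^+ 3 = L * (C * step n) * (tm n l.+1 - tm n l) ^+ 2.
    by rewrite tm_step; ring.
  apply: sqle_time_integral; first exact: tmS.
    apply: measurable_sum => j; apply: measurable_funM => //.
    apply: measurable_funB; first exact: mU.
    exact: (measurableT_comp (jointly_measurable_at (tm n l) (mU j)) measurable_fst).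
  move=> q /andP[lq ql]; apply: sqle_drift => j.
  have /andP[_ ltf] := tm_tf ln.
  apply: sqle_le (CP j (tm n l) q _ _); last exact: le_trans ltf.
    rewrite ler_wpM2l// -(tm_step n l); lra.
  by rewrite tm_ge0.
have err n k i : (k <= 8 ^ n)%N ->
    sqle P (fun w => U i w (tm n k) - euler n k i w) (d0 n * (1 + c * step n) ^+ k).
  elim/ltn_ind: k i => k IH i kn.
  have kstep : k%:R * step n <= tf by have /andP[] := tm_tf kn.
  pose X l w := \sum_j A i j * (U j w (tm n l) - euler n l j w).
  have XP (l : 'I_k) : sqle P (X l) (L * (d0 n * (1 + c * step n) ^+ l)).
    apply: sqle_drift => j; apply: IH => //.
    by rewrite ltnW// (leq_trans (ltn_ord l)).
  have h1 := sqleZ (step n) (sqle_sum XP).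
  have h2 := sqle_sum (fun l : 'I_k => defectP n l i (leq_trans (ltn_ord l) kn)).
  have h3 := sqle_noise_tail i n (tm_tf kn).
  have h := sqleD (sqleD h1 h2) h3.
  apply: (sqle_ae _ _ (sqle_le _ h)).
  - apply: filterS (solution_sum i kn) => w ->; rewrite euler_sum.
    have -> : \sum_(l < k) X l w = \sum_(l < k) \sum_j A i j * U j w (tm n l)
        - \sum_(l < k) \sum_j A i j * euler n l j w.
      rewrite -sumrB; apply: eq_bigr => l _; rewrite -sumrB.
      by apply: eq_bigr => j _; ring.
    by ring.
  - apply: measurable_funB; last exact: measurable_euler.
    exact: jointly_measurable_at.
  have st0 := step_ge0 n.
  rewrite !card_ord.
  set S := \sum_(l < k) L * _.
  have S0 : 0 <= S.
    by apply: sumr_ge0 => l _; rewrite !mulr_ge0 ?exprn_ge0// addr_ge0.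
  have e1 : step n ^+ 2 * (k%:R * S) <= tf * (step n * S).
    rewrite [leLHS](_ : _ = (k%:R * step n) * (step n * S)); last by ring.
    by rewrite ler_wpM2r ?mulr_ge0.
  have e1' : 4 * (tf * (step n * S)) = d0 n * ((1 + c * step n) ^+ k - 1).
    rewrite -(sum_geometric (c * step n)) /S !mulr_sumr; apply: eq_bigr => l _.
    by rewrite /c; ring.
  have e2 : k%:R * \sum_(l < k) L * C * step n ^+ 3 <= tf ^+ 2 * (L * C) * step n.
    rewrite sumr_const card_ord -mulr_natl.
    rewrite [leLHS](_ : _ = (k%:R * step n) ^+ 2 * ((L * C) * step n)); last by ring.
    rewrite -[leRHS]mulrA; apply: ler_wpM2r; first by rewrite !mulr_ge0.
    by rewrite lerXn2r ?nnegrE// mulr_ge0.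
  have e3 : (noise_rate i - \sum_(m < n) sg i m ^+ 2) * tm n k <= tf * tail n.
    rewrite mulrC; have /andP[tk0 tkf] := tm_tf kn.
    apply: ler_pM => //; rewrite /tail (bigD1 i)//= lerDl sumr_ge0// => j _; exact: taili0.
  by rewrite mulrBr mulr1 in e1'; rewrite /d0 in e1' *; lra.
exists (fun n => d0 n * expR (c * tf)); split.
- rewrite -[X in _ --> X](mul0r (expR (c * tf))).
  apply: cvgM; last exact: cvg_cst.
  rewrite (_ : (0 : R) = 4 * (tf ^+ 2 * (L * C) * 0) + 4 * (tf * 0)); last by rewrite !mulr0 addr0.
  apply: cvgD; apply: cvgM; [exact: cvg_cst| |exact: cvg_cst|].
    by apply: cvgM; [exact: cvg_cst|exact: cvg_step].
  apply: cvgM; first exact: cvg_cst.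
  rewrite /tail; elim: (index_enum I) => [|i s IH].
    rewrite (_ : (fun q => _) = fun=> 0); last by apply/funext => q; rewrite big_nil.
    exact: cvg_cst.
  rewrite (_ : (fun n => _) = (fun n => (noise_rate i - \sum_(m < n) sg i m ^+ 2) +
    \sum_(j <- s) (noise_rate j - \sum_(m < n) sg j m ^+ 2))); last first.
    by apply/funext => n; rewrite big_cons.
  rewrite -[X in _ --> X](addr0 0); apply: cvgD => //.
  rewrite -[X in _ --> X](subrr (noise_rate i)); apply: cvgB; first exact: cvg_cst.
  rewrite (_ : (fun n => _) = series (fun m => sg i m ^+ 2)); first exact: hsg.
  by apply/funext => n; rewrite seriesEord.
- by move=> n; rewrite mulr_ge0 ?expR_ge0.
- move=> n k i kn; apply: sqle_le (err n k i kn); rewrite ler_wpM2l//.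
  apply: (@le_trans _ _ (expR (c * step n) ^+ k)).
    by rewrite lerXn2r ?nnegrE ?expR_ge0 ?addr_ge0// expR_ge1Dx.
  rewrite -expRM_natl ler_expR mulrCA ler_wpM2l//.
  by have /andP[] := tm_tf kn.
Qed.

Lemma euler_estimates : exists K eta, [/\ 0 <= K, eta @ \oo --> (0 : R),
  forall n k i, (k <= 8 ^ n)%N -> sqle P (euler n k i) K &
  forall n k i q, (k <= 8 ^ n)%N -> tm n k <= q <= tf -> q <= tm n k.+1 ->
    sqle P (fun w => U i w q - euler n k i w) (eta n)].
Proof.
have [C C0 CP] := solution_increment; have [K K0 KP] := solution_moment.
have [delta [d0 dge0 dP]] := euler_converges.
have [D [_ hD]] := cvg_seq_bounded (cvgP _ d0).
have dD n : delta n <= D + 1 by apply: le_trans (ler_norm _) _; apply: (hD (D + 1)) => //; rewrite ltrDl.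
have D0 : 0 <= D + 1 := le_trans (dge0 0%N) (dD 0%N).
exists (2 * K + 2 * (D + 1)), (fun n => 2 * (C * step n) + 2 * delta n); split.
- lra.
- rewrite (_ : 0 = 2 * (C * 0) + 2 * 0); last by rewrite !mulr0 addr0.
  apply: cvgD; (apply: cvgM; first exact: cvg_cst) => //.
  by apply: cvgM; [exact: cvg_cst|exact: cvg_step].
- move=> n k i kn; apply: sqle_conv (sqleB (KP i _ (tm_tf kn)) (dP n k i kn)) _ _.
    by move=> w; ring.
  by have := dD n; lra.
- move=> n k i q kn /andP[kq qtf] qk.
  have h : 0 <= tm n k <= q by rewrite tm_ge0.
  apply: sqle_conv (sqleD (CP i _ _ h qtf) (dP n k i kn)) _ _ => [w|]; first by ring.
  by rewrite lerD2r ler_wpM2l// ler_wpM2l// -(tm_step n k) lerD2r.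
Qed.

Variables (g : nat -> R) (rho : I -> nat -> R).
Hypothesis sgE : forall i m, sg i m = g m * rho i m.
Hypothesis skew : forall x : I -> R, \sum_i (\sum_j A i j * x j) * x i = 0.

Section euler_limit.
Variables (K : R) (eta : nat -> R).
Hypothesis K0 : 0 <= K.
Hypothesis eta0 : eta @ \oo --> (0 : R).
Hypothesis KP : forall n k i, (k <= 8 ^ n)%N -> sqle P (euler n k i) K.
Hypothesis etaP : forall n k i q, (k <= 8 ^ n)%N -> tm n k <= q <= tf ->
  q <= tm n k.+1 -> sqle P (fun w => U i w q - euler n k i w) (eta n).

Definition integrand m w q := \sum_i rho i m * U i w q.
Definition euler_coef m n k w := \sum_i rho i m * euler n k i w.
Definition euler_elementary m n := Elementary (8 ^ n) (tm n) (euler_coef m n).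
Definition euler_int n m := elementary_int (B m) (euler_elementary m n).

Let rho2 m := nI * \sum_i rho i m ^+ 2.
Let rho2_ge0 m : 0 <= rho2 m.
Proof. by rewrite mulr_ge0// sumr_ge0// => i _; exact: sqr_ge0. Qed.

Lemma gmeas_euler_coef m n k : gmeas (filtration_events (tm n k)) (euler_coef m n k).
Proof.
apply: gmeas_sum => i; apply: gmeasM; first exact: gmeas_cst.
exact: gmeas_euler.
Qed.

Lemma sqle_euler_coef m n k : (k <= 8 ^ n)%N ->
  sqle P (euler_coef m n k) (rho2 m * K).
Proof. by move=> kn; apply: sqle_linear_comb => i; exact: KP. Qed.

Lemma measurable_euler_int n m : measurable_fun setT (euler_int n m).
Proof.
apply: measurable_sum => k; apply: measurable_funM.
  by apply: measurable_sum => i; apply: measurable_funM => //; exact: measurable_euler.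
exact: (measurable_incr hB m (tm_ge0 _ _) (tm_ge0 _ _)).
Qed.

Lemma euler_elementary_on m n : elementary_on P B tf (euler_elementary m n).
Proof.
split => /=; [exact: tm0|exact: tm_last|by move=> k _; exact: tmS| |].
- by move=> k _; exact: gmeas_euler_coef.
- move=> k kn; rewrite expectation_sqr.
  exact: le_lt_trans (sqle_euler_coef m (ltnW kn)).2 (ltry _).
Qed.

Lemma jointly_measurable_integrand m : jointly_measurable (integrand m).
Proof. by apply: measurable_sum => i; apply: measurable_funM => //; exact: mU. Qed.

Lemma sqle_integrand_coef m n k q : (k <= 8 ^ n)%N -> tm n k <= q <= tf ->
  q <= tm n k.+1 ->
  sqle P (fun w => integrand m w q - euler_coef m n k w) (rho2 m * eta n).
Proof.
move=> kn kq qk.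
apply: sqle_conv (sqle_linear_comb (rho ^~ m) (fun i => etaP i kn kq qk)) _ (lexx _).
by move=> w; rewrite -sumrB; apply: eq_bigr => i _; rewrite mulrBr.
Qed.

(** On each time cell the elementary process is frozen at the left end, where the
    scheme is close to the solution, and the solution varies little on the cell. *)
Lemma integrand_elementary m n :
  (\int[P]_w \int[mu]_(s in `[0%R, tf])
     (((integrand m w s - elementary_val (euler_elementary m n) w s) ^+ 2)%R)%:E
   <= (rho2 m * eta n * tf)%:E)%E.
Proof.
pose Y k w q := integrand m w q - euler_coef m n k w.
have mY k : jointly_measurable (Y k).
  apply: measurable_funB; first exact: jointly_measurable_integrand.
  apply: (measurableT_comp _ measurable_fst).
  by apply: measurable_sum => i; apply: measurable_funM => //; exact: measurable_euler.
have E w : (\int[mu]_(s in `[0%R, tf])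
     (((integrand m w s - elementary_val (euler_elementary m n) w s) ^+ 2)%R)%:E
   = \sum_(k < 8 ^ n) \int[mu]_(s in `[tm n k, tm n k.+1[) (Y k w s ^+ 2)%:E)%E.
  rewrite -{1}(tm0 n) -{1}(tm_last n) ge0_integral_grid//; last first.
  - by move=> s; rewrite lee_fin sqr_ge0.
  - apply: measurableT_comp => //; apply: measurable_funX.
    apply: measurable_funB.
      exact: measurable_funTS (jointly_measurable_path w (jointly_measurable_integrand m)).
    apply: measurable_sum => k; apply: measurable_funM => //.
  - by move=> k _; exact: tmS.
  apply: eq_bigr => k _; apply: eq_integral => s; rewrite inE/= in_itv/= => sk.
  suff -> : elementary_val (euler_elementary m n) w s = euler_coef m n k w by [].
  apply: (@elementary_val_cell _ _ _ (euler_elementary m n) (8 ^ n) w s k) => //.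
  by move=> l _; exact: tmS.
under eq_integral do rewrite E.
rewrite ge0_integral_sum//; last 2 first.
- move=> k; apply: measurable_ge0_time_integral => //; first exact: jointly_measurable_sqr.
  by move=> w s; exact: sqr_ge0.
- by move=> k w _; apply: integral_ge0 => s _; rewrite lee_fin sqr_ge0.
rewrite -(step_sum n) (_ : (_ * _)%:E = \sum_(k < 8 ^ n) (rho2 m * eta n * step n)%:E)%E; last first.
  by rewrite sumEFin; congr EFin; rewrite sumr_const card_ord -mulr_natl; ring.
apply: lee_sum => k _.
apply: le_trans (_ : (\int[P]_w \int[mu]_(s in `[tm n k, tm n k.+1]) (Y k w s ^+ 2)%:E <= _)%E).
  apply: ge0_le_integralT.
  - apply: measurable_ge0_time_integral => //; first exact: jointly_measurable_sqr.
    by move=> w s; exact: sqr_ge0.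
  - apply: measurable_ge0_time_integral => //; first exact: jointly_measurable_sqr.
    by move=> w s; exact: sqr_ge0.
  - by move=> w; apply: integral_ge0 => s _; rewrite lee_fin sqr_ge0.
  move=> w; apply: ge0_subset_integral => //.
  - apply: measurableT_comp => //; apply: measurable_funTS.
    exact: jointly_measurable_path (jointly_measurable_sqr (mY k)).
  - by move=> s _; rewrite lee_fin sqr_ge0.
  - by move=> s /=; rewrite !in_itv/= => /andP[-> /ltW ->].
rewrite -(tm_step n k); apply: mean_sqr_time_integral => //; first exact: tmS.
move=> q /andP[kq qk]; apply: sqle_integrand_coef => //; first exact: ltnW.
by rewrite kq (le_trans qk)//; have /andP[] := tm_tf (ltn_ord k).
Qed.

(** An increment over a coarse cell is the sum of the increments over the fine
    cells that it contains. *)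
Lemma sum_incr_refine (W f : nat -> R) q n :
  \sum_(k < n) f k * (W (k.+1 * q)%N - W (k * q)%N)
  = \sum_(k < n * q) f (k %/ q)%N * (W k.+1 - W k).
Proof.
case: q => [|q].
  by rewrite muln0 big_ord0 big1// => k _; rewrite !muln0 subrr mulr0.
elim: n => [|n IH]; first by rewrite !big_ord0.
rewrite big_ord_recr/= IH.
rewrite -!(big_mkord predT (fun k => f (k %/ q.+1)%N * (W k.+1 - W k))).
rewrite [RHS](big_cat_nat (n := n * q.+1))//=; last by rewrite leq_mul2r leqnSn orbT.
congr (_ + _).
rewrite (@telescope_sumr_eq _ _ _ (fun k => f n * W k)) ?leq_mul2r ?leqnSn ?orbT//.
  by rewrite -mulrBr.
move=> k /andP[nk kn]; rewrite -mulrBr; congr (f _ * _).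
by apply/eqP; rewrite eqn_leq leq_divRL// nk andbT -ltnS ltn_divLR.
Qed.

Lemma sum_step n c : \sum_(k < 8 ^ n) c * step n = c * tf.
Proof. by rewrite sumr_const card_ord -mulr_natl mulrCA step_sum. Qed.

Lemma tm_refine n p k : (n <= p)%N -> tm n k = tm p (k * 8 ^ (p - n)).
Proof.
move=> np; rewrite /tm /step -{2}(subnK np) expnD !natrM.
by field; rewrite !gt_eqF// pow8_gt0.
Qed.

Lemma euler_int_refine m n p w : (n <= p)%N ->
  euler_int n m w = \sum_(k < 8 ^ p)
    euler_coef m n (k %/ 8 ^ (p - n)) w * incr B m (tm p k) (tm p k.+1) w.
Proof.
move=> np.
rewrite -(big_mkord predT (fun k => euler_coef m n (k %/ 8 ^ (p - n)) w
  * incr B m (tm p k) (tm p k.+1) w)).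
have -> : (8 ^ p = 8 ^ n * 8 ^ (p - n))%N by rewrite -expnD subnKC.
rewrite big_mkord -(sum_incr_refine (fun k => B m (tm p k) w) (fun k => euler_coef m n k w)).
by apply: eq_bigr => k _; rewrite /= !(tm_refine _ np).
Qed.

(** On the finer grid both are integrals of elementary processes, so the isometry
    bounds their distance by that of their coefficients, each of which is
    close to the solution. *)
Lemma sqle_euler_int_sub m n p : (n <= p)%N ->
  sqle P (fun w => euler_int n m w - euler_int p m w)
    (rho2 m * (2 * eta n + 2 * eta p) * tf).
Proof.
move=> np; set q := (8 ^ (p - n))%N.
have q0 : (0 < q)%N by rewrite expn_gt0.
have kq k : (k %/ q * q <= k)%N by exact: leq_trunc_div.
pose X k w := euler_coef m n (k %/ q) w - euler_coef m p k w.
have FX k : (k < 8 ^ p)%N -> rv_events (X k) `<=` filtration B (tm p k).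
  move=> _; apply: gmeasB; last exact: gmeas_euler_coef.
  apply: (@gmeas_filtration_le _ (tm n (k %/ q))); last exact: gmeas_euler_coef.
  by rewrite (tm_refine _ np) tm_le.
have cX k : (k < 8 ^ p)%N -> sqle P (X k) (rho2 m * (2 * eta n + 2 * eta p)).
  move=> kp; have nk : (k %/ q < 8 ^ n)%N.
    by rewrite ltn_divLR// -expnD subnKC.
  have /andP[_ ktf] := tm_tf (ltnW kp).
  have h1 i := etaP (q := tm p k) i (ltnW nk).
  have h2 i := etaP (q := tm p k) i (ltnW kp).
  apply: sqle_conv (sqle_linear_comb (rho ^~ m) (fun i => sqleB (h2 i _ _) (h1 i _ _))) _ _.
  - by rewrite lexx.
  - by move=> _; exact: tmS.
  - by move=> _; rewrite (tm_refine _ np) tm_le.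
  - move=> _; rewrite (tm_refine _ np) tm_le// ltnW//.
    by rewrite -ltn_divLR.
  - by move=> w; rewrite /X /euler_coef -sumrB; apply: eq_bigr => i _; ring.
  - by rewrite [in leLHS]addrC.
have := ito_isometry1 hB m (tm_ge0 p 0) (fun k _ => tmS p k) FX cX.
move=> /sqle_conv; apply.
  move=> w; rewrite (euler_int_refine m w np) -sumrB.
  by apply: eq_bigr => k _; rewrite /X /incr /=; ring.
under eq_bigr do rewrite tm_step.
by rewrite sum_step.
Qed.

Lemma sum_ord_tail (f : nat -> R) r s : (r <= s)%N ->
  \sum_(m < s) f m - \sum_(m < r) f m = \sum_(m < s) (if (m < r)%N then 0 else f m).
Proof.
move=> rs; apply/eqP; rewrite subr_eq; apply/eqP.
rewrite -!(big_mkord predT f) -(big_mkord predT (fun m => if (m < r)%N then 0 else f m)).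
rewrite (big_cat_nat (n := r))//= addrC; congr (_ + _).
rewrite [RHS](big_cat_nat (n := r))//= [X in _ = X + _]big_nat_cond.
rewrite [X in _ = X + _]big1 ?add0r => [|m /andP[/andP[_ ->]]//].
by apply: eq_big_nat => m /andP[rm _]; rewrite ltnNge rm.
Qed.

Definition noise_sum r n w := \sum_(m < r) g m * euler_int n m w.
Definition noise_tail r := \sum_i (noise_rate i - \sum_(m < r) sg i m ^+ 2).

Lemma cvg_noise_partial : (\sum_i \sum_(m < r) sg i m ^+ 2) @[r --> \oo]
  --> \sum_i noise_rate i.
Proof.
elim: (index_enum I) => [|i s IH].
  rewrite big_nil (_ : (fun q => _) = fun=> 0); last by apply/funext => q; rewrite big_nil.
  exact: cvg_cst.
rewrite big_cons (_ : (fun n => _) = (fun n => \sum_(m < n) sg i m ^+ 2 +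
  \sum_(j <- s) \sum_(m < n) sg j m ^+ 2)); last first.
  by apply/funext => n; rewrite big_cons.
apply: cvgD => //.
rewrite (_ : (fun n => _) = series (fun m => sg i m ^+ 2)); first exact: hsg.
by apply/funext => n; rewrite seriesEord.
Qed.

Lemma noise_tailE r :
  noise_tail r = \sum_i noise_rate i - \sum_i \sum_(m < r) sg i m ^+ 2.
Proof. by rewrite /noise_tail sumrB. Qed.

Lemma cvg_noise_tail : noise_tail @ \oo --> (0 : R).
Proof.
rewrite (_ : noise_tail = (fun r => \sum_i noise_rate i
   - \sum_i \sum_(m < r) sg i m ^+ 2)); last by apply/funext => r; rewrite noise_tailE.
rewrite -[X in _ --> X](subrr (\sum_i noise_rate i)).
by apply: cvgB; [exact: cvg_cst|exact: cvg_noise_partial].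
Qed.

Let tail_const := nI * K * tf.
Let tail_const_ge0 : 0 <= tail_const.
Proof. by rewrite !mulr_ge0. Qed.

(** The bound is uniform in the time step, because the isometry only sees the
    second moments of the coefficients; this is what makes the limits in the time
    step and in the number of modes commute. *)
Lemma sqle_noise_sum_tail r s n : (r <= s)%N ->
  sqle P (fun w => noise_sum s n w - noise_sum r n w) (tail_const * noise_tail r).
Proof.
move=> rs.
pose X k m w := if (m < r)%N then 0 else \sum_i sg i m * euler n k i w.
pose c (k m : nat) := if (m < r)%N then 0 else nI * (\sum_i sg i m ^+ 2) * K.
have FX k m : (k < 8 ^ n)%N -> (m < s)%N -> rv_events (X k m) `<=` filtration B (tm n k).
  move=> _ _; rewrite /X; case: ltnP => _; first exact: gmeas_cst.
  apply: gmeas_sum => i; apply: gmeasM; first exact: gmeas_cst.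
  exact: gmeas_euler.
have cX k m : (k < 8 ^ n)%N -> (m < s)%N -> sqle P (X k m) (c k m).
  move=> kn _; rewrite /X /c; case: ltnP => _; first exact: sqle0.
  by apply: sqle_linear_comb => i; apply: KP; exact: ltnW.
have := ito_isometry hB (tm_ge0 n 0) (tmS n) FX cX.
move=> /sqle_conv; apply => [w|].
  rewrite /noise_sum (sum_ord_tail (fun m => g m * euler_int n m w) rs) exchange_big/=.
  apply: eq_bigr => m _; rewrite /X; case: ltnP => _.
    by rewrite big1// => k _; rewrite mul0r.
  rewrite /euler_int /elementary_int mulr_sumr; apply: eq_bigr => k _ /=.
  rewrite /euler_coef mulrA; congr (_ * _).
  by rewrite mulr_sumr; apply: eq_bigr => i _; rewrite sgE mulrA.
rewrite (_ : \sum_(i < 8 ^ n) _ = tf * \sum_(m < s) c 0%N m); last first.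
  rewrite -(step_sum n) -mulrA mulr_natl -[in RHS](card_ord (8 ^ n)) -sumr_const.
  apply: eq_bigr => k _; rewrite mulr_sumr; apply: eq_bigr => m _.
  by rewrite tm_step mulrC.
rewrite /tail_const [leRHS](_ : _ = tf * (nI * K * noise_tail r)); last by ring.
rewrite ler_wpM2l// noise_tailE.
have -> : \sum_(m < s) c 0%N m
    = nI * K * (\sum_(m < s) \sum_i sg i m ^+ 2 - \sum_(m < r) \sum_i sg i m ^+ 2).
  rewrite (sum_ord_tail (fun m => \sum_i sg i m ^+ 2) rs) mulr_sumr.
  by apply: eq_bigr => m _; rewrite /c; case: ltnP => _; ring.
rewrite ler_wpM2l ?mulr_ge0//.
rewrite ![\sum_(m < _) \sum_i _]exchange_big/= lerD2r.
by apply: ler_sum => i _; exact: noise_rate_ge.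
Qed.

Lemma euler_int_cauchy m e : 0 < e -> exists N, forall n p, (N <= n)%N -> (N <= p)%N ->
  sqle P (fun w => euler_int n m w - euler_int p m w) e.
Proof.
move=> e0; pose D := rho2 m * tf.
have D0 : 0 <= D by rewrite mulr_ge0.
have e1 : 0 < e / (4 * (D + 1)) by rewrite divr_gt0// mulr_gt0// ltr_wpDl.
have [N _ hN] := cvg0_le eta0 e1.
have sub n p : (N <= n)%N -> (n <= p)%N ->
    sqle P (fun w => euler_int n m w - euler_int p m w) e.
  move=> Nn np; apply: sqle_le (sqle_euler_int_sub m np).
  have h1 := hN n Nn; have h2 := hN p (leq_trans Nn np).
  apply: (@le_trans _ _ (D * (4 * (e / (4 * (D + 1)))))).
    rewrite mulrAC -/D ler_wpM2l//; move: h1 h2 => /=; lra.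
  have -> : D * (4 * (e / (4 * (D + 1)))) = e * (D / (D + 1)).
    by field; rewrite gt_eqF// ltr_wpDl.
  by rewrite ler_piMr ?(ltW e0)// ler_pdivrMr ?ltr_wpDl// mul1r lerDl.
exists N => n p Nn Np; case: (leqP n p) => [np|/ltnW pn]; first exact: sub.
by apply: sqle_ext (sqleN (sub _ _ Np pn)) => w; rewrite opprB.
Qed.

Lemma euler_int_cvg : exists J : nat -> T -> R, forall m,
  measurable_fun setT (J m) /\ cvgL2 P (euler_int ^~ m) (J m).
Proof.
suff h m : exists J, measurable_fun setT J /\ cvgL2 P (euler_int ^~ m) J.
  by have [J hJ] := choice h; exists J.
have [X mX cX] := L2_complete (euler_int_cauchy m) (measurable_euler_int ^~ m).
by exists X.
Qed.

Lemma ito_integral_limit m J : measurable_fun setT J ->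
  cvgL2 P (euler_int ^~ m) J -> ito_integral P B m (integrand m) tf J.
Proof.
move=> mJ cJ; split => //.
  exact: measurable_funTS (jointly_measurable_integrand m).
exists (euler_elementary m); split.
- exact: euler_elementary_on.
- apply/ereal_cvg0P => [n|e e0].
    by apply: integral_ge0 => w _; apply: integral_ge0 => s _; rewrite lee_fin sqr_ge0.
  have c0 : (rho2 m * eta n * tf) @[n --> \oo] --> (0 : R).
    rewrite -[X in _ --> X](mul0r tf); apply: cvgM; last exact: cvg_cst.
    by rewrite -[X in _ --> X](mulr0 (rho2 m)); apply: cvgM => //; exact: cvg_cst.
  apply: filterS (cvg0_le c0 e0) => n h.
  by apply: le_trans (integrand_elementary m n) _; rewrite lee_fin.
- by apply/cvgL2P => // n; exact: measurable_euler_int.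
Qed.

(** Along the diagonal [n] modes are used with the time step of level [n]: first
    fix [r] modes with a small tail, uniformly in the time step, then refine. *)
Lemma noise_sum_diagonal (J : nat -> T -> R) :
  (forall m, measurable_fun setT (J m)) ->
  (forall m, cvgL2 P (euler_int ^~ m) (J m)) ->
  exists2 S, measurable_fun setT S &
    cvgL2 P (fun r w => \sum_(m < r) g m * J m w) S /\
    cvgL2 P (fun n => noise_sum n n) S.
Proof.
move=> mJ cJ; pose F r w := \sum_(m < r) g m * J m w.
have mF r : measurable_fun setT (F r).
  by apply: measurable_sum => m; apply: measurable_funM.
have cF r : cvgL2 P (noise_sum r) (F r).
  have h : smallL2 P (fun n w => \sum_(m < r) g m * (euler_int n m w - J m w)).
    apply: (@smallL2_sum _ _ _ P r (fun n m w => g m * (euler_int n m w - J m w))) => m.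
    exact/smallL2Z/cJ.
  move=> e /h; apply: filterS => n; apply: sqle_ext => w.
  by rewrite /noise_sum /F -sumrB; apply: eq_bigr => m _; rewrite mulrBr.
pose D := tail_const.
have D1 : 0 < D + 1 by rewrite ltr_wpDl.
have tailN e : 0 < e -> exists N, forall r, (N <= r)%N -> D * noise_tail r <= e.
  move=> e0; have e1 : 0 < e / (D + 1) by rewrite divr_gt0.
  have [N _ hN] := cvg0_le cvg_noise_tail e1; exists N => r /hN /= h.
  apply: (@le_trans _ _ (D * (e / (D + 1)))); first by rewrite ler_wpM2l.
  by rewrite mulrCA ler_piMr ?(ltW e0)// ler_pdivrMr// mul1r lerDl.
have Ftail r s : (r <= s)%N -> sqle P (fun w => F s w - F r w) (2 * (D * noise_tail r)).
  move=> rs; apply: sqle_closed; last exact: measurable_funB.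
  move=> e e0; have e4 : 0 < e / 4 by rewrite divr_gt0.
  have [n [hs hr]] := @filter_ex _ \oo _ _ (filterI (cF s _ e4) (cF r _ e4)).
  exists (fun w => noise_sum s n w - noise_sum r n w); last exact: sqle_noise_sum_tail.
  apply: sqle_conv (sqleB hr hs) _ _ => [w|]; [by ring|by lra].
have FC e : 0 < e -> exists N, forall n p, (N <= n)%N -> (N <= p)%N ->
    sqle P (fun w => F n w - F p w) e.
  move=> e0; have e2 : 0 < e / 2 by rewrite divr_gt0.
  have [N hN] := tailN _ e2; exists N => n p Nn Np.
  case: (leqP n p) => [np|/ltnW pn].
    apply: sqle_conv (sqleN (Ftail _ _ np)) _ _ => [w|]; first by rewrite opprB.
    by have := hN n Nn; lra.
  by apply: sqle_le (Ftail _ _ pn); have := hN p Np; lra.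
have [S mS cS] := L2_complete FC mF.
exists S => //; split => // e e0.
have e12 : 0 < e / 12 by rewrite divr_gt0.
have [N hN] := tailN _ e12.
have [r [rN rS]] := @filter_ex _ \oo _ _ (filterI (nbhs_infty_ge N) (cS _ e12)).
near=> n.
have h1 : sqle P (fun w => noise_sum n n w - noise_sum r n w) (e / 12).
  apply: sqle_le (hN r rN) (sqle_noise_sum_tail _ _).
  by near: n; exact: nbhs_infty_ge.
have h2 : sqle P (fun w => noise_sum r n w - F r w) (e / 12).
  by near: n; exact: cF.
apply: sqle_conv (sqleD (sqleD h1 h2) rS) _ _ => [w|]; [by ring|by lra].
Unshelve. all: by end_near. Qed.

Definition euler_drift n k i w := step n * \sum_j A i j * euler n k j w.
Definition euler_noise n k i w := \sum_(m < n) sg i m * incr B m (tm n k) (tm n k.+1) w.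

(** The discrete energy identity is exact. The drift does no work, by skew
    symmetry, and the work of the noise is the sum defining the Ito integral. *)
Lemma euler_energy n k w : \sum_i euler n k i w ^+ 2 = \sum_i u0 i ^+ 2
  + 2 * \sum_(l < k) \sum_(m < n) g m * (euler_coef m n l w
      * incr B m (tm n l) (tm n l.+1) w)
  + \sum_(l < k) \sum_i (euler_drift n l i w + euler_noise n l i w) ^+ 2.
Proof.
elim: k => [|k IH]; first by rewrite !big_ord0 mulr0 !addr0.
rewrite !big_ord_recr/= -/(euler_drift n k _ w) -/(euler_noise n k _ w).
have sk : \sum_i euler n k i w * euler_drift n k i w = 0.
  transitivity (step n * \sum_i (\sum_j A i j * euler n k j w) * euler n k i w).
    by rewrite mulr_sumr; apply: eq_bigr => i _; rewrite /euler_drift; ring.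
  by rewrite (skew (fun i => euler n k i w)) mulr0.
have nk : \sum_(m < n) g m * (euler_coef m n k w * incr B m (tm n k) (tm n k.+1) w)
    = \sum_i euler n k i w * euler_noise n k i w.
  rewrite /euler_coef /euler_noise.
  under eq_bigr do rewrite mulr_suml mulr_sumr.
  rewrite exchange_big/=; apply: eq_bigr => i _; rewrite mulr_sumr.
  by apply: eq_bigr => m _; rewrite sgE; ring.
rewrite nk mulrDr.
have -> : \sum_i (euler n k i w + euler_drift n k i w + euler_noise n k i w) ^+ 2
  = \sum_i euler n k i w ^+ 2 + 2 * \sum_i euler n k i w * euler_drift n k i w
    + 2 * \sum_i euler n k i w * euler_noise n k i w
    + \sum_i (euler_drift n k i w + euler_noise n k i w) ^+ 2.
  by rewrite !mulr_sumr -!big_split/=; apply: eq_bigr => i _; ring.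
by rewrite sk IH; ring.
Qed.

Let L := nI ^+ 2 * drift_bound.
Let L0 : 0 <= L.
Proof. by rewrite mulr_ge0 ?sqr_ge0// drift_bound_ge0. Qed.
Let rate_sum := \sum_i noise_rate i.
Let rate_sum_ge0 : 0 <= rate_sum.
Proof. by apply: sumr_ge0 => i _; exact: noise_rate_ge0. Qed.
Let half := (2^-1 : R).

Lemma cvg_half : half ^+ n @[n --> \oo] --> (0 : R).
Proof. by apply: cvg_expr; rewrite ger0_norm /half// invf_lt1//; lra. Qed.

Lemma step_half n : step n = tf * half ^+ n * half ^+ n * half ^+ n.
Proof.
rewrite /step -!mulrA -!exprMn natrX -exprVn; congr (_ * _ ^+ _).
by rewrite /half; field.
Qed.

Lemma two_half n : (2 ^+ n : R) * half ^+ n = 1.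
Proof. by rewrite -exprMn /half divff// expr1n. Qed.

Lemma half_ge0 n : 0 <= half ^+ n.
Proof. by rewrite exprn_ge0 /half. Qed.

Lemma half_le1 n : half ^+ n <= 1.
Proof. by rewrite exprn_ile1 /half ?invr_ge0 ?invf_le1 ?ler1n. Qed.

Lemma sqle_euler_noise n k i : (k < 8 ^ n)%N ->
  sqle P (euler_noise n k i) (rate_sum * step n).
Proof.
move=> kn; have h : 0 <= tm n k <= tm n k.+1 by rewrite tm_ge0 tmS.
apply: sqle_le (sqle_white_noise (sg i) n h).
rewrite tm_step ler_wpM2r ?step_ge0// (le_trans (noise_rate_ge i n))//.
rewrite /rate_sum (bigD1 i)//= lerDl sumr_ge0// => j _; exact: noise_rate_ge0.
Qed.

(** There are [tf / step] terms, each of smaller order than [step]: a squared drift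
    trivially, and the product of a drift and a noise by Young's inequality with
    the weight [half ^ n], which tends to 0 more slowly than [step n]. *)
Lemma smallL1_drift_terms : smallL1 P (fun n w => \sum_(l < 8 ^ n) \sum_i
  (euler_drift n l i w ^+ 2 + 2 * (euler_drift n l i w * euler_noise n l i w))).
Proof.
pose c := nI * (tf * (tf * (L * K) + 2 * (L * K + tf * rate_sum))).
have LK0 : 0 <= L * K by rewrite mulr_ge0.
apply: (smallL1_bound (c := fun n => c * half ^+ n)).
  by rewrite -[X in _ --> X](mulr0 c); apply: cvgM; [exact: cvg_cst|exact: cvg_half].
move=> n.
have st0 := step_ge0 n.
have p0 : 0 < 2 ^+ n :> R by rewrite exprn_gt0.
have hp : 0 < half ^+ n by rewrite exprn_gt0 /half.
have term (l : 'I_(8 ^ n)) i :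
    able P (fun w => euler_drift n l i w ^+ 2
      + 2 * (euler_drift n l i w * euler_noise n l i w))
    (step n * ((tf * (L * K) + 2 * (L * K + tf * rate_sum)) * half ^+ n)).
  pose a w := \sum_j A i j * euler n l j w.
  have ha : sqle P a (L * K) by apply: sqle_drift => j; apply: KP; exact: ltnW.
  have h1 := ableZ (step n ^+ 2) (able_sqr ha).
  have h2 := ableZ (2 * step n) (ableM hp ha (sqle_euler_noise i (ltn_ord l))).
  apply: able_conv (ableD h1 h2) _ _ => [w|]; first by rewrite /euler_drift /a; ring.
  rewrite !ger0_norm ?sqr_ge0 ?mulr_ge0//.
  have -> : (half ^+ n)^-1 = 2 ^+ n by rewrite -exprVn /half invrK.
  have -> : 2 ^+ n * (rate_sum * step n) = tf * rate_sum * (half ^+ n * half ^+ n).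
    rewrite step_half [LHS](_ : _ = (2 ^+ n * half ^+ n)
      * (rate_sum * (tf * half ^+ n * half ^+ n))); last by ring.
    by rewrite two_half; ring.
  have e1 : step n ^+ 2 * (L * K) <= step n * (tf * (L * K) * half ^+ n).
    rewrite expr2 -mulrA ler_wpM2l// step_half.
    rewrite [leLHS](_ : _ = (half ^+ n * half ^+ n) * (tf * (L * K) * half ^+ n)); last by ring.
    have hh : half ^+ n * half ^+ n <= 1 by rewrite mulr_ile1 ?half_ge0 ?half_le1.
    by apply: ler_piMl hh; rewrite mulr_ge0 ?half_ge0// mulr_ge0.
  have e2 : tf * rate_sum * (half ^+ n * half ^+ n) <= tf * rate_sum * half ^+ n.
    by rewrite ler_wpM2l ?mulr_ge0// ler_piMl ?half_ge0 ?half_le1.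
  have e3 : 2 * step n * (half ^+ n * (L * K) + tf * rate_sum * (half ^+ n * half ^+ n))
     <= 2 * step n * (half ^+ n * (L * K) + tf * rate_sum * half ^+ n).
    by rewrite ler_wpM2l ?mulr_ge0// lerD2l.
  apply: le_trans (lerD e1 e3) _.
  by rewrite le_eqVlt; apply/orP; left; apply/eqP; ring.
have h := able_sum (fun l : 'I_(8 ^ n) => able_sum (term l)).
apply: able_le h; set X := (X in step n * X).
have -> : \sum_(l < 8 ^ n) \sum_(i : I) step n * X = nI * X * tf.
  rewrite -(sum_step n); apply: eq_bigr => l _; rewrite sumr_const -[LHS]mulr_natl.
  by rewrite mulrCA mulrC.
by rewrite /X /c le_eqVlt; apply/orP; left; apply/eqP; ring.
Qed.

(** Expanding the squares exhibits the covariations of the Brownian motions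
    along the grid. *)
Lemma quadratic_noise n w :
  \sum_(l < 8 ^ n) \sum_i euler_noise n l i w ^+ 2
    - tf * \sum_i \sum_(m < n) sg i m ^+ 2
  = \sum_i \sum_(m < n) sg i m * \sum_(m' < n) sg i m' *
      \sum_(l < 8 ^ n) (incr B m (tm n l) (tm n l.+1) w * incr B m' (tm n l) (tm n l.+1) w
         - (m == m' :> nat)%:R * (tm n l.+1 - tm n l)).
Proof.
rewrite exchange_big/= mulr_sumr -sumrB; apply: eq_bigr => i _.
have E : tf * \sum_(m < n) sg i m ^+ 2 = \sum_(m < n) sg i m * \sum_(m' < n) sg i m' *
    \sum_(l < 8 ^ n) ((m == m' :> nat)%:R * (tm n l.+1 - tm n l)).
  rewrite mulr_sumr; apply: eq_bigr => m _; rewrite (bigD1 m)//= [X in _ + X]big1 => [|m' mm'].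
    rewrite eqxx addr0; under eq_bigr do rewrite mul1r tm_step.
    by rewrite sumr_const card_ord -mulr_natl step_sum; ring.
  by rewrite big1 ?mulr0// => l _; rewrite (negbTE (_ : _ != _)) ?mul0r// eq_sym.
have F : \sum_(l < 8 ^ n) euler_noise n l i w ^+ 2
    = \sum_(m < n) sg i m * \sum_(m' < n) sg i m' * \sum_(l < 8 ^ n)
        (incr B m (tm n l) (tm n l.+1) w * incr B m' (tm n l) (tm n l.+1) w).
  rewrite /euler_noise; under eq_bigr => l _.
    rewrite expr2 mulr_suml; under eq_bigr do rewrite mulr_sumr.
    over.
  rewrite exchange_big/=; apply: eq_bigr => m _.
  rewrite exchange_big/= mulr_sumr; apply: eq_bigr => m' _.
  by rewrite !mulr_sumr; apply: eq_bigr => l _; ring.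
rewrite F E -sumrB; apply: eq_bigr => m _; rewrite -mulrBr -sumrB; congr (_ * _).
by apply: eq_bigr => m' _; rewrite -mulrBr -sumrB.
Qed.

(** Each of the [n^2] centred covariations has second moment of order [step n],
    and [n^2 * step n] tends to 0. *)
Lemma smallL2_quadratic_noise : smallL2 P (fun n w =>
  \sum_(l < 8 ^ n) \sum_i euler_noise n l i w ^+ 2
    - tf * \sum_i \sum_(m < n) sg i m ^+ 2).
Proof.
pose c := nI * \sum_(i : I) noise_rate i ^+ 2 * (116 * tf ^+ 2).
apply: (smallL2_bound (c := fun n => c * half ^+ n)).
  by rewrite -[X in _ --> X](mulr0 c); apply: cvgM; [exact: cvg_cst|exact: cvg_half].
move=> n; have st0 := step_ge0 n.
pose Q m m' w := \sum_(l < 8 ^ n) (incr B m (tm n l) (tm n l.+1) w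
  * incr B m' (tm n l) (tm n l.+1) w - (m == m')%:R * (tm n l.+1 - tm n l)).
have hQ m m' : sqle P (Q m m') (116 * (tf * step n)).
  apply: sqle_conv (quadratic_variation hB (tm_ge0 n 0) (tmS n) (8 ^ n) m m') _ _ => //.
  under eq_bigr do rewrite tm_step.
  by rewrite sumr_const card_ord -mulr_natl expr2 -(step_sum n); lra.
have inner i m : sqle P (fun w => \sum_(m' < n) sg i m' * Q m m' w)
    (n%:R * (noise_rate i * (116 * (tf * step n)))).
  have h := sqle_sum (fun m' : 'I_n => sqleZ (sg i m') (hQ m m')).
  apply: sqle_le h; rewrite card_ord -mulr_suml ler_wpM2l// ler_wpM2r ?mulr_ge0//.
  exact: noise_rate_ge.
have outer i : sqle P (fun w => \sum_(m < n) sg i m * \sum_(m' < n) sg i m' * Q m m' w)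
    (noise_rate i ^+ 2 * (116 * tf ^+ 2) * half ^+ n).
  have h := sqle_sum (fun m : 'I_n => sqleZ (sg i m) (inner i m)).
  apply: sqle_le h; rewrite card_ord -mulr_suml.
  have r0 := noise_rate_ge0 i.
  apply: (@le_trans _ _ (n%:R * (noise_rate i * (n%:R * (noise_rate i * (116 * (tf * step n))))))).
    by rewrite ler_wpM2l// ler_wpM2r ?mulr_ge0// noise_rate_ge.
  have n2 : (n%:R : R) * half ^+ n <= 1.
    rewrite -[leRHS](two_half n) ler_wpM2r ?half_ge0// -natrX ler_nat ltnW//; exact: ltn_expl.
  have n20 : 0 <= (n%:R : R) * half ^+ n by rewrite mulr_ge0 ?half_ge0.
  rewrite step_half [leLHS](_ : _ = noise_rate i ^+ 2 * (116 * tf ^+ 2) * half ^+ n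
    * ((n%:R * half ^+ n) * (n%:R * half ^+ n))); last by ring.
  have hh : (n%:R : R) * half ^+ n * (n%:R * half ^+ n) <= 1 by rewrite mulr_ile1.
  by apply: ler_piMr hh; rewrite mulr_ge0 ?half_ge0// mulr_ge0 ?sqr_ge0// mulr_ge0 ?sqr_ge0.
apply: sqle_conv (sqle_sum outer) _ _ => [w|]; first by rewrite quadratic_noise.
suff -> : nI * \sum_(i : I) noise_rate i ^+ 2 * (116 * tf ^+ 2) * half ^+ n = c * half ^+ n by [].
by rewrite /c -mulrA mulr_suml.
Qed.

Lemma smallL2_cst (c : nat -> R) : c @ \oo --> (0 : R) -> smallL2 P (fun n _ => c n).
Proof.
move=> c0; apply: (smallL2_bound (c := fun n => c n ^+ 2)) => [|n]; last exact: sqle_cst.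
by rewrite -[X in _ --> X](mulr0 (0 : R)); under eq_fun do rewrite expr2; exact: cvgM.
Qed.

Lemma smallL1_ae0 (X : nat -> T -> R) (Z : T -> R) : smallL1 P X ->
  (forall n, X n =1 Z) -> {ae P, forall w, Z w = 0}.
Proof.
move=> hX XZ; apply: able0_ae => e e0.
have [n h] := @filter_ex _ \oo _ _ (hX e e0).
exact: able_ext (XZ n) h.
Qed.

Lemma smallL1_energy_gap : smallL1 P (fun n w =>
  \sum_i U i w tf ^+ 2 - \sum_i euler n (8 ^ n) i w ^+ 2).
Proof.
have [K1 K10 K1P] := solution_moment.
have tf01 : 0 <= tf <= tf by rewrite tf0 lexx.
suff h i : smallL1 P (fun n w => U i w tf ^+ 2 - euler n (8 ^ n) i w ^+ 2).
  move=> e e0.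
  have n1 : 0 < nI + 1 by rewrite ltr_wpDl.
  have e1 : 0 < e / (nI + 1) by rewrite divr_gt0.
  have : \forall n \near \oo, forall i, able P (fun w => U i w tf ^+ 2
      - euler n (8 ^ n) i w ^+ 2) (e / (nI + 1)) by apply: filter_forall => i; exact: h.
  apply: filterS => n hn.
  apply: able_conv (able_sum hn) _ _ => [w|]; first by rewrite sumrB.
  rewrite sumr_const -[leLHS]mulr_natl mulrCA ler_piMr ?(ltW e0)//.
  by rewrite ler_pdivrMr// mul1r lerDl.
have h1 : smallL2 P (fun n w => U i w tf - euler n (8 ^ n) i w).
  apply: smallL2_bound eta0 _ => n.
  by apply: etaP => //; [rewrite tm_last lexx|rewrite -[leLHS](tm_last n) tmS].
have h2 n : sqle P (fun w => U i w tf + euler n (8 ^ n) i w) (2 * K1 + 2 * K).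
  by apply: sqleD; [exact: K1P|exact: KP].
move=> e /(smallL1M h1 h2); apply: filterS => n; apply: able_ext => w.
by rewrite -subr_sqr.
Qed.

(** The coefficients are known at the left ends, so the martingale property
    annihilates every term. *)
Lemma noise_sum_mean n : P.-integrable setT (EFin \o noise_sum n n) /\
  \int[P]_w noise_sum n n w = 0.
Proof.
have h k m : (k < 8 ^ n)%N ->
    P.-integrable setT (EFin \o (fun w => euler_coef m n k w * incr B m (tm n k) (tm n k.+1) w))
    /\ \int[P]_w (euler_coef m n k w * incr B m (tm n k) (tm n k.+1) w) = 0.
  move=> kn; have kk : 0 <= tm n k <= tm n k.+1 by rewrite tm_ge0 tmS.
  have gm : gmeas (past B m (tm n k)) (euler_coef m n k).
    by apply: gmeas_filtration_past; exact: gmeas_euler_coef.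
  have sc := sqle_euler_coef m (ltnW kn).
  split; first exact: sqle_integrable (sqle_past_incr hB kk gm sc).
  by apply: (past_incr_mean0 hB kk gm); exact: sqle_integrable sc.
have sumI (J : finType) (X : J -> T -> R) :
    (forall j, P.-integrable setT (EFin \o X j) /\ \int[P]_w X j w = 0) ->
    P.-integrable setT (EFin \o (fun w => \sum_j X j w)) /\
    \int[P]_w (\sum_j X j w) = 0.
  move=> hX; elim: (index_enum J) => [|j s [IH1 IH2]].
    rewrite (_ : (fun w => _) = fun=> 0); last by apply/funext => w; rewrite big_nil.
    by split; [exact: integrable0|rewrite Rintegral_cst// mul0r].
  rewrite (_ : (fun w => _) = (fun w => X j w + \sum_(i <- s) X i w)); last first.
    by apply/funext => w; rewrite big_cons.
  have [h1 h2] := hX j; split; last by rewrite RintegralD// h2 IH2 addr0.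
  rewrite (_ : EFin \o _ = (fun w => (X j w)%:E + (\sum_(i <- s) X i w)%:E)%E)//.
  exact: integrableD.
rewrite /noise_sum.
rewrite (_ : (fun w => _) = (fun w => \sum_(m < n) \sum_(k < 8 ^ n)
   g m * (euler_coef m n k w * incr B m (tm n k) (tm n k.+1) w))); last first.
  apply/funext => w; apply: eq_bigr => m _; rewrite mulr_sumr.
  by apply: eq_bigr => k _.
apply: (sumI) => m; apply: (sumI) => k; have [h1 h2] := h k m (ltn_ord k).
split; last by rewrite RintegralZl// h2 mulr0.
rewrite (_ : EFin \o _ = (fun w => (g m)%:E *
  (euler_coef m n k w * incr B m (tm n k) (tm n k.+1) w)%:E)%E)//.
exact: integrableZl.
Qed.

Lemma limit_mean0 S : cvgL2 P (fun n => noise_sum n n) S ->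
  measurable_fun setT S -> P.-integrable setT (EFin \o S) /\ \int[P]_w S w = 0.
Proof.
move=> cS mS.
have iD n : forall e, able P (fun w => noise_sum n n w - S w) e ->
    P.-integrable setT (EFin \o S) /\ `|\int[P]_w S w| <= e.
  move=> e h; have i1 := able_integrable h; have [i2 m2] := noise_sum_mean n.
  have iS : P.-integrable setT (EFin \o S).
    rewrite (_ : EFin \o S = (fun w => (noise_sum n n w)%:E - (noise_sum n n w - S w)%:E)%E).
      exact: integrableB.
    by apply/funext => w /=; rewrite -EFinB; congr EFin; ring.
  split => //; have := able_abs_mean h.
  by rewrite RintegralB// m2 sub0r normrN.
have cS1 := smallL2_L1 cS.
have [n hn] := @filter_ex _ \oo _ _ (cS1 1 ltr01).
split; first by have [] := iD n _ hn.
apply/eqP; rewrite -normr_le0; apply/ler_addgt0Pr => e e0; rewrite add0r.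
have [p hp] := @filter_ex _ \oo _ _ (cS1 e e0).
by have [] := iD p _ hp.
Qed.

(** Limit of the discrete identity: the energies converge in [L^1], the discrete
    integrals in [L^2], and the sum of the squares of the noise tends to its rate
    times the elapsed time. The mean follows because [S] is centred. *)
Lemma energy_identity_aux : exists (S : T -> R) (J : nat -> T -> R),
  [/\ forall m, ito_integral P B m (integrand m) tf (J m),
      measurable_fun setT S,
      (fun n => 'E_P[fun w => ((S w - \sum_(m < n) g m * J m w) ^+ 2)%R])%E
        @ \oo --> (0 : \bar R),
      {ae P, forall w, \sum_i U i w tf ^+ 2
         = 2 * S w + \sum_i u0 i ^+ 2 + (\sum_i noise_rate i) * tf} &
      ('E_P[fun w => (\sum_i U i w tf ^+ 2)%R]
         = (\sum_i u0 i ^+ 2 + (\sum_i noise_rate i) * tf)%:E)%E].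
Proof.
have [J hJ] := euler_int_cvg.
have [S mS [cF cS]] := noise_sum_diagonal (fun m => (hJ m).1) (fun m => (hJ m).2).
have ae : {ae P, forall w, \sum_i U i w tf ^+ 2
         = 2 * S w + \sum_i u0 i ^+ 2 + (\sum_i noise_rate i) * tf}.
  suff : {ae P, forall w, \sum_i U i w tf ^+ 2
         - (2 * S w + \sum_i u0 i ^+ 2 + (\sum_i noise_rate i) * tf) = 0}.
    by apply: filterS => w /eqP; rewrite subr_eq0 => /eqP.
  have c0 : (tf * (\sum_i \sum_(m < n) sg i m ^+ 2 - \sum_i noise_rate i)) @[n --> \oo]
      --> (0 : R).
    rewrite -[X in _ --> X](mulr0 tf); apply: cvgM; first exact: cvg_cst.
    rewrite -[X in _ --> X](subrr (\sum_i noise_rate i)); apply: cvgB; last exact: cvg_cst.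
    exact: cvg_noise_partial.
  apply: smallL1_ae0 (smallL1D (smallL1D (smallL1D (smallL1D smallL1_energy_gap
    (smallL1Z 2 (smallL2_L1 cS))) smallL1_drift_terms)
    (smallL2_L1 smallL2_quadratic_noise)) (smallL2_L1 (smallL2_cst c0))) _ => n w.
  rewrite (euler_energy n (8 ^ n) w).
  have -> : \sum_(l < 8 ^ n) \sum_(m < n) g m * (euler_coef m n l w
      * incr B m (tm n l) (tm n l.+1) w) = noise_sum n n w.
    rewrite exchange_big/=; apply: eq_bigr => m _; rewrite mulr_sumr.
    by apply: eq_bigr => l _.
  have -> : \sum_(l < 8 ^ n) \sum_i (euler_drift n l i w + euler_noise n l i w) ^+ 2
    = \sum_(l < 8 ^ n) \sum_i (euler_drift n l i w ^+ 2
        + 2 * (euler_drift n l i w * euler_noise n l i w))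
      + \sum_(l < 8 ^ n) \sum_i euler_noise n l i w ^+ 2.
    rewrite -big_split/=; apply: eq_bigr => l _; rewrite -big_split/=.
    by apply: eq_bigr => i _; ring.
  by ring.
exists S, J; split => //.
- by move=> m; have [mJ cJ] := hJ m; exact: ito_integral_limit.
- apply/cvgL2P => // n; apply: measurable_sum => m; apply: measurable_funM => //.
  by have [] := hJ m.
have [iS mS0] := limit_mean0 cS mS.
have iT : P.-integrable setT (EFin \o (fun w => 2 * S w)).
  rewrite (_ : EFin \o _ = (fun w => 2%:E * (S w)%:E)%E)//; exact: integrableZl.
set c := \sum_i u0 i ^+ 2 + _.
rewrite unlock.
transitivity (\int[P]_w ((2 * S w)%:E + c%:E))%E.
  apply: ae_eq_integral => //.
  - apply: measurableT_comp => //; apply: measurable_sum => i; apply: measurable_funX.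
    exact: jointly_measurable_at.
  - by apply: emeasurable_funD => //; apply: measurableT_comp => //; exact: measurable_funM.
  - by apply: filterS ae => w h _; rewrite h -EFinD /c addrA.
rewrite integralD//; last exact: finite_measure_integrable_cst.
rewrite [X in (_ + X)%E](_ : _ = c%:E); last first.
  by rewrite (@integral_cst _ _ _ P setT measurableT c%:E) [X in (_ * X)%E]probability_setT mule1.
rewrite -[X in (X + _)%E]fineK; last first.
  exact: integrable_fin_num.
rewrite -/(Rintegral _ _ _) RintegralZl// mS0 mulr0 add0e//.
Qed.

End euler_limit.

Lemma linear_energy_identity : exists (S : T -> R) (J : nat -> T -> R),
  [/\ forall m, ito_integral P B m (fun w q => \sum_i rho i m * U i w q) tf (J m),
      measurable_fun setT S,
      (fun n => 'E_P[fun w => ((S w - \sum_(m < n) g m * J m w) ^+ 2)%R])%E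
        @ \oo --> (0 : \bar R),
      {ae P, forall w, \sum_i U i w tf ^+ 2
         = 2 * S w + \sum_i u0 i ^+ 2 + (\sum_i noise_rate i) * tf} &
      ('E_P[fun w => (\sum_i U i w tf ^+ 2)%R]
         = (\sum_i u0 i ^+ 2 + (\sum_i noise_rate i) * tf)%:E)%E].
Proof.
have [K [eta [K0 eta0 KP etaP]]] := euler_estimates.
exact: (energy_identity_aux K0 eta0 KP etaP).
Qed.

End linear_sde.

Lemma ito_integral_ext {d : measure_display} {T : measurableType d} {R : realType}
    (P : probability T R) (B : nat -> R -> T -> R) m (f f' : T -> R -> R) t J :
  (forall w s, 0 <= s <= t -> f w s = f' w s) ->
  ito_integral P B m f t J -> ito_integral P B m f' t J.
Proof.
move=> ff' [mf mJ [g [gt gf gJ]]]; split => //.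
  apply: eq_measurable_fun mf => -[w s]; rewrite inE => -[_ /=]; rewrite in_itv/=.
  exact: ff'.
have E n : (\int[P]_w \int[@lebesgue_measure R]_(s in `[0%R, t])
      (((f w s - elementary_val (g n) w s) ^+ 2)%R)%:E)%E
    = (\int[P]_w \int[@lebesgue_measure R]_(s in `[0%R, t])
      (((f' w s - elementary_val (g n) w s) ^+ 2)%R)%:E)%E.
  apply: eq_integral => w _; apply: eq_integral => s.
  by rewrite inE/= in_itv/= => st; rewrite ff'.
exists g; split; [exact: gt| |exact: gJ].
by rewrite -(funext E).
Qed.

(** * Orthogonality of Legendre polynomials on a cell *)

Section cell_polynomials.
Context {R : realType}.
Local Notation mu := (@lebesgue_measure R).
Variables c1 c2 : R.
Hypothesis c12 : c1 < c2.
Local Notation cell := (`[c1, c2]%classic).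
Local Notation cint f := (\int[mu]_(y in `[c1, c2]) f y).

Lemma sqint_horner (p : {poly R}) : sqint mu cell (horner p).
Proof.
have cp : continuous (horner p : R -> R) by exact: continuous_horner.
split; first exact: measurable_funTS (continuous_measurable_fun cp).
apply: continuous_compact_integrable; first exact: segment_compact.
apply: continuous_subspaceT => y; rewrite (_ : (fun z => _) = horner (p ^+ 2)); last first.
  by apply/funext => z; rewrite horner_exp.
exact: continuous_horner.
Qed.

Lemma integral_deriv_poly (p : {poly R}) : cint (horner p^`()) = p.[c2] - p.[c1].
Proof.
rewrite /Rintegral (@continuous_FTC2 _ _ (horner p))//.
- by apply: continuous_subspaceT => y; exact: continuous_horner.
- split => //=.
  + by apply: cvg_at_right_filter; exact: continuous_horner.
  + by apply: cvg_at_left_filter; exact: continuous_horner.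
- by move=> y _; rewrite derivE.
Qed.

Lemma inner_horner (p q : {poly R}) :
  inner mu cell (horner p) (horner q) = cint (horner (p * q)).
Proof. by apply: eq_Rintegral => y _; rewrite hornerM. Qed.

Lemma inner_deriv (p q : {poly R}) :
  inner mu cell (horner p^`()) (horner q) + inner mu cell (horner p) (horner q^`())
  = p.[c2] * q.[c2] - p.[c1] * q.[c1].
Proof.
rewrite -!hornerM -integral_deriv_poly derivM !inner_horner -RintegralD//.
- by apply: eq_Rintegral => y _; rewrite hornerD.
- by apply: continuous_compact_integrable; [exact: segment_compact|
    apply: continuous_subspaceT => y; exact: continuous_horner].
- by apply: continuous_compact_integrable; [exact: segment_compact|
    apply: continuous_subspaceT => y; exact: continuous_horner].
Qed.

Lemma derivn_exp_root (z : R) n i (r : {poly R}) : (i < n)%N ->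
  ((('X - z%:P) ^+ n * r)^`(i)).[z] = 0.
Proof.
elim: i n r => [|i IH] [|n] r // ni.
  by rewrite derivn0 exprS !hornerE subrr !mul0r.
rewrite derivSn derivM deriv_exp derivXsubC mul1r /= exprS.
rewrite (_ : _ + _ = ('X - z%:P) ^+ n * (r *+ n.+1 + ('X - z%:P) * r^`())); last by ring.
exact: IH.
Qed.

Definition rodrigues n : {poly R} := ('X - c1%:P) ^+ n * ('X - c2%:P) ^+ n.

(** Repeated integration by parts moves the derivatives onto [q], which they
    annihilate; the boundary terms vanish because the end points are roots of
    order [n] of [rodrigues n]. *)
Lemma rodrigues_orthogonal n i (q : {poly R}) : (i <= n)%N -> (size q <= i)%N ->
  inner mu cell (horner (rodrigues n)^`(i)) (horner q) = 0.
Proof.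
elim: i q => [|i IH] q ni qi.
  have -> : q = 0 by apply/eqP; rewrite -size_poly_leq0.
  by rewrite innerC (_ : horner 0 = fun=> 0) ?inner0l//; apply/funext => y; rewrite horner0.
have sq : (size q^`() <= i)%N.
  apply/leq_sizeP => l il; rewrite coef_deriv nth_default ?mul0rn//.
  exact: leq_trans qi _.
have := inner_deriv (rodrigues n)^`(i) q.
rewrite -derivnS (IH _ (ltnW ni) sq) addr0 => ->.
have -> : (rodrigues n)^`(i).[c1] = 0 by rewrite /rodrigues derivn_exp_root.
have -> : (rodrigues n)^`(i).[c2] = 0 by rewrite /rodrigues mulrC derivn_exp_root.
by rewrite !mul0r subrr.
Qed.

Lemma rodrigues_monic n : rodrigues n \is monic.
Proof. by rewrite /rodrigues rpredM// monic_exp// monicXsubC. Qed.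

Lemma size_rodrigues n : size (rodrigues n) = (n + n).+1.
Proof.
rewrite /rodrigues size_Mmonic ?monic_exp ?monicXsubC// ?monic_neq0 ?monic_exp ?monicXsubC//.
by rewrite !size_exp_XsubC addSn addnS.
Qed.

Lemma size_derivn_rodrigues n : (size (rodrigues n)^`(n) <= n.+1)%N.
Proof.
apply/leq_sizeP => i ni; rewrite coef_derivn nth_default ?mul0rn//.
by rewrite size_rodrigues -addnS leq_add2l.
Qed.

Lemma coef_derivn_rodrigues n : (rodrigues n)^`(n)`_n != 0.
Proof.
rewrite coef_derivn mulrn_eq0 negb_or -lt0n ffact_gt0 leq_addr/=.
have := monic_neq0 (rodrigues_monic n); rewrite -lead_coef_eq0 /lead_coef.
by rewrite size_rodrigues.
Qed.
End cell_polynomials.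

Section legendre_cells.
Context {R : realType}.
Local Notation mu := (@lebesgue_measure R).
Variables (x : nat -> R) (j : nat).
Hypothesis xj : x j < x j.+1.
Local Notation cell := (`[x j, x j.+1]%classic).
Local Notation h := (cell_size x j).

Lemma comp_affine_derivn (p : {poly R}) s m l :
  (p \Po (s *: ('X - m%:P)))^`(l) = s ^+ l *: (p^`(l) \Po (s *: ('X - m%:P))).
Proof.
elim: l => [|l IH]; first by rewrite expr0 scale1r !derivn0.
rewrite !derivnS IH derivZ deriv_comp derivZ derivXsubC.
by rewrite exprSr -scalerA -[s *: 1]mul_polyC mulr1 mulrC mul_polyC.
Qed.

Definition legendre_factor l := (2 ^+ l * l`!%:R)^-1 * (2 / h) ^+ l.

Lemma cell_size_gt0 : 0 < h.
Proof. by rewrite subr_gt0. Qed.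

Lemma legendre_factor_neq0 l : legendre_factor l != 0.
Proof.
have h0 := cell_size_gt0.
rewrite mulf_neq0 ?invr_neq0 ?expf_neq0 ?mulf_neq0 ?expf_neq0 ?pnatr_eq0 -?lt0n ?fact_gt0//.
by rewrite invr_neq0// gt_eqF.
Qed.

(** The affine map of the cell onto [-1, 1] turns [X^2 - 1] into
    [(2 / h)^2 (X - x_j) (X - x_(j+1))], and each derivative brings a factor
    [2 / h]. *)
Lemma legendre_cellE l :
  legendre_cell x j l = legendre_factor l *: (rodrigues (x j) (x j.+1) l)^`(l).
Proof.
have h0 := cell_size_gt0; have hn : h != 0 by rewrite gt_eqF.
set s := 2 / h; set m := (x j + x j.+1) / 2.
have s0 : s != 0 by rewrite gt_eqF// divr_gt0.
rewrite /legendre_cell /legendre -/s -/m comp_polyZ.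
have -> : rodrigues (x j) (x j.+1) l
    = (s ^+ l) ^- 2 *: ((('X ^+ 2 - 1) ^+ l) \Po (s *: ('X - m%:P))).
  have -> : (('X ^+ 2 - 1) ^+ l) \Po (s *: ('X - m%:P))
      = ((s ^+ 2) *: (('X - (x j)%:P) * ('X - (x j.+1)%:P))) ^+ l.
    rewrite rmorphXn/= rmorphB rmorphXn/= comp_polyX rmorph1; congr (_ ^+ _).
    have -> : 'X - (x j)%:P = s^-1 *: (s *: ('X - m%:P) + 1).
      rewrite scalerDr scalerA mulVf// scale1r -addrA; congr (_ + _).
      rewrite -mul_polyC mulr1 -polyCN -polyCN -polyCD; congr polyC.
      by rewrite /m /s /cell_size; field; rewrite subr_eq0 gt_eqF.
    have -> : 'X - (x j.+1)%:P = s^-1 *: (s *: ('X - m%:P) - 1).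
      rewrite scalerDr scalerA mulVf// scale1r -addrA; congr (_ + _).
      rewrite scalerN -mul_polyC mulr1 -!polyCN -polyCD; congr polyC.
      by rewrite /m /s /cell_size; field; rewrite subr_eq0 gt_eqF.
    rewrite -scalerAl -scalerAr !scalerA (_ : s ^+ 2 * s^-1 * s^-1 = 1) ?scale1r; last by field.
    by ring.
  have Z (c : R) (Y : {poly R}) : (c *: Y) ^+ l = c ^+ l *: Y ^+ l by rewrite exprZn.
  rewrite Z -!mul_polyC mulrA -polyCM exprAC mulVf; last by rewrite expf_neq0 ?expf_neq0.
  by rewrite mul1r exprMn.
rewrite derivnZ comp_affine_derivn !scalerA; congr (_ *: _).
rewrite /legendre_factor -/s; field.
by rewrite expf_neq0//= ?mulf_neq0 ?expf_neq0 ?pnatr_eq0 -?lt0n ?fact_gt0.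
Qed.

Lemma size_legendre_cell l : (size (legendre_cell x j l) <= l.+1)%N.
Proof.
rewrite legendre_cellE; apply: leq_trans (size_scale_leq _ _) _.
exact: size_derivn_rodrigues.
Qed.

Lemma coef_legendre_cell l : (legendre_cell x j l)`_l != 0.
Proof.
by rewrite legendre_cellE coefZ mulf_neq0 ?legendre_factor_neq0 ?coef_derivn_rodrigues.
Qed.

Lemma legendre_cell_orthogonal l (q : {poly R}) : (size q <= l)%N ->
  cell_dot x j (horner (legendre_cell x j l)) (horner q) = 0.
Proof.
move=> ql; rewrite -[LHS]/(inner mu cell _ _).
rewrite (_ : horner (legendre_cell x j l) = (fun y => legendre_factor l *
  (rodrigues (x j) (x j.+1) l)^`(l).[y])); last first.
  by apply/funext => y; rewrite legendre_cellE hornerZ.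
rewrite innerZl//; [|exact: sqint_horner|exact: sqint_horner].
by rewrite (rodrigues_orthogonal xj (leqnn l) ql) mulr0.
Qed.

(** The degrees are exactly 0, 1, 2 and so on, whence triangularity. *)
Lemma legendre_cell_span n (q : {poly R}) : (size q <= n)%N ->
  exists a : nat -> R, q = \sum_(l < n) a l *: legendre_cell x j l.
Proof.
elim: n q => [|n IH] q qn.
  exists (fun=> 0); rewrite big_ord0; apply/eqP; by rewrite -size_poly_leq0.
pose c := q`_n / (legendre_cell x j n)`_n.
have [|a qa] := IH (q - c *: legendre_cell x j n).
  apply/leq_sizeP => i; rewrite leq_eqVlt => /predU1P[<-|ni].
    by rewrite coefB coefZ divfK ?coef_legendre_cell// subrr.
  rewrite coefB coefZ !nth_default ?mulr0 ?subrr//; last exact: leq_trans qn _.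
  exact: leq_trans (size_legendre_cell _) ni.
exists (fun l => if (l < n)%N then a l else c).
rewrite big_ord_recr/= ltnn -[LHS](subrK (c *: legendre_cell x j n)) qa; congr (_ + _).
by apply: eq_bigr => l _; rewrite ltn_ord.
Qed.

Lemma negligible_roots (p : {poly R}) : p != 0 -> mu.-negligible [set y | p.[y] = 0].
Proof.
have [n] := ubnP (size p); elim: n p => // n IH p /ltnSE pn p0.
have [[z pz]|noroot] := pselect (exists z, root p z); last first.
  apply: negligibleS (negligible_set0 _) => y /= py.
  by apply: noroot; exists y; apply/rootP.
have /factor_theorem[q pq] := pz.
have q0 : q != 0 by apply: contra_neq p0 => q0; rewrite pq q0 mul0r.
have nq : mu.-negligible [set y | q.[y] = 0].
  apply: IH => //; apply: leq_trans pn.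
  by rewrite pq size_Mmonic ?monicXsubC// size_XsubC addn2.
have nz : mu.-negligible [set z].
  by apply/negligibleP => //; exact: lebesgue_measure_set1.
apply: negligibleS (negligibleU nz nq) => y /=; rewrite pq !hornerE => /eqP.
by rewrite mulf_eq0 subr_eq0 => /orP[/eqP|/eqP]; [right|left].
Qed.

(** A nonzero polynomial vanishes on a negligible set only, and the cell is not
    negligible. *)
Lemma cell_dot_gt0 (p : {poly R}) : p != 0 -> 0 < cell_dot x j (horner p) (horner p).
Proof.
move=> p0; rewrite lt_neqAle (_ : 0 <= _) ?andbT; last exact: (@inner_ge0 _ _ _ mu cell).
apply/eqP => /esym h.
have sp := @sqint_horner _ (x j) (x j.+1) p.
have := @inner_sqrE _ (measurableTypeR R) R mu _ (measurable_itv _) _ sp.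
rewrite -[inner _ _ _ _]/(cell_dot x j (horner p) (horner p)) h.
under eq_integral do rewrite -(ger0_norm (sqr_ge0 _)).
move=> /esym h0.
have : ae_eq mu cell (fun y => (p.[y] ^+ 2)%:E) (cst 0%E).
  apply/ae_eq_integral_abs => //; apply/measurable_EFinP; apply: measurable_funX.
  exact: sp.1.
move=> ae0.
have : mu.-negligible cell.
  apply: negligibleS (negligibleU (negligible_roots p0) ae0) => y xy.
  have [py|py] := eqVneq p.[y] 0; [by left|right] => /= /(_ xy) [] /eqP.
  by rewrite sqrf_eq0 (negbTE py).
move=> nc; have : mu cell = 0%E by apply/negligibleP.
rewrite lebesgue_measure_itv/= lte_fin xj => -[] /eqP.
by rewrite subr_eq0 gt_eqF.
Qed.

End legendre_cells.

(** * Orthonormal coordinates in the discontinuous Galerkin space *)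

Section orthonormal_coordinates.
Context {R : realType}.
Local Notation mu := (@lebesgue_measure R).
Variables (k : nat) (x : nat -> R) (j : nat).
Hypothesis xj : x j < x j.+1.
Local Notation cell := (`[x j, x j.+1]%classic).
Local Notation mcell := (measurable_itv `[x j, x j.+1] : measurable (cell : set (measurableTypeR R))).

Definition unit_legendre l : {poly R} := Num.sqrt (legendre_weight x j l) *: legendre_cell x j l.

Lemma legendre_cell_neq0 l : legendre_cell x j l != 0.
Proof. by have := coef_legendre_cell xj l; apply: contra_neq => ->; rewrite coef0. Qed.

Lemma legendre_weight_gt0 l : 0 < legendre_weight x j l.
Proof. by rewrite invr_gt0 cell_dot_gt0 ?legendre_cell_neq0. Qed.

Lemma size_unit_legendre l : (size (unit_legendre l) <= l.+1)%N.
Proof. exact: leq_trans (size_scale_leq _ _) (size_legendre_cell xj l). Qed.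

Lemma cell_dotC (f g : R -> R) : cell_dot x j f g = cell_dot x j g f.
Proof. exact: innerC. Qed.

Lemma cell_dotZl c (p : {poly R}) f : sqint mu cell f ->
  cell_dot x j (horner (c *: p)) f = c * cell_dot x j (horner p) f.
Proof.
move=> sf; rewrite (_ : horner (c *: p) = (fun y => c * p.[y])); last first.
  by apply/funext => y; rewrite hornerZ.
apply: (@innerZl _ (measurableTypeR R) R mu _ mcell) => //; exact: sqint_horner.
Qed.

Lemma cell_dot_suml (I : Type) (s : seq I) (p : I -> {poly R}) f : sqint mu cell f ->
  cell_dot x j (horner (\sum_(i <- s) p i)) f = \sum_(i <- s) cell_dot x j (horner (p i)) f.
Proof.
move=> sf; rewrite (_ : horner _ = (fun y => \sum_(i <- s) (p i).[y])); last first.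
  by apply/funext => y; rewrite horner_sum.
apply: (@inner_suml _ (measurableTypeR R) R mu _ mcell) => // i; exact: sqint_horner.
Qed.

Lemma unit_legendre_orthonormal l l' :
  cell_dot x j (horner (unit_legendre l)) (horner (unit_legendre l')) = (l == l')%:R.
Proof.
have s p := @sqint_horner _ (x j) (x j.+1) p.
rewrite cell_dotZl// cell_dotC cell_dotZl// mulrA.
have [<-|ll'] := eqVneq l l'.
  rewrite -expr2 sqr_sqrtr ?ltW ?legendre_weight_gt0// mulVf// gt_eqF//.
  by rewrite cell_dot_gt0 ?legendre_cell_neq0.
suff -> : cell_dot x j (horner (legendre_cell x j l')) (horner (legendre_cell x j l)) = 0.
  by rewrite mulr0.
have [lt|gt|eq] := ltngtP l l'.
- by rewrite legendre_cell_orthogonal// (leq_trans (size_legendre_cell xj _)).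
- by rewrite cell_dotC legendre_cell_orthogonal// (leq_trans (size_legendre_cell xj _)).
- by rewrite eq eqxx in ll'.
Qed.

Lemma unit_legendre_expansion (q : {poly R}) : (size q <= k.+1)%N ->
  q = \sum_(l < k.+1) cell_dot x j (horner q) (horner (unit_legendre l)) *: unit_legendre l.
Proof.
move=> /(legendre_cell_span xj)[a qa].
have [b qb] : exists b : nat -> R, q = \sum_(l < k.+1) b l *: unit_legendre l.
  exists (fun l => a l / Num.sqrt (legendre_weight x j l)); rewrite qa.
  apply: eq_bigr => l _; rewrite scalerA divfK// gt_eqF// sqrtr_gt0.
  exact: legendre_weight_gt0.
have s p := @sqint_horner _ (x j) (x j.+1) p.
rewrite {1}qb; apply: eq_bigr => l _; congr (_ *: _).
rewrite qb cell_dot_suml//.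
transitivity (\sum_(i < k.+1) b i * (i == l)%:R); last first.
  by apply: eq_bigr => i _; rewrite cell_dotZl// unit_legendre_orthonormal.
by rewrite (bigD1 l)//= big1 => [|i /negbTE ->]; rewrite ?mulr0// eqxx mulr1 addr0.
Qed.

Lemma cell_dot_expansion (q : {poly R}) f : (size q <= k.+1)%N -> sqint mu cell f ->
  cell_dot x j (horner q) f = \sum_(l < k.+1)
    cell_dot x j (horner q) (horner (unit_legendre l))
    * cell_dot x j (horner (unit_legendre l)) f.
Proof.
move=> qk sf; rewrite {1}(unit_legendre_expansion qk) cell_dot_suml//.
by apply: eq_bigr => l _; rewrite cell_dotZl.
Qed.

End orthonormal_coordinates.

Section dg_space.
Context {R : realType}.
Local Notation mu := (@lebesgue_measure R).
Variables (a b : R) (N : nat) (x : nat -> R).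
Hypothesis xmesh : mesh a b N x.
Local Notation cell j := (`[x j, x j.+1]%classic).
Local Notation mitv D := (measurable_itv D : measurable ([set` D] : set (measurableTypeR R))).

Lemma mesh_lt (j : 'I_N) : x j < x j.+1.
Proof. by have [_ _] := xmesh; apply. Qed.

Lemma mesh_le i j : (i <= j <= N)%N -> x i <= x j.
Proof.
move=> /andP[ij jN]; elim: j ij jN => [|j IH]; first by rewrite leqn0 => /eqP ->.
rewrite leq_eqVlt => /predU1P[->//|ij] jN.
by apply: le_trans (IH ij (ltnW jN)) _; have [_ _ h] := xmesh; exact/ltW/h.
Qed.

Lemma mesh_cell_sub (j : 'I_N) y : x j <= y <= x j.+1 -> a <= y <= b.
Proof.
move=> /andP[jy yj]; have [x0 xN _] := xmesh.
rewrite -{1}x0 -xN (le_trans _ jy) ?(le_trans yj) ?mesh_le//= ?leq0n ?ltn_ord ?leqnn//.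
by rewrite ltnW.
Qed.

Lemma cell_subset (j : 'I_N) : cell j `<=` `[a, b].
Proof. by move=> y /=; rewrite !in_itv/=; exact: mesh_cell_sub. Qed.

Lemma sqint_cell (j : 'I_N) f : sqint mu `[a, b] f -> sqint mu (cell j) f.
Proof.
move=> [mf if2]; split; first by apply: measurable_funS mf => //; exact: cell_subset.
by apply: integrableS if2 => //; exact: cell_subset.
Qed.

Lemma sqint_indic_poly (D : interval R) (p : {poly R}) :
  sqint mu `[a, b] (fun y => \1_([set` D]) y * p.[y]).
Proof.
have [mp ip] := @sqint_horner _ a b p; have mD := mitv D.
have m1 : measurable_fun `[a, b] (fun y => \1_([set` D]) y * p.[y] : R).
  by apply: measurable_funM => //; exact: measurable_indic.
split => //; apply: le_integrable ip => //.
  by apply/measurable_EFinP; exact: measurable_funX.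
move=> y _; rewrite lee_fin ger0_norm ?sqr_ge0// ger0_norm ?sqr_ge0//.
by rewrite exprMn indicE; case: (_ \in _); rewrite ?expr1n ?mul1r// expr0n mul0r sqr_ge0.
Qed.

Lemma integral_indic_poly (D : interval R) (p : {poly R}) f :
  [set` D] `<=` `[a, b] ->
  dotL2 a b (fun y => \1_([set` D]) y * p.[y]) f
  = \int[mu]_(y in [set` D]) (p.[y] * f y).
Proof.
move=> Dab; rewrite -{2}(setIidr Dab) Rintegral_mkcondr; apply: eq_Rintegral => y _.
by rewrite patchE indicE; case: (_ \in _); rewrite ?mul1r// !mul0r.
Qed.

Lemma cell_dot_open (j : 'I_N) f g : sqint mu (cell j) f -> sqint mu (cell j) g ->
  cell_dot x j f g = \int[mu]_(y in `]x j, x j.+1[) (f y * g y).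
Proof.
move=> sf sg; have i1 := @sqint_mul _ (measurableTypeR R) R mu _ (mitv _) _ _ sf sg.
have i2 : mu.-integrable `[x j, x j.+1[ (EFin \o (fun y => f y * g y)).
  by apply: integrableS i1 => // y /=; rewrite !in_itv/= => /andP[-> /ltW].
have i3 : mu.-integrable `]x j, x j.+1[ (EFin \o (fun y => f y * g y)).
  by apply: integrableS i2 => // y /=; rewrite !in_itv/= => /andP[/ltW -> ->].
by rewrite /cell_dot -Rintegral_itv_bndo_bndc// -Rintegral_itv_obnd_cbnd.
Qed.

Lemma cell_dot_eq_open (j : 'I_N) f f' g : sqint mu (cell j) f -> sqint mu (cell j) f' ->
  sqint mu (cell j) g -> (forall y, x j < y < x j.+1 -> f y = f' y) ->
  cell_dot x j f g = cell_dot x j f' g.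
Proof.
move=> sf sf' sg ff'; rewrite !cell_dot_open//; apply: eq_Rintegral => y.
by rewrite inE/= in_itv/= => /ff' ->.
Qed.

Lemma dotL2_closed_cell (j : 'I_N) (p : {poly R}) f :
  dotL2 a b (fun y => \1_(cell j) y * p.[y]) f = cell_dot x j (horner p) f.
Proof. exact: integral_indic_poly (@cell_subset j). Qed.

Lemma sqint_Vh_fun (v : 'I_N -> {poly R}) : sqint mu `[a, b] (Vh_fun x v).
Proof.
apply: (@sqint_sum _ (measurableTypeR R) R mu _ (mitv _)) => j.
exact: sqint_indic_poly.
Qed.

Lemma dotL2_Vh_fun (v : 'I_N -> {poly R}) f : sqint mu `[a, b] f ->
  dotL2 a b (Vh_fun x v) f = \sum_(j < N) cell_dot x j (horner (v j)) f.
Proof.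
move=> sf; rewrite -[LHS]/(inner mu `[a, b] (Vh_fun x v) f).
rewrite (@inner_suml _ (measurableTypeR R) R mu _ (mitv _))//; last first.
  by move=> j; exact: sqint_indic_poly.
apply: eq_bigr => j _; rewrite cell_dot_open; [|exact: sqint_horner|exact: sqint_cell].
apply: integral_indic_poly => y; rewrite /= !in_itv/= => /andP[/ltW jy /ltW yj].
by apply: (@mesh_cell_sub j); rewrite jy.
Qed.

Lemma Vh_fun_cell (v : 'I_N -> {poly R}) (j : 'I_N) y : x j < y < x j.+1 ->
  Vh_fun x v y = (v j).[y].
Proof.
move=> yj; rewrite /Vh_fun (bigD1 j)//= big1 => [|i ij].
  by rewrite indicE mem_set/= ?in_itv// mul1r addr0.
rewrite indicE memNset ?mul0r//= in_itv/= => /andP[iy yi].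
have [ji|ji|/val_inj ji] := ltngtP i j; last by rewrite ji eqxx in ij.
  by have := mesh_le (i := i.+1) (j := j); rewrite ji ltnW// => /(_ isT); move: yj; lra.
by have := mesh_le (i := j.+1) (j := i); rewrite ji ltnW// => /(_ isT); move: yj; lra.
Qed.

Variable k : nat.

Lemma Vh_sqnorm_coordinates (v : 'I_N -> {poly R}) : in_Vh k v ->
  Vh_sqnorm a b x v = \sum_(j < N) \sum_(l < k.+1)
    cell_dot x j (horner (v j)) (horner (unit_legendre x j l)) ^+ 2.
Proof.
move=> vk; rewrite /Vh_sqnorm dotL2_Vh_fun; last exact: sqint_Vh_fun.
apply: eq_bigr => j _.
have s p := @sqint_horner _ (x j) (x j.+1) p.
rewrite cell_dotC (@cell_dot_eq_open j _ (horner (v j)))//; last 2 first.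
- by apply: sqint_cell; exact: sqint_Vh_fun.
- by move=> y; exact: Vh_fun_cell.
rewrite (cell_dot_expansion (mesh_lt j) (vk j))//.
by apply: eq_bigr => l _; rewrite expr2 [X in _ * X]cell_dotC.
Qed.

Lemma dg_drift_local alpha (v phi phi' : 'I_N -> {poly R}) j : phi j = phi' j ->
  dg_drift alpha x v phi j = dg_drift alpha x v phi' j.
Proof. by move=> e; rewrite /dg_drift /trace_m /trace_p ord_predK e. Qed.

Lemma dg_drift_suml alpha (I : finType) (c : I -> R) (v : I -> 'I_N -> {poly R}) phi j :
  dg_drift alpha x (fun i => \sum_s c s *: v s i) phi j
  = \sum_s c s * dg_drift alpha x (v s) phi j.
Proof.
have fl i : flux alpha x (fun i => \sum_s c s *: v s i) i = \sum_s c s * flux alpha x (v s) i.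
  rewrite /flux /avg /jump /trace_p /trace_m !horner_sum.
  rewrite -sumrB -big_split/= mulr_suml mulr_sumr -big_split/=.
  by apply: eq_bigr => s _; rewrite !hornerZ; ring.
rewrite /dg_drift !fl cell_dot_suml; last exact: sqint_horner.
rewrite !mulr_suml -sumrB -big_split/=; apply: eq_bigr => s _.
by rewrite cell_dotZl; [ring|exact: sqint_horner].
Qed.

Lemma dg_drift_sumr alpha (I : finType) (c : I -> R) (phi : I -> 'I_N -> {poly R}) v j :
  dg_drift alpha x v (fun i => \sum_s c s *: phi s i) j
  = \sum_s c s * dg_drift alpha x v (phi s) j.
Proof.
have D : (\sum_s c s *: phi s j)^`() = \sum_s c s *: (phi s j)^`().
  by elim/big_rec2: _ => [|s p q _ IH]; rewrite ?deriv0// derivD derivZ IH.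
rewrite /dg_drift /trace_p /trace_m !horner_sum D.
rewrite cell_dotC cell_dot_suml; last exact: sqint_horner.
rewrite !mulr_sumr -sumrB -big_split/=; apply: eq_bigr => s _.
by rewrite cell_dotZl ?hornerZ; [rewrite cell_dotC; ring|exact: sqint_horner].
Qed.

(** The alternating fluxes make the coupled drift skew-symmetric: integration by
    parts leaves the jumps of the products [u eta] at the interfaces, and
    [eta^+ u^+ - eta^- u^- = {eta} [u] + {u} [eta]]; the penalty terms in [alpha]
    cancel because their signs are opposite. *)
Lemma dg_drift_skew alpha (u eta : 'I_N -> {poly R}) :
  \sum_(j < N) (dg_drift (- alpha) x eta u j + dg_drift alpha x u eta j) = 0.
Proof.
have parts (j : 'I_N) : cell_dot x j (horner (eta j)) (horner (u j)^`())
    + cell_dot x j (horner (u j)) (horner (eta j)^`())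
    = trace_m x eta j * trace_m x u j
      - trace_p x eta (ord_pred j) * trace_p x u (ord_pred j).
  rewrite /trace_m /trace_p ord_predK -(inner_deriv (mesh_lt j)) [RHS]addrC.
  by congr (_ + _); rewrite cell_dotC.
have reindex_pred (F : 'I_N -> R) : \sum_(j < N) F (ord_pred j) = \sum_(j < N) F j.
  by rewrite [RHS](reindex_inj (@ord_pred_inj N)).
pose G j := flux (- alpha) x eta j * trace_p x u j + flux alpha x u j * trace_p x eta j
  - trace_p x eta j * trace_p x u j.
have -> : \sum_(j < N) (dg_drift (- alpha) x eta u j + dg_drift alpha x u eta j)
    = \sum_(j < N) (trace_m x eta j * trace_m x u j
        - flux (- alpha) x eta j * trace_m x u j - flux alpha x u j * trace_m x eta j)
      + \sum_(j < N) G (ord_pred j).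
  rewrite -big_split/=; apply: eq_bigr => j _.
  have := parts j; rewrite /dg_drift /G; lra.
rewrite reindex_pred -big_split/= big1// => j _.
by rewrite /G /flux /avg /jump; field.
Qed.

End dg_space.

(** * Projection on the discontinuous Galerkin space *)

Lemma sum_pairE {V : nmodType} (I J : finType) (F : I * J -> V) :
  \sum_s F s = \sum_i \sum_j F (i, j).
Proof. by rewrite pair_bigA; apply: eq_bigr => -[]. Qed.

Section noise_coefficients.
Context {R : realType}.
Local Notation mu := (@lebesgue_measure R).
Variables (a b : R) (N : nat) (x : nat -> R) (k : nat).
Hypothesis xmesh : mesh a b N x.
Local Notation mitv D := (measurable_itv D : measurable ([set` D] : set (measurableTypeR R))).
Local Notation cell j := (`[x j, x j.+1]%classic).
Local Notation nI := ('I_N * 'I_k.+1)%type.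

Definition coordinate (f : R -> R) (s : nI) : R :=
  cell_dot x s.1 (horner (unit_legendre x s.1 s.2)) f.

(** Written with all the pairs of indices, as a combination of fixed families, so
    that the linearity of the drift applies to it. *)
Definition synthesis (y : nI -> R) (j : 'I_N) : {poly R} :=
  \sum_(s : nI) y s *: (if s.1 == j then unit_legendre x j s.2 else 0).

Lemma synthesisE y j : synthesis y j = \sum_(l < k.+1) y (j, l) *: unit_legendre x j l.
Proof.
rewrite /synthesis sum_pairE/=.
rewrite (bigD1 j)//= [X in _ + X]big1 ?addr0 => [|i /negbTE ij].
  by apply: eq_bigr => l _; rewrite eqxx.
by rewrite big1// => l _; rewrite ij scaler0.
Qed.

Lemma synthesis_Vh y : in_Vh k (synthesis y).
Proof.
move=> j; rewrite synthesisE; apply: (leq_trans (size_sum _ _ _)); apply/bigmax_leqP => l _.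
apply: leq_trans (size_scale_leq _ _) _.
exact: leq_trans (size_unit_legendre (mesh_lt xmesh j) _) (ltn_ord l).
Qed.

Lemma cell_dot_synthesis y (s : nI) :
  cell_dot x s.1 (horner (synthesis y s.1)) (horner (unit_legendre x s.1 s.2)) = y s.
Proof.
have sh p := @sqint_horner _ (x s.1) (x s.1.+1) p.
case: s sh => j l /= sh; rewrite synthesisE cell_dot_suml//.
transitivity (\sum_(i < k.+1) y (j, i) * (i == l)%:R).
  apply: eq_bigr => i _; rewrite cell_dotZl// unit_legendre_orthonormal//.
  exact: (mesh_lt xmesh).
by rewrite (bigD1 l)//= big1 => [|i /negbTE ->]; rewrite ?mulr0// eqxx mulr1 addr0.
Qed.

Lemma Vh_expansion (v : 'I_N -> {poly R}) : in_Vh k v ->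
  v = synthesis (fun s => cell_dot x s.1 (horner (v s.1)) (horner (unit_legendre x s.1 s.2))).
Proof.
move=> vk; apply/funext => j; rewrite synthesisE.
exact: unit_legendre_expansion (mesh_lt xmesh j) _ (vk j).
Qed.

Lemma dotL2_synthesis y f : sqint mu `[a, b] f ->
  dotL2 a b (Vh_fun x (synthesis y)) f = \sum_(s : nI) y s * coordinate f s.
Proof.
move=> sf; rewrite (dotL2_Vh_fun xmesh)//.
rewrite sum_pairE/=.
apply: eq_bigr => j _; rewrite synthesisE cell_dot_suml; last exact: (sqint_cell xmesh).
by apply: eq_bigr => l _; rewrite cell_dotZl//; exact: (sqint_cell xmesh).
Qed.

Lemma Vh_sqnorm_synthesis y : Vh_sqnorm a b x (synthesis y) = \sum_(s : nI) y s ^+ 2.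
Proof.
rewrite (Vh_sqnorm_coordinates xmesh (synthesis_Vh y)).
rewrite pair_bigA/=; apply: eq_bigr => -[j l] _ /=.
by rewrite (cell_dot_synthesis y (j, l)).
Qed.

(** Pythagoras: the square distance to [V_h^k] is minimal for the coordinates of
    [f], with value the square norm of [f] minus that of its projection. *)
Lemma distance_synthesis y f : sqint mu `[a, b] f ->
  \int[mu]_(z in `[a, b]) (f z - Vh_fun x (synthesis y) z) ^+ 2
  = dotL2 a b f f - \sum_(s : nI) coordinate f s ^+ 2
    + \sum_(s : nI) (coordinate f s - y s) ^+ 2.
Proof.
move=> sf; set v := synthesis y.
have sv := sqint_Vh_fun a b x v.
have sB := @sqintB _ (measurableTypeR R) R mu _ (mitv _) _ _ sf sv.
have sNv := @sqintZ _ (measurableTypeR R) R mu _ (mitv _) (-1) _ sv.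
pose g z := f z - Vh_fun x v z.
have DB h : sqint mu `[a, b] h -> dotL2 a b g h = dotL2 a b f h - dotL2 a b (Vh_fun x v) h.
  move=> sh.
  have -> : g = (fun z => f z + -1 * Vh_fun x v z).
    by apply/funext => z; rewrite mulN1r.
  rewrite -[LHS]/(inner mu `[a, b] _ _).
  rewrite (@innerDl _ (measurableTypeR R) R mu _ (mitv _))//.
  by rewrite (@innerZl _ (measurableTypeR R) R mu _ (mitv _))// mulN1r.
have dC h h' : dotL2 a b h h' = dotL2 a b h' h by exact: innerC.
have -> : \int[mu]_(z in `[a, b]) (f z - Vh_fun x v z) ^+ 2 = dotL2 a b g g.
  by apply: eq_Rintegral => z _; rewrite expr2.
rewrite (DB g sB) (dC f g) (dC _ g) (DB f sf) (DB _ sv) (dC f).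
rewrite -[dotL2 a b (Vh_fun x v) (Vh_fun x v)]/(Vh_sqnorm a b x v).
rewrite /v Vh_sqnorm_synthesis dotL2_synthesis//.
have -> : \sum_(s : nI) (coordinate f s - y s) ^+ 2 = \sum_(s : nI) coordinate f s ^+ 2
   - 2 * \sum_(s : nI) y s * coordinate f s + \sum_(s : nI) y s ^+ 2.
  by rewrite mulr_sumr -sumrB -big_split/=; apply: eq_bigr => s _; ring.
by ring.
Qed.

Lemma bessel f : sqint mu `[a, b] f ->
  \sum_(s : nI) coordinate f s ^+ 2 <= dotL2 a b f f.
Proof.
move=> sf; rewrite -subr_ge0.
have := distance_synthesis (coordinate f) sf.
rewrite [X in _ + X]big1 ?addr0 => [<-|s _]; last by rewrite subrr expr0n.
by rewrite /Rintegral fine_ge0// integral_ge0// => z _; rewrite lee_fin sqr_ge0.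
Qed.

Lemma best_approximation (v : 'I_N -> {poly R}) f : in_Vh k v -> sqint mu `[a, b] f ->
  dotL2 a b f f - \sum_(s : nI) coordinate f s ^+ 2
  <= \int[mu]_(z in `[a, b]) (f z - Vh_fun x v z) ^+ 2.
Proof.
move=> vk sf; rewrite (Vh_expansion vk) distance_synthesis// lerDl.
by apply: sumr_ge0 => s _; exact: sqr_ge0.
Qed.

Variables (e : nat -> R -> R) (gamma : nat -> R) (Q : (R -> R) -> (R -> R)).
Hypothesis he : orthonormal_basis a b e.
Hypothesis hQ : covariance_operator a b e gamma Q.

Lemma sqint_basis m : sqint mu `[a, b] (e m).
Proof. by have [h _ _] := he; exact: h. Qed.

Lemma basis_norm m : dotL2 a b (e m) (e m) = 1.
Proof. by have [_ -> _] := he; rewrite eqxx. Qed.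

(** This gives both the sign of the eigenvalues and the trace of [Q]. *)
Lemma dot_covariance m : dotL2 a b (Q (e m)) (e m) = gamma m.
Proof.
have [mq _] := cov_L2 hQ (sqint_basis m); have [me _] := sqint_basis m.
transitivity (dotL2 a b (fun z => gamma m * e m z) (e m)).
  rewrite /dotL2 /Rintegral; congr fine; apply: ae_eq_integral => //.
  - by apply/measurable_EFinP; exact: measurable_funM.
  - by apply/measurable_EFinP; apply: measurable_funM => //; exact: measurable_funM.
  - have [A [mA A0 sA]] := cov_eigen hQ m; exists A; split => // z hz.
    by apply: sA => h; apply: hz => zab /=; rewrite h.
rewrite -[LHS]/(inner mu `[a, b] _ _).
rewrite (@innerZl _ (measurableTypeR R) R mu _ (mitv _)) ?sqint_basis//; try exact: sqint_basis.
by rewrite -[inner _ _ _ _]/(dotL2 a b (e m) (e m)) basis_norm mulr1.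
Qed.

Lemma gamma_ge0 m : 0 <= gamma m.
Proof. by rewrite -dot_covariance; exact: cov_ge0 hQ _ (sqint_basis m). Qed.

Lemma traceQE : traceQ a b e Q = limn (series gamma).
Proof.
rewrite /traceQ; congr (limn (series _)); apply/funext => m; exact: dot_covariance.
Qed.

Lemma coordinate_le1 m s : coordinate (e m) s ^+ 2 <= 1.
Proof.
rewrite -(basis_norm m); apply: le_trans _ (bessel (sqint_basis m)).
by rewrite (bigD1 s)//= lerDl sumr_ge0// => *; exact: sqr_ge0.
Qed.

Lemma cvg_energy s : cvgn (series (fun m => gamma m * coordinate (e m) s ^+ 2)).
Proof.
apply: series_le_cvg (cov_trace_class hQ) => m.
- by rewrite mulr_ge0 ?gamma_ge0 ?sqr_ge0.
- exact: gamma_ge0.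
- by rewrite ler_piMr ?gamma_ge0 ?coordinate_le1.
Qed.

Definition mode_energy s := limn (series (fun m => gamma m * coordinate (e m) s ^+ 2)).

(** The weights normalize the Legendre polynomials, so that the constant is the
    sum over the modes of [gamma m] times the square norm of the projection
    of [e m]. *)
Lemma Kconst_coordinates : Kconst k e gamma N x = \sum_(s : nI) mode_energy s.
Proof.
rewrite sum_pairE/=.
apply: eq_bigr => j _; apply: eq_bigr => l _.
have w0 := legendre_weight_gt0 (mesh_lt xmesh j) l.
have se m : sqint mu (cell j) (e m) by apply: (sqint_cell xmesh); exact: sqint_basis.
have E m : cell_dot x j (horner (legendre_cell x j l)) (fun y => Num.sqrt (gamma m) * e m y) ^+ 2
    = (legendre_weight x j l)^-1 * (gamma m * coordinate (e m) (j, l) ^+ 2).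
  rewrite cell_dotC -[cell_dot _ _ _ _]/(inner mu (cell j) _ _).
  rewrite (@innerZl _ (measurableTypeR R) R mu _ (mitv _))//; last exact: sqint_horner.
  rewrite -[inner _ _ _ _]/(cell_dot x j (e m) (horner (legendre_cell x j l))) cell_dotC.
  rewrite /coordinate /= cell_dotZl// !exprMn !sqr_sqrtr ?gamma_ge0 ?ltW//.
  by rewrite [RHS]mulrCA mulKf// gt_eqF.
have -> : [series (cell_dot x j (horner (legendre_cell x j l))
    (fun y => Num.sqrt (gamma m) * e m y)) ^+ 2]_m
  = series ((legendre_weight x j l)^-1 *: (fun m => gamma m * coordinate (e m) (j, l) ^+ 2)).
  by congr series; apply/funext => m; exact: E.
by rewrite lim_seriesZ ?mulVKf ?gt_eqF//; exact: cvg_energy.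
Qed.

End noise_coefficients.

Lemma cell_dot_coef {R : realType} k (x : nat -> R) j (q : {poly R}) f :
  (size q <= k.+1)%N -> sqint (@lebesgue_measure R) `[x j, x j.+1] f ->
  cell_dot x j (horner q) f = \sum_(l < k.+1) q`_l * cell_dot x j (horner 'X^l) f.
Proof.
move=> qk sf; have {1}-> : q = \sum_(l < k.+1) q`_l *: 'X^l.
  rewrite -poly_def; apply/polyP => i; rewrite coef_poly; case: ltnP => // ki.
  by rewrite nth_default// (leq_trans qk).
by rewrite cell_dot_suml//; apply: eq_bigr => l _; rewrite cell_dotZl.
Qed.

(** * The energy identity for the scheme *)

Section scheme_energy.
Context {R : realType} {d : measure_display} {Omega : measurableType d}.
Local Notation mu := (@lebesgue_measure R).
Variables (a b : R) (k : nat) (e : nat -> R -> R) (gamma : nat -> R).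
Variable Q : (R -> R) -> (R -> R).
Hypothesis he : orthonormal_basis a b e.
Hypothesis hQ : covariance_operator a b e gamma Q.
Variables (P : probability Omega R) (B : nat -> R -> Omega -> R).
Variables (N : nat) (x : nat -> R) (lambda1 lambda2 alpha T : R).
Variables (u0 eta0 : 'I_N -> {poly R}) (u eta : Omega -> R -> 'I_N -> {poly R}).
Hypothesis hB : independent_brownian_motions P B.
Hypothesis xmesh : mesh a b N x.
Hypothesis sol : dg_solution P a b e gamma B k x T lambda1 lambda2 alpha u0 eta0 u eta.
Variable t : R.
Hypothesis tT : 0 <= t <= T.
Local Notation nI := ('I_N * 'I_k.+1)%type.
Local Notation mitv D := (measurable_itv D : measurable ([set` D] : set (measurableTypeR R))).

(* The first component of an index tells [u] (true) from [eta] (false). *)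
Let z (c : bool) := if c then u else eta.
Let z0 (c : bool) := if c then u0 else eta0.
Let lam (c : bool) := if c then lambda2 else - lambda1.
Let al (c : bool) := if c then - alpha else alpha.
Let psi (s : nI) := unit_legendre x s.1 s.2.
Let coords (v : 'I_N -> {poly R}) (s : nI) := cell_dot x s.1 (horner (v s.1)) (horner (psi s)).
Let test (l : 'I_k.+1) (j : 'I_N) := unit_legendre x j l.
Let single (s : nI) (j : 'I_N) := if s.1 == j then unit_legendre x j s.2 else 0.

Let t0 : 0 <= t. Proof. by have /andP[] := tT. Qed.

Let process c : Vh_process P k T (z0 c) (z c).
Proof. by case: c; [exact: dg_u_process sol|exact: dg_eta_process sol]. Qed.

Let equation c : dg_equation P a b e gamma B k x T (lam c) (al c) (z c) (z (~~ c)).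
Proof. by case: c; [exact: dg_u_eq sol|exact: dg_eta_eq sol]. Qed.

Let in_T s : 0 <= s <= t -> 0 <= s <= T.
Proof. by move=> /andP[-> st]; have /andP[_] := tT; exact: le_trans. Qed.

Let state (i : bool * nI) (w : Omega) (s : R) : R :=
  if 0 <= s <= t then coords (z i.1 w s) i.2 else 0.
Let drift_matrix (i i' : bool * nI) : R :=
  if i.1 == i'.1 then 0 else dg_drift (al i.1) x (single i'.2) (test i.2.2) i.2.1.
Let rho (i : bool * nI) m : R := lam i.1 * coordinate x (e m) i.2.
Let noise (i : bool * nI) m : R := Num.sqrt (gamma m) * rho i m.

Let test_Vh l : in_Vh k (test l).
Proof.
move=> j; apply: leq_trans (size_unit_legendre (mesh_lt xmesh j) _) _; exact: ltn_ord.
Qed.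

Let drift_matrixE (y : bool * nI -> R) i : \sum_i' drift_matrix i i' * y i'
  = dg_drift (al i.1) x (synthesis x (fun s => y (~~ i.1, s))) (test i.2.2) i.2.1.
Proof.
rewrite sum_pairE big_bool/= /synthesis dg_drift_suml /drift_matrix /=.
case: i => [[] s] /=.
  rewrite [X in X + _]big1 ?add0r => [|i _]; last by rewrite mul0r.
  by apply: eq_bigr => i _; rewrite mulrC.
rewrite [X in _ + X]big1 ?addr0 => [|i _]; last by rewrite mul0r.
by apply: eq_bigr => i _; rewrite mulrC.
Qed.

Let drift_skew (y : bool * nI -> R) : \sum_i (\sum_j drift_matrix i j * y j) * y i = 0.
Proof.
pose F c := synthesis x (fun s => y (c, s)).
have E c : \sum_s (\sum_j drift_matrix (c, s) j * y j) * y (c, s)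
    = \sum_j dg_drift (al c) x (F (~~ c)) (F c) j.
  rewrite sum_pairE; apply: eq_bigr => j _.
  rewrite (@dg_drift_local _ _ _ _ _ _ (fun j' => \sum_l y (c, (j, l)) *: test l j')); last first.
    by rewrite /F synthesisE.
  rewrite dg_drift_sumr; apply: eq_bigr => l _.
  by rewrite drift_matrixE mulrC.
rewrite sum_pairE big_bool/= !E -big_split/=.
exact: (dg_drift_skew xmesh alpha (F true) (F false)).
Qed.

Let state_measurable i : jointly_measurable (state i).
Proof.
have [vk _ mv _] := process i.1.
pose D : set (Omega * R) := setT `*` `[0, t].
pose g (p : Omega * R) := \sum_(l < k.+1) (z i.1 p.1 p.2 i.2.1)`_l
  * cell_dot x i.2.1 (horner 'X^l) (horner (psi i.2)).
have mD : measurable D by exact: measurableX.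
have mg : measurable_fun D g.
  apply: measurable_sum => l; apply: measurable_funM => //.
  apply: measurable_funS (mv _ _); first exact: measurableX.
  by move=> p /= [_]; rewrite !in_itv/= => /in_T.
move/(measurable_restrictT g mD): mg; rewrite /jointly_measurable.
congr measurable_fun; apply/funext => p; rewrite patchE /state.
have -> : (p \in D) = (0 <= p.2 <= t).
  by apply/idP/idP; rewrite inE /D/= in_itv/= => //; case.
case: ifP => // pt; rewrite /g /coords -cell_dot_coef//; last exact: sqint_horner.
by apply: vk; exact: in_T.
Qed.

Let state_continuous : {ae P, forall w, forall i, {within `[0, t], continuous (state i w)}}.
Proof.
have [vk1 _ _ cu] := process true; have [vk2 _ _ ce] := process false.
apply: filterS2 cu ce => w cu ce i.
have cz j l : {within `[0, t], continuous (fun s => (z i.1 w s j)`_l)}.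
  apply: (@continuous_subspaceW _ _ _ `[0, T]).
    by move=> s /=; rewrite !in_itv/=; exact: in_T.
  by case: i.1; [exact: cu|exact: ce].
apply: (@subspace_eq_continuous _ _ _ (fun s => \sum_(l < k.+1) (z i.1 w s i.2.1)`_l
  * cell_dot x i.2.1 (horner 'X^l) (horner (psi i.2)))).
  move=> s; rewrite inE/= in_itv/= => st.
  suff E : state i w s = \sum_(l < k.+1) (z i.1 w s i.2.1)`_l
    * cell_dot x i.2.1 (horner 'X^l) (horner (psi i.2)) by exact/esym.
  rewrite /state st /coords -cell_dot_coef//; last exact: sqint_horner.
  by case: i.1; [exact: vk1 _ _ (in_T st) _|exact: vk2 _ _ (in_T st) _].
elim: (index_enum _) => [|l s IH].
  rewrite (_ : (fun q => _) = fun=> 0); last by apply/funext => q; rewrite big_nil.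
  by apply: continuous_subspaceT => y; exact: cvg_cst.
rewrite (_ : (fun q => _) = fun q => (z i.1 w q i.2.1)`_l
  * cell_dot x i.2.1 (horner 'X^l) (horner (psi i.2)) + \sum_(l <- s) (z i.1 w q i.2.1)`_l
  * cell_dot x i.2.1 (horner 'X^l) (horner (psi i.2))); last first.
  by apply/funext => q; rewrite big_cons.
move=> y; apply: cvgD; last exact: IH.
by apply: cvgM; [exact: cz|exact: cvg_cst].
Qed.

Let noise_summable i : cvgn (series (fun m => noise i m ^+ 2)).
Proof.
rewrite (_ : (fun m => _) = (lam i.1 ^+ 2) *: (fun m => gamma m * coordinate x (e m) i.2 ^+ 2)).
  by apply: is_cvg_seriesZ; exact: (cvg_energy xmesh he hQ).
apply/funext => m; rewrite /noise /rho !exprMn sqr_sqrtr ?(gamma_ge0 he hQ)//.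
by rewrite mulrCA.
Qed.

Let noise_martingale : exists M : (bool * nI) -> R -> Omega -> R,
  forall i s, 0 <= s <= t ->
  [/\ measurable_fun setT (M i s),
     cvgL2 P (fun n w => \sum_(m < n) noise i m * incr B m 0 s w) (M i s) &
     {ae P, forall w, state i w s = coords (z0 i.1) i.2
       + \int[mu]_(q in `[0, s]) (\sum_j drift_matrix i j * state j w q) + M i s w}].
Proof.
suff h i s : exists M, 0 <= s <= t -> [/\ measurable_fun setT M,
     cvgL2 P (fun n w => \sum_(m < n) noise i m * incr B m 0 s w) M &
     {ae P, forall w, state i w s = coords (z0 i.1) i.2
       + \int[mu]_(q in `[0, s]) (\sum_j drift_matrix i j * state j w q) + M w}].
  have [M hM] := choice (fun p => h p.1 p.2); exists (fun i s => M (i, s)) => i s; exact: (hM (i, s)).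
have [st|] := boolP (0 <= s <= t); last by move=> _; exists (fun=> 0).
have [S [wS aeS]] := equation i.1 i.2.1 (test_Vh i.2.2) (in_T st).
exists S => _; have /andP[s0 _] := st.
have [mS cS] := wiener_integral_cst hB s0 wS.
split => //.
  move: cS; congr cvgL2; apply/funext => n; apply/funext => w; apply: eq_bigr => m _.
  rewrite /noise /rho; congr (_ * _ * _).
  rewrite -[LHS]/(inner mu `[a, b] _ _).
  rewrite (@innerZl _ (measurableTypeR R) R mu _ (mitv _)); last 2 first.
  - exact: sqint_indic_poly.
  - exact: sqint_basis he m.
  congr (_ * _); rewrite -[LHS]/(dotL2 a b _ (e m)).
  exact: (dotL2_closed_cell xmesh).
have [vk v0 _ _] := process i.1; have [vk' _ _ _] := process (~~ i.1).
apply: filterS aeS => w; rewrite v0 => /eqP; rewrite subr_eq => /eqP h.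
have -> : state i w s = cell_dot x i.2.1 (horner (z i.1 w s i.2.1))
    (horner (test i.2.2 i.2.1)) by rewrite /state st.
rewrite h addrC addrA; congr (_ + _ + _).
apply: eq_Rintegral => q; rewrite inE/= in_itv/= => /andP[q0 qs].
have qt : 0 <= q <= t by rewrite q0 (le_trans qs)//; have /andP[] := st.
have E : z (~~ i.1) w q = synthesis x (fun s => state (~~ i.1, s) w q).
  rewrite {1}(Vh_expansion xmesh (vk' w q (in_T qt))); congr synthesis.
  by apply/funext => s'; rewrite /state/= qt.
by rewrite drift_matrixE E.
Qed.

Let energyE (v : bool -> 'I_N -> {poly R}) : (forall c, in_Vh k (v c)) ->
  \sum_(i : bool * nI) coords (v i.1) i.2 ^+ 2
  = Vh_sqnorm a b x (v true) + Vh_sqnorm a b x (v false).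
Proof.
move=> vk; rewrite sum_pairE big_bool/=.
by rewrite !(Vh_sqnorm_coordinates xmesh (vk _)) !sum_pairE.
Qed.

Let rateE : \sum_i noise_rate noise i
  = (lambda1 ^+ 2 + lambda2 ^+ 2) * Kconst k e gamma N x.
Proof.
have E c s : noise_rate noise (c, s) = lam c ^+ 2 * mode_energy x e gamma s.
  rewrite /noise_rate (_ : (fun m => _) = (lam c ^+ 2) *:
    (fun m => gamma m * coordinate x (e m) s ^+ 2)).
    by rewrite lim_seriesZ//; exact: (cvg_energy xmesh he hQ).
  apply/funext => m; rewrite /noise /rho !exprMn sqr_sqrtr ?(gamma_ge0 he hQ)//.
  by rewrite mulrCA.
rewrite sum_pairE big_bool/=; under eq_bigr do rewrite E.
under [X in _ + X]eq_bigr do rewrite E.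
rewrite -!mulr_sumr -(Kconst_coordinates k xmesh he hQ) /lam sqrrN; ring.
Qed.

Let dot_solution m w s : 0 <= s <= t ->
  \sum_i rho i m * state i w s
  = dotL2 a b (fun y => lambda2 * Vh_fun x (u w s) y - lambda1 * Vh_fun x (eta w s) y) (e m).
Proof.
move=> st; have [vk1 _ _ _] := process true; have [vk2 _ _ _] := process false.
have sb := sqint_basis he m.
have sv (v : 'I_N -> {poly R}) := sqint_Vh_fun a b x v.
have sZ c (v : 'I_N -> {poly R}) := @sqintZ _ (measurableTypeR R) R mu _ (mitv `[a, b]) c _ (sv v).
have -> : (fun y => lambda2 * Vh_fun x (u w s) y - lambda1 * Vh_fun x (eta w s) y)
  = (fun y => lambda2 * Vh_fun x (u w s) y + - lambda1 * Vh_fun x (eta w s) y).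
  by apply/funext => y; rewrite mulNr.
rewrite -[RHS]/(inner mu `[a, b] _ _) (@innerDl _ (measurableTypeR R) R mu _ (mitv _))//.
rewrite !(@innerZl _ (measurableTypeR R) R mu _ (mitv _))//.
rewrite -/(dotL2 a b (Vh_fun x (u w s)) (e m)) -/(dotL2 a b (Vh_fun x (eta w s)) (e m)).
have eu : u w s = _ := Vh_expansion xmesh (vk1 w s (in_T st)).
have ee : eta w s = _ := Vh_expansion xmesh (vk2 w s (in_T st)).
rewrite [X in lambda2 * dotL2 _ _ (Vh_fun x X) _]eu [X in - lambda1 * dotL2 _ _ (Vh_fun x X) _]ee.
rewrite !(dotL2_synthesis xmesh)// sum_pairE big_bool/= !mulr_sumr.
by congr (_ + _); apply: eq_bigr => j _; rewrite /rho /state st /coords /=; ring.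
Qed.

Lemma scheme_energy :
  (exists S : Omega -> R,
    wiener_integral P B a b e gamma
      (fun w s y => lambda2 * Vh_fun x (u w s) y - lambda1 * Vh_fun x (eta w s) y) t S /\
    {ae P, forall w,
      Vh_sqnorm a b x (u w t) + Vh_sqnorm a b x (eta w t)
      = 2 * S w + Vh_sqnorm a b x u0 + Vh_sqnorm a b x eta0
        + (lambda1 ^+ 2 + lambda2 ^+ 2) * Kconst k e gamma N x * t}) /\
  ('E_P[fun w => (Vh_sqnorm a b x (u w t) + Vh_sqnorm a b x (eta w t))%R])%E
  = (Vh_sqnorm a b x u0 + Vh_sqnorm a b x eta0
     + (lambda1 ^+ 2 + lambda2 ^+ 2) * Kconst k e gamma N x * t)%:E.
Proof.
have [M hM] := noise_martingale.
have U0 i w : state i w 0 = coords (z0 i.1) i.2.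
  by rewrite /state lexx t0; have [_ -> _ _] := process i.1.
have mM i s : 0 <= s <= t -> measurable_fun setT (M i s) by move=> /(hM i)[].
have cM i s : 0 <= s <= t ->
    cvgL2 P (fun n w => \sum_(m < n) noise i m * incr B m 0 s w) (M i s) by move=> /(hM i)[].
have eM i s : 0 <= s <= t -> {ae P, forall w, state i w s = coords (z0 i.1) i.2
    + \int[mu]_(q in `[0, s]) (\sum_j drift_matrix i j * state j w q) + M i s w}.
  by move=> /(hM i)[].
have [S [J [iJ mS cS aeS ES]]] := linear_energy_identity hB t0 noise_summable
  state_measurable state_continuous U0 mM cM eM (fun i m => erefl) drift_skew.
have [w0 _] : [set: Omega] !=set0.
  apply/set0P/eqP => O0; have := probability_setT P.
  by rewrite O0 measure0 => /eqP; rewrite eqe eq_sym oner_eq0.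
have tt : 0 <= t <= t by rewrite t0 lexx.
have end_energy w : \sum_i state i w t ^+ 2
    = Vh_sqnorm a b x (u w t) + Vh_sqnorm a b x (eta w t).
  rewrite -(energyE (v := fun c => z c w t)).
    by apply: eq_bigr => i _; rewrite /state tt.
  by move=> c; have [h _ _ _] := process c; apply: h; exact: in_T.
have start_energy : \sum_i coords (z0 i.1) i.2 ^+ 2
    = Vh_sqnorm a b x u0 + Vh_sqnorm a b x eta0.
  rewrite -(energyE (v := z0))// => c; have [h h0 _ _] := process c.
  by rewrite -(h0 w0); apply: h; apply: in_T; rewrite lexx t0.
split.
  exists S; split.
    split; [exact: mS|exists J; split; [move=> m|exact: cS]].
    by apply: ito_integral_ext (iJ m) => w s st; exact: dot_solution.
  by apply: filterS aeS => w; rewrite end_energy start_energy rateE => ->; ring.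
rewrite -rateE -start_energy -ES; congr expectation.
by apply/funext => w; rewrite end_energy.
Qed.

End scheme_energy.

(** * Comparison of the constant with the trace *)

Section trace_comparison.
Context {R : realType}.
Local Notation mu := (@lebesgue_measure R).
Variables (a b : R) (k : nat) (e : nat -> R -> R) (gamma : nat -> R).
Variable Q : (R -> R) -> (R -> R).
Hypothesis hab : a < b.
Hypothesis he : orthonormal_basis a b e.
Hypothesis hQ : covariance_operator a b e gamma Q.
Local Notation mitv D := (measurable_itv D : measurable ([set` D] : set (measurableTypeR R))).

Section fixed_mesh.
Variables (N : nat) (x : nat -> R).
Hypothesis xmesh : mesh a b N x.
Local Notation nI := ('I_N * 'I_k.+1)%type.

(** The square norm of the projection of [e m] on [V_h^k]. *)
Definition captured m := \sum_(s : nI) coordinate x (e m) s ^+ 2.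

Lemma captured_le1 m : captured m <= 1.
Proof. by rewrite -(basis_norm he m); exact: (bessel k xmesh (sqint_basis he m)). Qed.

Lemma cvg_captured : series (fun m => gamma m * captured m) @ \oo --> Kconst k e gamma N x.
Proof.
rewrite (Kconst_coordinates k xmesh he hQ) /captured.
elim: (index_enum _) => [|s l IH].
  rewrite big_nil (_ : series _ = fun=> 0); first exact: cvg_cst.
  by apply/funext => n; rewrite seriesEord/= big1// => m _; rewrite big_nil mulr0.
rewrite big_cons.
rewrite (_ : series _ = series (fun m => gamma m * coordinate x (e m) s ^+ 2)
  + series (fun m => gamma m * \sum_(i <- l) coordinate x (e m) i ^+ 2)); last first.
  rewrite -seriesD; congr series; apply/funext => m.
  by rewrite big_cons mulrDr.
by apply: cvgD => //; exact: (cvg_energy xmesh he hQ).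
Qed.

Lemma trace_gap : series (fun m => gamma m * (1 - captured m)) @ \oo
  --> traceQ a b e Q - Kconst k e gamma N x.
Proof.
rewrite (traceQE he hQ) (_ : series (fun m => gamma m * (1 - captured m))
  = series gamma - series (fun m => gamma m * captured m)).
  by apply: cvgB; [exact: cov_trace_class hQ|exact: cvg_captured].
apply/funext => n; rewrite !fctE !seriesEord -sumrB.
by apply: eq_bigr => m _; rewrite mulrBr mulr1.
Qed.

Lemma gap_term_ge0 m : 0 <= gamma m * (1 - captured m).
Proof. by rewrite mulr_ge0 ?(gamma_ge0 he hQ)// subr_ge0 captured_le1. Qed.

Lemma Kconst_le_trace : Kconst k e gamma N x <= traceQ a b e Q.
Proof.
rewrite -subr_ge0 -(cvg_lim _ trace_gap)//; apply: limr_ge.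
  by apply/cvg_ex; eexists; exact: trace_gap.
by apply: nearW => n; rewrite seriesEord; apply: sumr_ge0 => m _; exact: gap_term_ge0.
Qed.

Lemma gap_le c : (forall n, \sum_(m < n) gamma m * (1 - captured m) <= c) ->
  `|Kconst k e gamma N x - traceQ a b e Q| <= c.
Proof.
move=> h; rewrite distrC ger0_norm ?subr_ge0 ?Kconst_le_trace//.
rewrite -(cvg_lim _ trace_gap)//; apply: limr_le.
  by apply/cvg_ex; eexists; exact: trace_gap.
by apply: nearW => n; rewrite seriesEord; exact: h.
Qed.

Lemma mesh_size_ge (j : 'I_N) : cell_size x j <= mesh_size N x.
Proof. exact: le_bigmax. Qed.

Lemma mesh_locate z n : (n <= N)%N -> a <= z < x n ->
  exists j : 'I_N, x j <= z < x j.+1.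
Proof.
have [x0 _ _] := xmesh.
elim: n => [_|n IH nN]; first by rewrite x0 => /andP[az za]; move: za; rewrite ltNge az.
move=> /andP[az zn]; have [nz|zn'] := leP (x n) z.
  by exists (Ordinal nN) => /=; rewrite nz.
by apply: IH; [exact: ltnW|rewrite az].
Qed.

Lemma mesh_size_gt0 : 0 < mesh_size N x.
Proof.
have [_ xN _] := xmesh.
have [|j _] := @mesh_locate a N (leqnn _); first by rewrite lexx xN.
by apply: lt_le_trans (mesh_size_ge j); rewrite subr_gt0; exact: mesh_lt xmesh j.
Qed.

Lemma negligible_nodes : mu.-negligible [set z | exists2 i, (i <= N)%N & z = x i].
Proof.
have nb : mu.-negligible (\bigcup_i [set x i]).
  by apply: negligible_bigcup => i; apply/negligibleP => //; exact: lebesgue_measure_set1.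
by apply: negligibleS nb => z [i _ ->]; exists i.
Qed.

(** Away from the nodes, a [kappa]-Lipschitz function is within [kappa * h] of
    its values at the midpoints of the cells. *)
Lemma captured_lipschitz m kappa : 0 <= kappa ->
  (forall y z, a < y < b -> a < z < b -> `|e m y - e m z| <= kappa * `|y - z|) ->
  1 - captured m <= (b - a) * (kappa * mesh_size N x) ^+ 2.
Proof.
move=> k0 lip; have sf := sqint_basis he m.
pose mid j := (x j + x j.+1) / 2.
pose v (j : 'I_N) : {poly R} := (e m (mid j))%:P.
have vk : in_Vh k v by move=> j; apply: leq_trans (size_polyC_leq1 _) _.
rewrite -(basis_norm he m); apply: le_trans (best_approximation xmesh vk sf) _.
have sv := sqint_Vh_fun a b x v.
have sB := @sqintB _ (measurableTypeR R) R mu _ (mitv _) _ _ sf sv.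
set c := (kappa * _) ^+ 2.
have c0 : 0 <= c by exact: sqr_ge0.
rewrite -lee_fin fineK; last exact: integrable_fin_num sB.2.
apply: (@le_trans _ _ (\int[mu]_(z in `[a, b]) c%:E)%E); last first.
  rewrite integral_cst//= lebesgue_measure_itv/= lte_fin hab -EFinB -EFinM.
  by rewrite lee_fin mulrC.
apply: ae_ge0_le_integral => //.
- by move=> z _; rewrite lee_fin sqr_ge0.
- exact: measurable_int sB.2.
apply: negligibleS negligible_nodes => z /= hz; apply: contrapT => nz; apply: hz => zab.
move: zab; rewrite in_itv/= => /andP[az zb].
have [_ xN _] := xmesh.
have [|j /andP[jz zj]] := @mesh_locate z N (leqnn _).
  rewrite az xN lt_neqAle zb andbT/=; apply/eqP => zb'; apply: nz; exists N => //.
  by rewrite xN.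
have jz' : x j < z.
  by rewrite lt_neqAle jz andbT; apply/eqP => e'; apply: nz; exists j => //; exact: ltnW.
rewrite (Vh_fun_cell xmesh _ (j := j)) ?jz'// /v hornerC lee_fin.
have jj := mesh_lt xmesh j.
have jmid : x j < mid j < x j.+1 by rewrite /mid; lra.
have inI y : x j < y < x j.+1 -> a < y < b.
  move=> /andP[jy yj]; have [x0 _ _] := xmesh.
  have h1 : a <= x j by rewrite -x0; apply: (mesh_le xmesh); rewrite /= ltnW.
  have h2 : x j.+1 <= b by rewrite -xN; apply: (mesh_le xmesh); rewrite ltn_ord leqnn.
  by rewrite (le_lt_trans h1 jy) (lt_le_trans yj h2).
rewrite -real_normK ?num_real// /c lerXn2r ?nnegrE ?mulr_ge0 ?(ltW mesh_size_gt0)//.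
apply: le_trans (lip _ _ (inI _ _) (inI _ _)) _ => //; first by rewrite jz'.
rewrite ler_wpM2l// (le_trans _ (mesh_size_ge j))// ler_norml /cell_size.
by move: jmid; lra.
Qed.

End fixed_mesh.

Lemma Kconst_le N x : mesh a b N x -> Kconst k e gamma N x <= k.+1%:R * traceQ a b e Q.
Proof.
move=> xmesh; apply: le_trans (Kconst_le_trace xmesh) _.
rewrite ler_peMl ?ler1n// (traceQE he hQ); apply: limr_ge.
  exact: cov_trace_class hQ.
apply: nearW => n; rewrite seriesEord; apply: sumr_ge0 => m _; exact: gamma_ge0 he hQ m.
Qed.

Lemma lipschitz_of_sup_norm m kappa : (forall y, a < y < b -> derivable (e m) y 1) ->
  (deriv_sup_norm a b (e m) <= kappa%:E)%E ->
  forall y z, a < y < b -> a < z < b -> `|e m y - e m z| <= kappa * `|y - z|.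
Proof.
move=> de supk.
have main y z : a < y < b -> a < z < b -> y < z -> `|e m y - e m z| <= kappa * `|y - z|.
  move=> /andP[ay yb] /andP[az zb] yz.
  have inI q : q \in `[y, z] -> a < q < b.
    by rewrite in_itv/= => /andP[yq qz]; rewrite (lt_le_trans ay)// (le_lt_trans qz).
  rewrite distrC (distrC y).
  have [||c cyz ->] := @MVT R (e m) (fun q => (e m)^`()%classic q) y z yz.
  - move=> q /subset_itv_oo_cc qyz; apply: DeriveDef; first exact/de/inI.
    by rewrite derive1E.
  - by apply: derivable_within_continuous => q /inI; exact: de.
  rewrite normrM ler_wpM2r// -lee_fin; apply: le_trans supk.
  apply: ereal_sup_ubound; exists c => //=.
  by rewrite in_itv/= inI// subset_itv_oo_cc.
move=> y z hy hz; have [yz|zy|->] := ltgtP y z; first exact: main.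
  by rewrite distrC (distrC y); exact: main.
by rewrite !subrr normr0 mulr0.
Qed.

Lemma min1_sqr_powR (y beta : R) : 0 <= y -> 0 < beta <= 2 ->
  Num.min 1 (y ^+ 2) <= y `^ beta.
Proof.
move=> y0 /andP[b0 b2]; have [y1|y1] := leP 1 y.
  rewrite ge_min; apply/orP; left; rewrite -[leLHS](powRr0 y).
  exact: ler_powR y1 _ _ (ltW b0).
rewrite ge_min; apply/orP; right; rewrite -powR_mulrn//.
move: y0; rewrite le_eqVlt => /predU1P[<-|y0].
  by rewrite powR0 ?powR_ge0// pnatr_eq0.
by apply: ger_powR; rewrite ?y0 ?(ltW y1).
Qed.

Lemma sqr_le_powR (y beta : R) : 0 <= y -> 2 <= beta -> y ^+ 2 <= 1 + y `^ beta.
Proof.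
move=> y0 b2; have [y1|y1] := leP 1 y.
  by rewrite -powR_mulrn// (le_trans (ler_powR y1 b2))// lerDr.
by rewrite ler_wpDr ?powR_ge0// exprn_ile1// ltW.
Qed.

(** The rate is at most quadratic: [1 - captured m] is both at most [1] and at
    most of order [(kappa h)^2]; interpolate between the two for [beta <= 2], and
    use [kappa^2 <= 1 + kappa^beta] otherwise. *)
Lemma gap_rate (h kappa beta p : R) : 0 < h -> 0 <= kappa -> 0 < beta ->
  p <= 1 -> p <= (b - a) * (kappa * h) ^+ 2 ->
  p <= (1 + (b - a)) * (h `^ Num.min beta 2 * (1 + kappa `^ beta)).
Proof.
move=> h0 k0 b0 p1 p2; have ba0 : 0 <= b - a by rewrite subr_ge0 ltW.
have B0 : 0 <= 1 + (b - a) by rewrite addr_ge0.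
have hp := powR_ge0 h (Num.min beta 2).
have [b2|b2] := leP beta 2.
  have pm : p <= (1 + (b - a)) * Num.min 1 ((kappa * h) ^+ 2).
    have s0 := sqr_ge0 (kappa * h).
    have [m1|m1] := leP 1 ((kappa * h) ^+ 2); nra.
  apply: le_trans pm _; rewrite ler_wpM2l//.
  have b02 : 0 < beta <= 2 by rewrite b0.
  apply: le_trans (min1_sqr_powR (mulr_ge0 k0 (ltW h0)) b02) _.
  rewrite powRM ?(ltW h0)// mulrC ler_wpM2l ?powR_ge0//.
  by rewrite lerDr.
have -> : h `^ 2 = h ^+ 2 by rewrite -powR_mulrn// ltW.
have := sqr_le_powR k0 (ltW b2); have := sqr_ge0 h; have := powR_ge0 kappa beta.
rewrite exprMn in p2 => q0 hh0 hk.
apply: le_trans p2 _.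
have e1 : kappa ^+ 2 * h ^+ 2 <= h ^+ 2 * (1 + kappa `^ beta) by rewrite mulrC ler_wpM2l.
apply: (@le_trans _ _ ((b - a) * (h ^+ 2 * (1 + kappa `^ beta)))); first by rewrite ler_wpM2l.
by rewrite ler_wpM2r ?lerDr// mulr_ge0// addr_ge0.
Qed.

Lemma deriv_sup_norm_ge0 m : (0 <= deriv_sup_norm a b (e m))%E.
Proof.
apply: (@le_trans _ _ (`|derive1 (e m) ((a + b) / 2)|%:E)); first by rewrite lee_fin.
apply: ereal_sup_ubound; exists ((a + b) / 2) => //=; rewrite in_itv/=.
by have := hab; lra.
Qed.

(** The summability hypothesis forces [gamma m = 0] for the modes whose derivative
    is unbounded; for the others the rate is applied and weighted by [gamma m]. *)
Lemma Kconst_rate beta : 0 < beta -> (forall m y, a < y < b -> derivable (e m) y 1) ->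
  (\sum_(0 <= m <oo) ((gamma m)%:E * deriv_sup_norm a b (e m) `^ beta) < +oo)%E ->
  exists C, forall N x, mesh a b N x ->
    `|Kconst k e gamma N x - traceQ a b e Q| <= C * mesh_size N x `^ Num.min beta 2.
Proof.
move=> b0 de fin.
pose q m := (deriv_sup_norm a b (e m) `^ beta)%E.
have q0 m : (0 <= q m)%E by exact: poweR_ge0.
have g0 := gamma_ge0 he hQ.
have gq0 m : (0 <= (gamma m)%:E * q m)%E by rewrite mule_ge0// lee_fin.
have partial n : (\sum_(m < n) (gamma m)%:E * q m
    <= \sum_(0 <= m <oo) ((gamma m)%:E * q m))%E.
  by rewrite -(big_mkord predT (fun m => (gamma m)%:E * q m)%E); exact: nneseries_lim_ge.
pose L := fine (\sum_(0 <= m <oo) ((gamma m)%:E * q m))%E.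
have LE : (\sum_(0 <= m <oo) ((gamma m)%:E * q m))%E = L%:E.
  by rewrite fineK// ge0_fin_numE//; exact: nneseries_ge0.
have term m : ((gamma m)%:E * q m <= L%:E)%E.
  rewrite -LE; apply: le_trans (partial m.+1); rewrite big_ord_recr/= leeDr//.
  exact: sume_ge0.
have sup_fin m : 0 < gamma m -> exists2 kappa, 0 <= kappa &
    deriv_sup_norm a b (e m) = kappa%:E.
  move=> gm; have := deriv_sup_norm_ge0 m; have := term m; rewrite /q.
  case: (deriv_sup_norm a b (e m)) => [r _|h|]//=; first by rewrite lee_fin; exists r.
  by move: h; rewrite poweRyr ?gt_eqF// gt0_muley ?lte_fin.
pose r m := fine ((gamma m)%:E * q m).
have rE m : (r m)%:E = ((gamma m)%:E * q m)%E.
  by rewrite fineK// ge0_fin_numE// (le_lt_trans (term m)) ?ltry.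
have r0 m : 0 <= r m by rewrite -lee_fin rE.
have rsum n : \sum_(m < n) r m <= L.
  rewrite -lee_fin -LE -sumEFin; apply: le_trans (partial n).
  by apply: lee_sum => m _; rewrite rE.
have gsum n : \sum_(m < n) gamma m <= traceQ a b e Q.
  rewrite (traceQE he hQ) (_ : \sum_(m < n) gamma m = series gamma n); last by rewrite seriesEord.
  apply: nondecreasing_cvgn_le; last exact: cov_trace_class hQ.
  by apply/nondecreasing_seqP => m; rewrite !seriesEord/= big_ord_recr/= lerDl.
exists ((1 + (b - a)) * (traceQ a b e Q + L)) => N x xmesh.
have h0 := mesh_size_gt0 xmesh; set H := mesh_size N x `^ _.
have H0 : 0 <= H by exact: powR_ge0.
have M0 : 0 <= 1 + (b - a) by rewrite addr_ge0// subr_ge0 ltW.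
apply: (gap_le xmesh) => n.
apply: (@le_trans _ _ (\sum_(m < n) (1 + (b - a)) * H * (gamma m + r m))).
  apply: ler_sum => m _.
  have := g0 m; rewrite le_eqVlt => /predU1P[gm|gm].
    by rewrite -gm mul0r add0r mulr_ge0// mulr_ge0.
  have [kappa k0 sk] := sup_fin m gm.
  have -> : r m = gamma m * kappa `^ beta.
    by apply: EFin_inj; rewrite rE /q sk poweR_EFin.
  rewrite [leRHS](_ : _ = gamma m * ((1 + (b - a)) * (H * (1 + kappa `^ beta)))); last by ring.
  rewrite ler_wpM2l//; apply: gap_rate => //.
    by rewrite gerBl; apply: sumr_ge0 => s _; exact: sqr_ge0.
  apply: (captured_lipschitz xmesh) => //.
  by apply: lipschitz_of_sup_norm; [exact: de|rewrite sk].
rewrite -mulr_sumr big_split/= [leRHS]mulrAC ler_wpM2l ?mulr_ge0//.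
exact: lerD (gsum n) (rsum n).
Qed.

End trace_comparison.

Unset Implicit Arguments.
Set Strict Implicit.

Theorem theorem2p2 (R : realType) (a b : R) (k : nat)
    (e : nat -> R -> R) (gamma : nat -> R) (Q : (R -> R) -> (R -> R))
    (hab : a < b) (he : orthonormal_basis a b e)
    (hQ : covariance_operator a b e gamma Q) :
  (forall (d : measure_display) (Omega : measurableType d)
      (P : probability Omega R) (B : nat -> R -> Omega -> R)
      (N : nat) (x : nat -> R) (lambda1 lambda2 alpha T : R)
      (u0 eta0 : 'I_N -> {poly R}) (u eta : Omega -> R -> 'I_N -> {poly R}),
    independent_brownian_motions P B ->
    mesh a b N x ->
    -1 <= alpha <= 1 -> alpha != 0 ->
    dg_solution P a b e gamma B k x T lambda1 lambda2 alpha u0 eta0 u eta ->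
    forall t, 0 <= t <= T ->
      (exists S : Omega -> R,
        wiener_integral P B a b e gamma
          (fun w s y => lambda2 * Vh_fun x (u w s) y
                        - lambda1 * Vh_fun x (eta w s) y) t S /\
        {ae P, forall w,
          Vh_sqnorm a b x (u w t) + Vh_sqnorm a b x (eta w t)
          = 2 * S w + Vh_sqnorm a b x u0 + Vh_sqnorm a b x eta0
            + (lambda1 ^+ 2 + lambda2 ^+ 2) * Kconst k e gamma N x * t}) /\
      ('E_P[fun w => (Vh_sqnorm a b x (u w t) + Vh_sqnorm a b x (eta w t))%R])%E
      = (Vh_sqnorm a b x u0 + Vh_sqnorm a b x eta0
         + (lambda1 ^+ 2 + lambda2 ^+ 2) * Kconst k e gamma N x * t)%:E) /\
  (forall (N : nat) (x : nat -> R), mesh a b N x ->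
    Kconst k e gamma N x <= k.+1%:R * traceQ a b e Q) /\
  (* The order cannot exceed 2 in general, whatever beta: for k = 0 and a smooth
     nonconstant e_m with gamma_m > 0, the difference is of exact order h^2. *)
  (forall beta : R, 0 < beta ->
    (forall m y, a < y < b -> derivable (e m) y 1) ->
    (\sum_(0 <= m <oo) ((gamma m)%:E * deriv_sup_norm a b (e m) `^ beta)
       < +oo)%E ->
    forall sigma : R, exists C delta : R, 0 < delta /\
      forall (N : nat) (x : nat -> R), mesh a b N x ->
        (forall j, (j < N)%N -> mesh_size N x <= sigma * cell_size x j) ->
        mesh_size N x < delta ->
        `|Kconst k e gamma N x - traceQ a b e Q|
          <= C * mesh_size N x `^ Num.min beta 2).
Proof.
split; last split.
- move=> d Omega P B N x lambda1 lambda2 alpha T u0 eta0 u eta hB hx _ _ sol t tT.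
  exact: (scheme_energy he hQ hB hx sol tT).
- by move=> N x hx; exact: (Kconst_le k he hQ hx).
- move=> beta beta0 de fin sigma.
  have [C hC] := Kconst_rate k hab he hQ beta0 de fin.
  by exists C, 1; split => // N x hx _ _; exact: hC.
Qed.
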